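(* Let $\varphi$ be a bounded analytic function on the open unit disc $\mathbb D$ and let $T_\varphi$ be the analytic Toeplitz operator on the Hardy space $H^2(\mathbb D)$ defined by $T_\varphi f=\varphi\cdot f$. If the symbol $\varphi$ is not constant, then the adjoint operator $T_\varphi^*$ has rich point spectrum.
   Context: $\sigma_p(T)$ denotes the point spectrum (set of eigenvalues) of $T$. A bounded linear operator $T$ on a complex Banach space $E$ has rich point spectrum if $\sigma_p(T)$ has nonempty interior and for every (nonempty) open disc $D\subseteq\sigma_p(T)$ the family of eigenvectors $\bigcup_{z\in D}\ker(T-z)$ is a total set, i.e. its linear span is dense in $E$. *)

(* Defs.v *)
From Stdlib Require Import Reals Lra Lia.
From Stdlib Require Import ClassicalEpsilon FunctionalExtensionality.
From Stdlib Require Import PropExtensionality ProofIrrelevance.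
From Coquelicot Require Import Coquelicot.

Open Scope R_scope.

(** * Rich point spectrum *)

Section RichPointSpectrum.

Context {E : CompleteNormedModule C_AbsRing}.

Definition open_disc (c : C) (r : R) (z : C) : Prop := Cmod (z - c) < r.

Definition ker_shift (T : E -> E) (z : C) (x : E) : Prop :=
  minus (T x) (scal z x) = zero.

Definition point_spectrum (T : E -> E) (z : C) : Prop :=
  exists x : E, x <> zero /\ ker_shift T z x.

Inductive lin_span (S : E -> Prop) : E -> Prop :=
| lin_span_zero : lin_span S zero
| lin_span_cons (k : C) (x y : E) :
    S x -> lin_span S y -> lin_span S (plus (scal k x) y).

Definition total (S : E -> Prop) : Prop :=
  forall (x : E) (eps : R), 0 < eps ->
    exists y : E, lin_span S y /\ norm (minus y x) < eps.

(* [is_linear] is Coquelicot's predicate of bounded linear maps. *)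
Definition rich_point_spectrum (T : E -> E) : Prop :=
  is_linear T /\
  (exists (c : C) (r : R), 0 < r /\
     forall z, open_disc c r z -> point_spectrum T z) /\
  (forall (c : C) (r : R), 0 < r ->
     (forall z, open_disc c r z -> point_spectrum T z) ->
     total (fun x => exists z, open_disc c r z /\ ker_shift T z x)).

End RichPointSpectrum.

(** * Functions on the open unit disc *)

Record unit_disc : Type := Unit_disc {
  disc_val :> C;
  disc_lt1 : Cmod disc_val < 1 }.

(* The power series is centred at [z0]; only its values at points of the disc
   are constrained, so [r] need not be less than the distance to the boundary. *)
Definition analytic_on_disc (f : unit_disc -> C) : Prop :=
  forall z0 : unit_disc, exists (a : nat -> C) (r : R), 0 < r /\
    forall z : unit_disc, open_disc z0 r z -> is_pseries a (z - z0)%C (f z).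

Definition bounded_on_disc (f : unit_disc -> C) : Prop :=
  exists M : R, forall z, Cmod (f z) <= M.

Definition constant_on_disc (f : unit_disc -> C) : Prop :=
  exists c : C, forall z, f z = c.

(** * Square-summable sequences *)

Definition square_summable (a : nat -> C) : Prop :=
  ex_series (fun n => Cmod (a n) ^ 2).

Definition l2norm (a : nat -> C) : R := sqrt (Series (fun n => Cmod (a n) ^ 2)).

Lemma square_summable_le (a : nat -> C) (b : nat -> R) :
  (forall n, Cmod (a n) ^ 2 <= b n) -> ex_series b -> square_summable a.
Proof.
intros H Hb. apply (ex_series_le (V := R_CompleteNormedModule) _ b); [|exact Hb].
intros n. change (Rabs (Cmod (a n) ^ 2) <= b n).
rewrite Rabs_pos_eq; [apply H|apply pow2_ge_0].
Qed.

Lemma Cmod_plus_sqr (p q : R) (x y : C) : 0 < p -> 0 < q ->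
  Cmod (x + y) ^ 2 <= (p + q) * (Cmod x ^ 2 / p + Cmod y ^ 2 / q).
Proof.
intros Hp Hq.
pose proof (Cmod_triangle x y); pose proof (Cmod_ge_0 (x + y)).
apply Rle_trans with ((Cmod x + Cmod y) ^ 2).
  now apply pow_incr.
apply Rminus_le_0.
replace (_ - _) with ((q * Cmod x - p * Cmod y) ^ 2 / (p * q)) by (field; lra).
apply Rdiv_le_0_compat; [apply pow2_ge_0|now apply Rmult_lt_0_compat].
Qed.

Lemma square_summable_plus (a b : nat -> C) :
  square_summable a -> square_summable b ->
  square_summable (fun n => (a n + b n)%C).
Proof.
intros Ha Hb.
apply square_summable_le
  with (fun n => 2 * (Cmod (a n) ^ 2) + 2 * (Cmod (b n) ^ 2)).
  intros n. pose proof (Cmod_plus_sqr 1 1 (a n) (b n)). lra.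
apply (ex_series_plus (V := R_NormedModule));
  now apply (ex_series_scal (V := R_NormedModule)).
Qed.

Lemma square_summable_scal (k : C) (a : nat -> C) :
  square_summable a -> square_summable (fun n => (k * a n)%C).
Proof.
intros Ha. apply square_summable_le with (fun n => Cmod k ^ 2 * Cmod (a n) ^ 2).
  intros n. rewrite Cmod_mult. apply Req_le. ring.
now apply (ex_series_scal (V := R_NormedModule)).
Qed.

Lemma square_summable_ext (a b : nat -> C) :
  (forall n, a n = b n) -> square_summable a -> square_summable b.
Proof. intros H; replace b with a; [easy|now apply functional_extensionality]. Qed.

Lemma square_summable_opp (a : nat -> C) :
  square_summable a -> square_summable (fun n => (- a n)%C).
Proof.
intros Ha. apply square_summable_ext with (fun n => (- (1) * a n)%C).
  intros n; ring.
now apply square_summable_scal.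
Qed.

Lemma square_summable_zero : square_summable (fun _ => RtoC 0).
Proof.
exists 0. apply (is_series_ext (V := R_NormedModule) (fun n : nat => 0 * (/2) ^ n)).
  intros n. rewrite Cmod_0. change (0 * (/2) ^ n = 0 ^ 2). ring.
replace 0 with (0 * (/ (1 - /2))) at 1 by ring.
apply (is_series_scal (V := R_NormedModule) 0).
apply is_series_geom. rewrite Rabs_pos_eq; lra.
Qed.

Lemma Series_nonneg (u : nat -> R) : (forall n, 0 <= u n) -> ex_series u ->
  0 <= Series u.
Proof.
intros Hu Hs. replace 0 with (Series (fun n => 0 * u n)).
  apply Series_le; [|exact Hs]. intros n; specialize (Hu n); lra.
rewrite Series_scal_l. ring.
Qed.

Lemma Series_ge_partial (u : nat -> R) (n : nat) :
  (forall n, 0 <= u n) -> ex_series u -> sum_n u n <= Series u.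
Proof.
intros Hu Hs. rewrite sum_n_Reals.
rewrite (Series_incr_n u (S n)); [simpl Init.Nat.pred|lia|exact Hs].
assert (0 <= Series (fun k => u (S n + k)%nat)); [|lra].
apply Series_nonneg; [easy|].
now apply (ex_series_incr_n (V := R_NormedModule)).
Qed.

Lemma Series_partial_le (u : nat -> R) (M : R) :
  (forall n, 0 <= u n) -> (forall n, sum_n u n <= M) ->
  ex_series u /\ Series u <= M.
Proof.
intros Hu HM.
assert (Hex : ex_finite_lim_seq (sum_n u)).
  apply ex_finite_lim_seq_incr with M; [|exact HM].
  intros n. rewrite sum_Sn. unfold plus; simpl. specialize (Hu (S n)). lra.
destruct Hex as [l Hl]. split; [now exists l|].
assert (Series u = l) as ->. { now apply is_series_unique. }
exact (is_lim_seq_le _ (fun _ => M) (Finite l) (Finite M) HM Hl (is_lim_seq_const M)).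
Qed.

Lemma l2norm_ge_0 (a : nat -> C) : 0 <= l2norm a.
Proof. apply sqrt_pos. Qed.

Lemma l2norm_sqr (a : nat -> C) : square_summable a ->
  Series (fun n => Cmod (a n) ^ 2) = l2norm a ^ 2.
Proof.
intros Ha. unfold l2norm. rewrite pow2_sqrt; [easy|].
apply Series_nonneg; [intros; apply pow2_ge_0|exact Ha].
Qed.

Lemma l2norm_ext (a b : nat -> C) : (forall n, a n = b n) -> l2norm a = l2norm b.
Proof. intros H; unfold l2norm; f_equal; apply Series_ext; intros n; now rewrite H. Qed.

Lemma l2norm_triangle (a b : nat -> C) :
  square_summable a -> square_summable b ->
  l2norm (fun n => (a n + b n)%C) <= l2norm a + l2norm b.
Proof.
intros Ha Hb. apply le_epsilon. intros eps Heps.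
pose proof (l2norm_ge_0 a); pose proof (l2norm_ge_0 b).
set (p := l2norm a + eps / 2); set (q := l2norm b + eps / 2).
assert (Hp : 0 < p) by (unfold p; lra). assert (Hq : 0 < q) by (unfold q; lra).
replace (l2norm a + l2norm b + eps) with (p + q) by (unfold p, q; field).
unfold l2norm at 1. rewrite <- (sqrt_pow2 (p + q)) by lra.
apply sqrt_le_1_alt.
apply Rle_trans with
  (Series (fun n => (p + q) * (Cmod (a n) ^ 2 * / p + Cmod (b n) ^ 2 * / q))).
  apply Series_le.
    intros n; split; [apply pow2_ge_0|now apply Cmod_plus_sqr].
  apply (ex_series_scal (V := R_NormedModule)).
  apply (ex_series_plus (V := R_NormedModule)); now apply ex_series_scal_r.
rewrite Series_scal_l, Series_plus, !Series_scal_r, !l2norm_sqr by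
  (try assumption; now apply ex_series_scal_r).
replace ((p + q) ^ 2) with ((p + q) * (p ^ 2 * / p + q ^ 2 * / q)) by (field; lra).
apply Rmult_le_compat_l; [lra|].
apply Rplus_le_compat; apply Rmult_le_compat_r;
  try (left; now apply Rinv_0_lt_compat); apply pow_incr; unfold p, q; lra.
Qed.

Lemma l2norm_scal (k : C) (a : nat -> C) :
  l2norm (fun n => (k * a n)%C) = Cmod k * l2norm a.
Proof.
unfold l2norm. rewrite (Series_ext _ (fun n => Cmod k ^ 2 * Cmod (a n) ^ 2)).
  rewrite Series_scal_l, sqrt_mult_alt by apply pow2_ge_0.
  now rewrite sqrt_pow2 by apply Cmod_ge_0.
intros n. rewrite Cmod_mult. ring.
Qed.

Lemma l2norm_ge_coef (a : nat -> C) (n : nat) : square_summable a ->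
  Cmod (a n) <= l2norm a.
Proof.
intros Ha.
assert (H : Cmod (a n) ^ 2 <= l2norm a ^ 2).
  rewrite <- l2norm_sqr by exact Ha.
  eapply Rle_trans;
    [|apply (Series_ge_partial _ n); [intros; apply pow2_ge_0|exact Ha]].
  destruct n; [now rewrite sum_O; apply Rle_refl|].
  assert (0 <= sum_n (fun n => Cmod (a n) ^ 2) n).
    clear. induction n; [rewrite sum_O; apply pow2_ge_0|].
    rewrite sum_Sn. apply Rplus_le_le_0_compat; [exact IHn|apply pow2_ge_0].
  rewrite sum_Sn.
  change (Cmod (a (S n)) ^ 2
    <= sum_n (fun n => Cmod (a n) ^ 2) n + Cmod (a (S n)) ^ 2). lra.
apply Rsqr_incr_0; [|apply Cmod_ge_0|apply l2norm_ge_0].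
now rewrite !Rsqr_pow2.
Qed.

(** * Complex series *)

(* Meaningful for convergent series only. *)
Definition CSeries (a : nat -> C) : C :=
  (Series (fun n => Re (a n)), Series (fun n => Im (a n))).

Lemma sum_n_Re_Im (a : nat -> C) (n : nat) :
  sum_n a n = (sum_n (fun k => Re (a k)) n, sum_n (fun k => Im (a k)) n).
Proof.
induction n.
  rewrite !sum_O. now destruct (a 0%nat).
now rewrite !sum_Sn, IHn.
Qed.

Lemma is_series_C (a : nat -> C) (l : C) :
  is_series a l <->
  is_series (fun n => Re (a n)) (Re l) /\ is_series (fun n => Im (a n)) (Im l).
Proof.
split.
- intros H; split; intros P [eps HP].
  + assert (H' : eventually (fun n => ball l eps (sum_n a n))).
      apply (H (ball l eps)). now exists eps.
    revert H'. unfold filtermap. apply filter_imp. intros n Hn. apply HP.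
    rewrite sum_n_Re_Im in Hn. exact (proj1 Hn).
  + assert (H' : eventually (fun n => ball l eps (sum_n a n))).
      apply (H (ball l eps)). now exists eps.
    revert H'. unfold filtermap. apply filter_imp. intros n Hn. apply HP.
    rewrite sum_n_Re_Im in Hn. exact (proj2 Hn).
- intros [H1 H2] P [eps HP].
  assert (H1' : eventually (fun n => ball (Re l) eps (sum_n (fun n => Re (a n)) n))).
    apply (H1 (ball (Re l) eps)). now exists eps.
  assert (H2' : eventually (fun n => ball (Im l) eps (sum_n (fun n => Im (a n)) n))).
    apply (H2 (ball (Im l) eps)). now exists eps.
  generalize (filter_and _ _ H1' H2'). unfold filtermap. apply filter_imp. intros n Hn. apply HP.
  rewrite sum_n_Re_Im. exact Hn.
Qed.

Lemma is_series_CSeries (a : nat -> C) (l : C) : is_series a l -> CSeries a = l.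
Proof.
intros H. apply is_series_C in H as [H1 H2].
unfold CSeries. rewrite (is_series_unique _ _ H1), (is_series_unique _ _ H2).
now destruct l.
Qed.

Lemma CSeries_correct (a : nat -> C) : ex_series a -> is_series a (CSeries a).
Proof. intros [l H]. now rewrite (is_series_CSeries _ _ H). Qed.

Lemma ex_CSeries_mult (a b : nat -> C) :
  square_summable a -> square_summable b -> ex_series (fun n => (a n * b n)%C).
Proof.
intros Ha Hb.
apply (ex_series_le (V := C_CompleteNormedModule) _
  (fun n => Cmod (a n) ^ 2 + Cmod (b n) ^ 2)).
  intros n. change (Cmod (a n * b n) <= Cmod (a n) ^ 2 + Cmod (b n) ^ 2).
  rewrite Cmod_mult.
  pose proof (pow2_ge_0 (Cmod (a n) - Cmod (b n))).
  pose proof (pow2_ge_0 (Cmod (a n) + Cmod (b n))). nra.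
now apply (ex_series_plus (V := R_NormedModule)).
Qed.

Lemma ex_pseries_disc (a : nat -> C) (z : unit_disc) :
  square_summable a -> ex_pseries a (z : C).
Proof.
intros Ha. apply (ex_CSeries_mult (fun n => pow_n (z : C) n) a); [|exact Ha].
apply square_summable_le with (fun n => (Cmod z ^ 2) ^ n).
  intros n. apply Req_le. rewrite <- pow_mult, Nat.mul_comm, pow_mult. f_equal.
  induction n; [apply Cmod_1|].
  change (Cmod (z * pow_n (z : C) n) = Cmod z * Cmod z ^ n).
  now rewrite Cmod_mult, IHn.
eexists. apply is_series_geom.
pose proof (Cmod_ge_0 z); pose proof (disc_lt1 z).
rewrite Rabs_pos_eq; nra.
Qed.

Lemma pow_n_RtoC (x : R) (n : nat) : pow_n (RtoC x) n = RtoC (x ^ n).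
Proof.
induction n; [easy|].
change ((RtoC x * pow_n (RtoC x) n)%C = RtoC (x * x ^ n)).
now rewrite IHn, RtoC_mult.
Qed.

Lemma pseries_coef_eq0 (a : nat -> R) :
  (forall x, Rabs x < 1 -> is_pseries a x 0) -> forall n, a n = 0.
Proof.
intros H n.
apply (PSeries_ext_recip a (fun _ => 0)).
- apply Rbar_lt_le_trans with (/2); [simpl; lra|].
  apply Rbar_not_lt_le. intros Hlt.
  apply (CV_disk_outside a (/2)).
    rewrite Rabs_pos_eq; [exact Hlt|lra].
  apply ex_series_lim_0. exists 0. apply is_pseries_R, H.
  rewrite Rabs_pos_eq; lra.
- now rewrite CV_radius_const_0.
- exists (mkposreal 1 Rlt_0_1). intros x Hx.
  rewrite PSeries_const_0. apply is_pseries_unique, H.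
  change (Rabs (x - 0) < 1) in Hx. now rewrite Rminus_0_r in Hx.
Qed.

Lemma pseries_coef_unique (a b : nat -> C) (f : unit_disc -> C) :
  (forall z : unit_disc, is_pseries a (z : C) (f z)) ->
  (forall z : unit_disc, is_pseries b (z : C) (f z)) ->
  forall n, a n = b n.
Proof.
intros Ha Hb.
assert (H : forall x : R, Rabs x < 1 ->
  is_pseries (fun n => Re (a n - b n)%C) x 0 /\
  is_pseries (fun n => Im (a n - b n)%C) x 0).
  intros x Hx.
  assert (Hx' : Cmod (RtoC x) < 1) by now rewrite Cmod_R.
  pose proof (is_series_minus _ _ _ _ (Ha (Unit_disc _ Hx')) (Hb (Unit_disc _ Hx')))
    as Hs.
  assert (Hz : forall w : C, plus w (opp w) = RtoC 0) by (intros w; apply Cplus_opp_r).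
  rewrite Hz in Hs. apply is_series_C in Hs as [H1 H2]. simpl disc_val in H1, H2.
  split; apply is_pseries_R.
  + revert H1. apply is_series_ext. intros n. rewrite pow_n_RtoC.
    unfold scal, plus, opp; simpl. unfold mult; simpl. ring.
  + revert H2. apply is_series_ext. intros n. rewrite pow_n_RtoC.
    unfold scal, plus, opp; simpl. unfold mult; simpl. ring.
intros n.
assert (H1 := pseries_coef_eq0 _ (fun x Hx => proj1 (H x Hx)) n).
assert (H2 := pseries_coef_eq0 _ (fun x Hx => proj2 (H x Hx)) n).
simpl in H1, H2. destruct (a n) as [a1 a2], (b n) as [b1 b2]. simpl in *.
f_equal; lra.
Qed.

(** * The Hardy space of the disc *)

(* A power series converging on the whole disc is analytic there, so these are
   the analytic functions with square-summable Taylor coefficients at 0. *)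
Definition in_H2 (f : unit_disc -> C) : Prop :=
  exists a : nat -> C,
    (forall z : unit_disc, is_pseries a (z : C) (f z)) /\ square_summable a.

Record H2 : Type := MkH2 {
  H2_fun :> unit_disc -> C;
  H2_prop : in_H2 H2_fun }.

Definition coef (f : H2) : nat -> C :=
  proj1_sig (constructive_indefinite_description _ (H2_prop f)).

Lemma coef_pseries (f : H2) (z : unit_disc) : is_pseries (coef f) (z : C) (f z).
Proof. apply (proj2_sig (constructive_indefinite_description _ (H2_prop f))). Qed.

Lemma coef_l2 (f : H2) : square_summable (coef f).
Proof. apply (proj2_sig (constructive_indefinite_description _ (H2_prop f))). Qed.

Lemma coef_unique (f : H2) (a : nat -> C) :
  (forall z : unit_disc, is_pseries a (z : C) (f z)) -> forall n, coef f n = a n.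
Proof. apply pseries_coef_unique, coef_pseries. Qed.

Lemma H2_eq (f g : H2) : (forall z, f z = g z) -> f = g.
Proof.
destruct f as [f Hf], g as [g Hg]. simpl. intros H.
apply functional_extensionality in H. subst g. f_equal. apply proof_irrelevance.
Qed.

Lemma H2_eq_coef (f g : H2) : (forall n, coef f n = coef g n) -> f = g.
Proof.
intros H. apply H2_eq. intros z.
apply functional_extensionality in H.
rewrite <- (is_series_CSeries _ _ (coef_pseries f z)).
rewrite <- (is_series_CSeries _ _ (coef_pseries g z)).
now rewrite H.
Qed.

Lemma in_H2_of_coef (a : nat -> C) : square_summable a ->
  in_H2 (fun z => CSeries (fun n => scal (pow_n (z : C) n) (a n))).
Proof.
intros Ha. exists a. split; [|exact Ha]. intros z.
apply CSeries_correct, ex_pseries_disc, Ha.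
Qed.

Definition H2_of_coef (a : nat -> C) (Ha : square_summable a) : H2 :=
  MkH2 _ (in_H2_of_coef a Ha).

Lemma coef_of_coef (a : nat -> C) (Ha : square_summable a) (n : nat) :
  coef (H2_of_coef a Ha) n = a n.
Proof.
apply coef_unique. intros z. apply CSeries_correct, ex_pseries_disc, Ha.
Qed.

Lemma pseries_plus (a b : nat -> C) (z x y : C) :
  is_pseries a z x -> is_pseries b z y ->
  is_pseries (fun n => (a n + b n)%C) z (x + y)%C.
Proof. apply (is_pseries_plus (V := C_NormedModule)). Qed.

Lemma pseries_scal (k : C) (a : nat -> C) (z x : C) :
  is_pseries a z x -> is_pseries (fun n => (k * a n)%C) z (k * x)%C.
Proof.
apply (is_pseries_scal (V := C_NormedModule)).
change ((z * k)%C = (k * z)%C). apply Cmult_comm.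
Qed.

Lemma pseries_opp (a : nat -> C) (z x : C) :
  is_pseries a z x -> is_pseries (fun n => (- a n)%C) z (- x)%C.
Proof. apply (is_pseries_opp (V := C_NormedModule)). Qed.

Lemma pseries_zero (z : C) : is_pseries (fun _ => RtoC 0) z (RtoC 0).
Proof.
apply is_series_C; split.
- apply (is_series_ext (fun n => scal 0 ((/2) ^ n))).
    intros n. destruct (pow_n z n). unfold scal; simpl; unfold mult; simpl; ring.
  replace (Re (RtoC 0)) with (scal 0 (/ (1 - / 2))) by
    (unfold scal; simpl; unfold mult; simpl; ring).
  apply (is_series_scal (V := R_NormedModule)), is_series_geom.
  rewrite Rabs_pos_eq; lra.
- apply (is_series_ext (fun n => scal 0 ((/2) ^ n))).
    intros n. destruct (pow_n z n). unfold scal; simpl; unfold mult; simpl; ring.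
  replace (Im (RtoC 0)) with (scal 0 (/ (1 - / 2))) by
    (unfold scal; simpl; unfold mult; simpl; ring).
  apply (is_series_scal (V := R_NormedModule)), is_series_geom.
  rewrite Rabs_pos_eq; lra.
Qed.

Lemma in_H2_plus (f g : H2) : in_H2 (fun z => (f z + g z)%C).
Proof.
exists (fun n => (coef f n + coef g n)%C); split.
- intros z. apply pseries_plus; apply coef_pseries.
- apply square_summable_plus; apply coef_l2.
Qed.

Lemma in_H2_scal (k : C) (f : H2) : in_H2 (fun z => (k * f z)%C).
Proof.
exists (fun n => (k * coef f n)%C); split.
- intros z. apply pseries_scal; apply coef_pseries.
- apply square_summable_scal; apply coef_l2.
Qed.

Lemma in_H2_opp (f : H2) : in_H2 (fun z => (- f z)%C).
Proof.
exists (fun n => (- coef f n)%C); split.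
- intros z. apply pseries_opp; apply coef_pseries.
- apply square_summable_opp; apply coef_l2.
Qed.

Lemma in_H2_zero : in_H2 (fun _ => RtoC 0).
Proof.
exists (fun _ => RtoC 0); split.
- intros z. apply pseries_zero.
- apply square_summable_zero.
Qed.

Definition H2_plus (f g : H2) : H2 := MkH2 _ (in_H2_plus f g).
Definition H2_scal (k : C) (f : H2) : H2 := MkH2 _ (in_H2_scal k f).
Definition H2_opp (f : H2) : H2 := MkH2 _ (in_H2_opp f).
Definition H2_zero : H2 := MkH2 _ in_H2_zero.

Lemma coef_plus (f g : H2) n : coef (H2_plus f g) n = (coef f n + coef g n)%C.
Proof.
apply (coef_unique _ (fun n => (coef f n + coef g n)%C)).
intros z. apply pseries_plus; apply coef_pseries.
Qed.

Lemma coef_scal (k : C) (f : H2) n : coef (H2_scal k f) n = (k * coef f n)%C.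
Proof.
apply (coef_unique _ (fun n => (k * coef f n)%C)).
intros z. apply pseries_scal; apply coef_pseries.
Qed.

Lemma coef_opp (f : H2) n : coef (H2_opp f) n = (- coef f n)%C.
Proof.
apply (coef_unique _ (fun n => (- coef f n)%C)).
intros z. apply pseries_opp; apply coef_pseries.
Qed.

Lemma coef_zero n : coef H2_zero n = RtoC 0.
Proof. apply (coef_unique _ (fun _ => RtoC 0)). intros z. apply pseries_zero. Qed.

Definition H2_norm (f : H2) : R := l2norm (coef f).

Definition H2_inner (f g : H2) : C := CSeries (fun n => (coef f n * Cconj (coef g n))%C).

(** ** Banach space structure *)

Definition H2_AbelianMonoid_mixin : AbelianMonoid.mixin_of H2.
Proof.
apply (AbelianMonoid.Mixin _ H2_plus H2_zero);
  intros; apply H2_eq; intros; simpl; ring.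
Defined.

Canonical H2_AbelianMonoid := AbelianMonoid.Pack H2 H2_AbelianMonoid_mixin H2.

Definition H2_AbelianGroup_mixin : AbelianGroup.mixin_of H2_AbelianMonoid.
Proof.
apply (AbelianGroup.Mixin H2_AbelianMonoid H2_opp);
  intros; apply H2_eq; intros; simpl; ring.
Defined.

Canonical H2_AbelianGroup :=
  AbelianGroup.Pack H2 (AbelianGroup.Class _ _ H2_AbelianGroup_mixin) H2.

Definition H2_ModuleSpace_mixin :
  ModuleSpace.mixin_of C_Ring H2_AbelianGroup.
Proof.
apply (ModuleSpace.Mixin C_Ring H2_AbelianGroup H2_scal);
  intros; apply H2_eq; intros; simpl; unfold mult, one, plus; simpl; ring.
Defined.

Canonical H2_ModuleSpace :=
  ModuleSpace.Pack C_Ring H2 (ModuleSpace.Class _ _ _ H2_ModuleSpace_mixin) H2.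

Definition H2_ball (f : H2) (eps : R) (g : H2) : Prop :=
  H2_norm (minus g f) < eps.

Lemma coef_minus (f g : H2) n : coef (minus g f) n = (coef g n - coef f n)%C.
Proof.
change (coef (H2_plus g (H2_opp f)) n = (coef g n - coef f n)%C).
now rewrite coef_plus, coef_opp.
Qed.

Lemma H2_norm_triangle (f g : H2) : H2_norm (plus f g) <= H2_norm f + H2_norm g.
Proof.
unfold H2_norm.
rewrite (l2norm_ext (coef (plus f g)) (fun n => (coef f n + coef g n)%C)).
  apply l2norm_triangle; apply coef_l2.
intros n; apply coef_plus.
Qed.

Lemma H2_norm_scal (k : C) (f : H2) : H2_norm (scal k f) = Cmod k * H2_norm f.
Proof. unfold H2_norm. rewrite <- l2norm_scal. apply l2norm_ext, coef_scal. Qed.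

Lemma H2_norm_eq0 (f : H2) : H2_norm f = 0 -> f = zero.
Proof.
intros H. apply H2_eq_coef. intros n.
change (coef f n = coef H2_zero n).
rewrite coef_zero. apply Cmod_eq_0.
apply Rle_antisym; [|apply Cmod_ge_0].
rewrite <- H. apply l2norm_ge_coef, coef_l2.
Qed.

Lemma H2_norm_zero : H2_norm zero = 0.
Proof.
replace (zero : H2) with (scal (RtoC 0) (zero : H2)) by apply (scal_zero_r (V := H2_ModuleSpace)).
rewrite H2_norm_scal, Cmod_0. ring.
Qed.

Lemma H2_norm_minus_sym (f g : H2) : H2_norm (minus f g) = H2_norm (minus g f).
Proof.
replace (minus f g) with (scal (- RtoC 1)%C (minus g f)).
  rewrite H2_norm_scal, Cmod_opp, Cmod_1. ring.
apply H2_eq_coef. intros n.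
change (coef (H2_scal (- RtoC 1)%C (minus g f)) n = coef (minus f g) n).
rewrite coef_scal, !coef_minus. ring.
Qed.

Definition H2_UniformSpace_mixin : UniformSpace.mixin_of H2.
Proof.
apply (UniformSpace.Mixin H2 zero H2_ball).
- intros f eps. unfold H2_ball. rewrite minus_eq_zero.
  change (H2_norm H2_zero < eps). rewrite (H2_norm_zero : H2_norm H2_zero = 0).
  apply cond_pos.
- intros f g eps. unfold H2_ball. now rewrite H2_norm_minus_sym.
- intros f g h e1 e2 H1 H2. unfold H2_ball in *.
  rewrite (minus_trans g h f).
  eapply Rle_lt_trans; [apply H2_norm_triangle|]. lra.
Defined.

Canonical H2_UniformSpace := UniformSpace.Pack H2 H2_UniformSpace_mixin H2.

Canonical H2_NormedModuleAux :=
  NormedModuleAux.Pack C_AbsRing H2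
    (NormedModuleAux.Class _ _ (ModuleSpace.class _ H2_ModuleSpace)
       (UniformSpace.class H2_UniformSpace)) H2.

Definition H2_NormedModule_mixin :
  NormedModule.mixin_of C_AbsRing H2_NormedModuleAux.
Proof.
apply (NormedModule.Mixin C_AbsRing H2_NormedModuleAux H2_norm 1).
- exact H2_norm_triangle.
- intros k f. right. apply H2_norm_scal.
- intros f g eps H. exact H.
- intros f g eps H. rewrite Rmult_1_l. exact H.
- exact H2_norm_eq0.
Defined.

Canonical H2_NormedModule :=
  NormedModule.Pack C_AbsRing H2
    (NormedModule.Class _ _ _ H2_NormedModule_mixin) H2.

(* Limits of Cauchy filters are taken coefficientwise. *)
Definition H2_lim_coef (F : (H2 -> Prop) -> Prop) (n : nat) : C :=
  @lim C_CompleteNormedModule (fun P => F (fun f => P (coef f n))).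

Definition H2_lim (F : (H2 -> Prop) -> Prop) : H2 :=
  match excluded_middle_informative (square_summable (H2_lim_coef F)) with
  | left Ha => H2_of_coef _ Ha
  | right _ => H2_zero
  end.

Section Completeness.

Context (F : (H2 -> Prop) -> Prop) (FF : ProperFilter F) (HF : cauchy F).

Lemma H2_lim_coef_near (n : nat) (d : posreal) :
  F (fun f => Cmod (coef f n - H2_lim_coef F n) < d).
Proof.
set (G := fun P : C -> Prop => F (fun f => P (coef f n))).
assert (FG : ProperFilter G).
  exact (filtermap_proper_filter _ _ (fun f => coef f n) F FF).
assert (HG : cauchy (T := C_UniformSpace) G).
  intros eps. destruct (HF eps) as [x Hx]. exists (coef x n).
  unfold G. revert Hx. apply filter_imp. intros f Hf.
  apply C_NormedModule_mixin_compat1.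
  change (Cmod (coef f n - coef x n) < eps).
  rewrite <- coef_minus.
  apply Rle_lt_trans with (2 := Hf). apply l2norm_ge_coef, coef_l2.
assert (Hd : 0 < d / sqrt 2).
  apply Rdiv_lt_0_compat; [apply cond_pos|apply Rlt_sqrt2_0].
pose proof (@complete_cauchy C_CompleteNormedModule G FG HG (mkposreal _ Hd)) as H.
unfold G in H at 1. revert H. apply filter_imp. intros f Hf.
apply C_NormedModule_mixin_compat2 in Hf. simpl pos in Hf.
replace (sqrt 2 * (d / sqrt 2)) with (pos d) in Hf by
  (field; apply Rgt_not_eq, Rlt_sqrt2_0).
exact Hf.
Qed.

Lemma H2_lim_coef_near_upto (N : nat) (d : posreal) :
  F (fun f => forall n, (n <= N)%nat -> Cmod (coef f n - H2_lim_coef F n) < d).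
Proof.
induction N.
  generalize (H2_lim_coef_near 0 d). apply filter_imp. intros f Hf n Hn.
  now replace n with 0%nat by lia.
generalize (filter_and _ _ IHN (H2_lim_coef_near (S N) d)).
apply filter_imp. intros f [H1 H2'] n Hn.
destruct (Nat.eq_dec n (S N)) as [->|]; [exact H2'|apply H1; lia].
Qed.

Lemma H2_lim_coef_close (x : H2) (eps : posreal) : F (ball x eps) ->
  square_summable (fun n => (H2_lim_coef F n - coef x n)%C) /\
  l2norm (fun n => (H2_lim_coef F n - coef x n)%C) <= 2 * eps.
Proof.
intros Hx.
pose proof (cond_pos eps) as Heps.
assert (H : forall N,
  sum_n (fun n => Cmod (H2_lim_coef F n - coef x n) ^ 2) N <= (2 * eps) ^ 2).
{ intros N.
  pose proof (lt_0_INR (S N) (Nat.lt_0_succ N)) as HN.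
  assert (HN1 : 1 <= INR (S N)) by (apply (le_INR 1); lia).
  assert (Hd : 0 < eps / INR (S N)) by now apply Rdiv_lt_0_compat.
  set (d := eps / INR (S N)) in Hd.
  destruct (filter_ex _ (filter_and _ _ Hx (H2_lim_coef_near_upto N (mkposreal _ Hd))))
    as [f [H1 H2']]. cbn [pos] in H2'.
  apply Rle_trans with
    (sum_n (fun n => plus (2 * d ^ 2)
                          (2 * Cmod (coef (minus f x) n) ^ 2)) N).
  { rewrite !sum_n_Reals. apply sum_Rle. intros n Hn.
    rewrite coef_minus.
    replace (H2_lim_coef F n - coef x n)%C with
      (- (coef f n - H2_lim_coef F n) + (coef f n - coef x n))%C by ring.
    eapply Rle_trans; [apply (Cmod_plus_sqr 1 1); lra|].
    rewrite Cmod_opp. specialize (H2' n Hn).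
    pose proof (Cmod_ge_0 (coef f n - H2_lim_coef F n)).
    assert (Cmod (coef f n - H2_lim_coef F n) ^ 2 <= d ^ 2)
      by (apply pow_incr; lra).
    change (plus (2 * d ^ 2) (2 * Cmod (coef f n - coef x n) ^ 2))
      with (2 * d ^ 2 + 2 * Cmod (coef f n - coef x n) ^ 2).
    lra. }
  rewrite sum_n_plus.
  rewrite sum_n_const.
  assert (Hs : sum_n (fun n => 2 * Cmod (coef (minus f x) n) ^ 2) N <= 2 * eps ^ 2).
  { rewrite (sum_n_mult_l (K := R_Ring) 2 (fun n => Cmod (coef (minus f x) n) ^ 2)).
    apply Rmult_le_compat_l; [lra|].
    eapply Rle_trans.
      apply Series_ge_partial; [intros; apply pow2_ge_0|apply coef_l2].
    rewrite l2norm_sqr by apply coef_l2.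
    apply pow_incr. split; [apply l2norm_ge_0|left; exact H1]. }
  apply Rle_trans with (INR (S N) * (2 * d ^ 2) + 2 * eps ^ 2).
    now apply Rplus_le_compat_l.
  replace (INR (S N) * (2 * d ^ 2)) with (2 * eps ^ 2 * / INR (S N))
    by (unfold d; field; lra).
  assert (/ INR (S N) <= 1).
    rewrite <- Rinv_1. apply Rinv_le_contravar; lra.
  assert (0 < eps ^ 2) by (apply pow_lt; lra). nra. }
apply Series_partial_le in H; [|intros; apply pow2_ge_0].
destruct H as [H1 H2']. split; [exact H1|].
unfold l2norm. rewrite <- (sqrt_pow2 (2 * eps)) by lra. now apply sqrt_le_1_alt.
Qed.

Lemma H2_complete (eps : posreal) : F (ball (H2_lim F) eps).
Proof.
pose proof (cond_pos eps) as Heps.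
assert (He : 0 < eps / 3) by lra.
destruct (HF (mkposreal _ He)) as [x Hx].
destruct (H2_lim_coef_close x _ Hx) as [H1 H3]. simpl pos in H3.
assert (Hl : forall n, coef (H2_lim F) n = H2_lim_coef F n).
{ unfold H2_lim. destruct (excluded_middle_informative _) as [Ha|Ha].
    now apply coef_of_coef.
  exfalso. apply Ha.
  apply square_summable_ext
    with (fun n => (H2_lim_coef F n - coef x n + coef x n)%C).
    intros n; ring.
  apply square_summable_plus; [exact H1|apply coef_l2]. }
revert Hx. apply filter_imp. intros f Hf.
change (H2_norm (minus f (H2_lim F)) < eps).
change (H2_norm (minus f x) < eps / 3) in Hf.
rewrite (minus_trans x f (H2_lim F)).
eapply Rle_lt_trans; [apply H2_norm_triangle|].
assert (H2_norm (minus x (H2_lim F)) <= 2 * (eps / 3)); [|lra].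
rewrite H2_norm_minus_sym. unfold H2_norm.
rewrite (l2norm_ext _ (fun n => (H2_lim_coef F n - coef x n)%C)); [exact H3|].
intros n. now rewrite coef_minus, Hl.
Qed.

End Completeness.

Definition H2_CompleteSpace_mixin : CompleteSpace.mixin_of H2_UniformSpace.
Proof.
apply (CompleteSpace.Mixin H2_UniformSpace H2_lim).
- exact H2_complete.
- intros F1 F2 H12 H21. replace F2 with F1; [apply close_refl|].
  apply functional_extensionality. intros P.
  apply propositional_extensionality. split; [apply H21|apply H12].
Defined.

Canonical H2_CompleteSpace :=
  CompleteSpace.Pack H2 (CompleteSpace.Class _ _ H2_CompleteSpace_mixin) H2.

Canonical H2_CompleteNormedModule :=
  CompleteNormedModule.Pack C_AbsRing H2
    (CompleteNormedModule.Class _ _ (NormedModule.class _ H2_NormedModule)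
       H2_CompleteSpace_mixin) H2.

(** * Analytic Toeplitz operators and adjoints *)

Definition analytic_toeplitz (phi : unit_disc -> C) (T : H2 -> H2) : Prop :=
  is_linear T /\ forall (f : H2) (z : unit_disc), T f z = (phi z * f z)%C.

(* Hilbert-space adjoint; [T] determines it, see [adjoint_of_unique]. *)
Definition adjoint_of (T S : H2 -> H2) : Prop :=
  is_linear S /\ forall f g : H2, H2_inner (T f) g = H2_inner f (S g).

Lemma H2_inner_self (f : H2) : H2_inner f f = RtoC (H2_norm f ^ 2).
Proof.
apply is_series_CSeries, is_series_C; split.
- apply is_series_ext with (fun n => Cmod (coef f n) ^ 2).
    intros n. rewrite <- Cmod2_conj. easy.
  change (Re (RtoC (H2_norm f ^ 2))) with (l2norm (coef f) ^ 2).
  rewrite <- l2norm_sqr by apply coef_l2.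
  apply Series_correct, coef_l2.
- apply is_series_ext with (fun n => Im (RtoC 0)).
    intros n. rewrite <- Cmod2_conj. easy.
  apply (is_series_ext (fun n => Im (scal (pow_n (RtoC 0) n) (RtoC 0)))).
    intros n. rewrite pow_n_RtoC. unfold scal; simpl. unfold mult; simpl. ring.
  exact (proj2 (proj1 (is_series_C _ _) (pseries_zero (RtoC 0)))).
Qed.

Lemma H2_inner_correct (f g : H2) :
  is_series (fun n => (coef f n * Cconj (coef g n))%C) (H2_inner f g).
Proof.
apply CSeries_correct, ex_CSeries_mult; [apply coef_l2|].
apply square_summable_le with (fun n => Cmod (coef g n) ^ 2); [|apply coef_l2].
intros n. rewrite Cmod_conj. apply Rle_refl.
Qed.

Lemma H2_inner_minus_r (f g h : H2) :
  H2_inner f (minus g h) = (H2_inner f g - H2_inner f h)%C.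
Proof.
apply is_series_CSeries.
generalize (is_series_minus _ _ _ _ (H2_inner_correct f g) (H2_inner_correct f h)).
apply is_series_ext. intros n. rewrite coef_minus, Cminus_conj.
match goal with |- plus ?x (opp ?y) = _ => change ((x - y)%C = 
  (coef f n * (Cconj (coef g n) - Cconj (coef h n)))%C) end.
ring.
Qed.

Lemma analytic_toeplitz_unique (phi : unit_disc -> C) (T T' : H2 -> H2) :
  analytic_toeplitz phi T -> analytic_toeplitz phi T' -> T = T'.
Proof.
intros [_ H] [_ H']. apply functional_extensionality. intros f.
apply H2_eq. intros z. now rewrite H, H'.
Qed.

Lemma adjoint_of_unique (T S S' : H2 -> H2) :
  adjoint_of T S -> adjoint_of T S' -> S = S'.
Proof.
intros [_ H] [_ H']. apply functional_extensionality. intros g.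
assert (E : H2_norm (minus (S g) (S' g)) = 0).
{ assert (E : H2_inner (minus (S g) (S' g)) (minus (S g) (S' g)) = RtoC 0).
    rewrite H2_inner_minus_r, <- H, <- H'. ring.
  rewrite H2_inner_self in E. apply RtoC_inj in E.
  now apply Rmult_integral in E as [E|E]; [|rewrite Rmult_1_r in E]. }
apply H2_norm_eq0 in E.
apply (plus_reg_r (opp (S' g))). rewrite plus_opp_r. exact E.
Qed.

(* Main.v *)
(* A bounded analytic function has a power series on the whole disc, and Parseval's
   inequality, taken in quadratic mean over roots of unity, bounds multiplication by it
   on H^2; so T exists. The reproducing kernel k_w satisfies T* k_w = conj(phi w) k_w,
   hence the point spectrum of T* contains conj(phi(D)), which contains a disc.
   Conversely, if |phi - conj c| is bounded below, then 1/(phi - conj c) is again a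
   bounded multiplier, T - conj c is onto, and c is not an eigenvalue of T*. So a disc of
   eigenvalues meets conj(phi(D)) and contains conj(phi z) for all z near some w; a
   function orthogonal to the corresponding k_z vanishes near w, hence everywhere.
   Power series are handled without integration: Cauchy's estimate is the case f = 1 of
   Parseval's inequality. *)
Require Import Defs.
From Stdlib Require Import Reals Lra Lia Arith.
From Stdlib Require Import Classical ClassicalEpsilon ProofIrrelevance.
From Coquelicot Require Import Coquelicot.

(** * Series and absolutely convergent power series *)

(** The symbol is given by local expansions, whereas membership in H^2 is a condition on the
    coefficients at 0, so a single expansion on the whole disc must be available before any norm
    estimate. It is needed twice: for [phi], and for [1/(phi - conj c)], whose analyticity is again
    first known only locally. The quadratic mean over the [(m + 1)]-st roots of unity is exact for
    polynomials of degree [m], since their frequencies stay distinct modulo [m + 1]. An absolutely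
    convergent series differs from its partial sum by a small uniform error on the circle, which is
    why estimates are made at a radius below 1 and the radius tends to 1 last. In the totality
    clause the disc of eigenvalues is arbitrary, not one chosen inside conj(phi(D)), so kernels
    lying over it must first be found. If the disc of centre [c] and radius [r] missed conj(phi(D)),
    then [|phi - conj c| >= r] everywhere, which is exactly the lower bound making
    [1/(phi - conj c)] a bounded multiplier. For a disc inside the range no open mapping theorem is
    required: one point with nonzero derivative and a contraction argument suffice. *)

Lemma is_series_norm {K : AbsRing} {V : NormedModule K} (u : nat -> V) (l : V) :
  is_series u l <->
  forall eps : posreal, exists N, forall n, (N <= n)%nat ->
    norm (minus (sum_n u n) l) < eps.
Proof.
exact (filterlim_locally_ball_norm (sum_n u) l).
Qed.

Lemma is_series_le_bound {K : AbsRing} {V : NormedModule K}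
  (u : nat -> V) (l : V) (b : nat -> R) (B : R) :
  is_series u l -> (forall n, norm (u n) <= b n) -> (forall n, sum_n b n <= B) ->
  norm l <= B.
Proof.
intros Hu Hb HB.
assert (Hs : forall n, norm (sum_n u n) <= sum_n b n).
{ induction n; [rewrite !sum_O; apply Hb|].
  rewrite !sum_Sn. eapply Rle_trans; [apply norm_triangle|].
  now apply Rplus_le_compat. }
apply le_epsilon. intros eps Heps.
destruct (proj1 (is_series_norm u l) Hu (mkposreal _ Heps)) as [N HN].
specialize (HN N (le_n N)). specialize (Hs N). specialize (HB N). simpl in HN.
pose proof (norm_triangle_inv (sum_n u N) l) as H.
pose proof (Rabs_maj2 (norm (sum_n u N) - norm l)). lra.
Qed.

Lemma is_series_norm_unique {K : AbsRing} {V : NormedModule K} (u : nat -> V) (l l' : V) :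
  is_series u l -> is_series u l' -> l = l'.
Proof.
intros H H'.
exact (filterlim_locally_unique (sum_n u) l l' H H').
Qed.

Lemma is_pseries_Cpow (a : nat -> C) (z l : C) :
  is_pseries a z l <-> is_series (fun n => (a n * z ^ n)%C) l.
Proof.
assert (H : forall n, scal (pow_n z n) (a n) = (a n * z ^ n)%C).
{ intros n. rewrite Cmult_comm. reflexivity. }
split; apply is_series_ext; intros n; now rewrite H.
Qed.

(** The radius is explicit instead of being a radius of convergence: estimates give up a little of
    it at each step, and the closed circle of radius [r] is included. *)
Definition abs_pseries (a : nat -> C) (r : R) : Prop :=
  ex_series (fun n => Cmod (a n) * r ^ n).

Lemma ex_series_le_R (u v : nat -> R) :
  (forall n, 0 <= u n <= v n) -> ex_series v -> ex_series u.
Proof.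
intros H Hv. apply (ex_series_le (V := R_CompleteNormedModule) u v); [|exact Hv].
intros n. change (Rabs (u n) <= v n). rewrite Rabs_pos_eq; apply H.
Qed.

Lemma sum_n_mono (u : nat -> R) (n m : nat) :
  (forall k, 0 <= u k) -> (n <= m)%nat -> sum_n u n <= sum_n u m.
Proof.
intros Hu H. induction H; [lra|]. rewrite sum_Sn. specialize (Hu (S m)).
change (sum_n u n <= sum_n u m + u (S m)). lra.
Qed.

Lemma sum_n_nonneg (u : nat -> R) (n : nat) : (forall k, 0 <= u k) -> 0 <= sum_n u n.
Proof. intros Hu. rewrite sum_n_Reals. now apply cond_pos_sum. Qed.

Lemma term_le_sum_n (u : nat -> R) (k n : nat) :
  (forall k, 0 <= u k) -> (k <= n)%nat -> u k <= sum_n u n.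
Proof.
intros Hu Hk. eapply Rle_trans; [|apply (sum_n_mono u k n Hu Hk)].
destruct k; [rewrite sum_O; lra|]. rewrite sum_Sn.
pose proof (sum_n_nonneg u k Hu). change (u (S k) <= sum_n u k + u (S k)). lra.
Qed.

Lemma term_le_Series (u : nat -> R) (n : nat) :
  (forall n, 0 <= u n) -> ex_series u -> u n <= Series u.
Proof.
intros Hu Hs. apply Rle_trans with (sum_n u n).
  now apply term_le_sum_n.
now apply Series_ge_partial.
Qed.

Lemma ex_series_Cmod (u : nat -> C) : ex_series (fun n => Cmod (u n)) -> ex_series u.
Proof.
intros H. apply (ex_series_le (V := C_CompleteNormedModule) u (fun n => Cmod (u n))).
  intros n. apply Rle_refl.
exact H.
Qed.

Lemma Cmod_series_le (u : nat -> C) (l : C) (b : nat -> R) :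
  is_series u l -> (forall n, Cmod (u n) <= b n) -> ex_series b -> Cmod l <= Series b.
Proof.
intros Hu Hb Hs.
apply (is_series_le_bound (V := C_NormedModule) u l b); [exact Hu|exact Hb|].
intros m. apply Series_ge_partial; [|exact Hs].
intros n. eapply Rle_trans; [apply Cmod_ge_0|apply Hb].
Qed.

Lemma abs_pseries_le (a : nat -> C) (r s : R) :
  0 <= s <= r -> abs_pseries a r -> abs_pseries a s.
Proof.
intros Hs. apply ex_series_le_R. intros n.
pose proof (Cmod_ge_0 (a n)). pose proof (pow_le s n (proj1 Hs)).
split; [now apply Rmult_le_pos|].
apply Rmult_le_compat_l; [easy|]. now apply pow_incr.
Qed.

Lemma abs_pseries_ex (a : nat -> C) (r : R) (z : C) :
  Cmod z <= r -> abs_pseries a r -> ex_series (fun n => (a n * z ^ n)%C).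
Proof.
intros Hz Ha. apply ex_series_Cmod.
apply ex_series_ext with (fun n => Cmod (a n) * Cmod z ^ n).
  intros n. now rewrite Cmod_mult, Cmod_pow.
apply abs_pseries_le with (2 := Ha). split; [apply Cmod_ge_0|exact Hz].
Qed.

(** Abel's lemma: the terms are dominated by the geometric sequence [B * (s / r) ^ n]. *)
Lemma abs_pseries_of_bounded (a : nat -> C) (r s B : R) :
  0 <= s < r -> (forall n, Cmod (a n) * r ^ n <= B) -> abs_pseries a s.
Proof.
intros Hs HB.
apply ex_series_le_R with (fun n => B * (s / r) ^ n).
- intros n. pose proof (Cmod_ge_0 (a n)). pose proof (pow_le s n (proj1 Hs)).
  split; [now apply Rmult_le_pos|].
  replace (Cmod (a n) * s ^ n) with (Cmod (a n) * r ^ n * (s / r) ^ n).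
    apply Rmult_le_compat_r; [|easy]. apply pow_le, Rdiv_le_0_compat; lra.
  unfold Rdiv. rewrite Rpow_mult_distr, pow_inv. field. apply pow_nonzero. lra.
- apply (ex_series_scal (V := R_NormedModule)), ex_series_geom.
  rewrite Rabs_pos_eq by (apply Rdiv_le_0_compat; lra).
  apply Rmult_lt_reg_r with r; [lra|]. unfold Rdiv. rewrite Rmult_assoc, Rinv_l; lra.
Qed.

(** Convergence bounds the partial sums by some [M], hence each term, a difference of two of them,
    by [M + M]; Abel's lemma then applies at any smaller radius. *)
Lemma pseries_abs (a : nat -> C) (z l : C) (s : R) :
  is_pseries a z l -> 0 <= s < Cmod z -> abs_pseries a s.
Proof.
intros H Hs. apply is_pseries_Cpow in H.
destruct (filterlim_bounded (K := C_AbsRing) (V := C_NormedModule) _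
  (ex_intro _ l H)) as [M HM].
apply abs_pseries_of_bounded with (Cmod z) (M + M); [exact Hs|].
intros n. rewrite <- Cmod_pow, <- Cmod_mult.
assert (HM' : forall n, Cmod (sum_n (fun n => (a n * z ^ n)%C) n) <= M) by exact HM.
destruct n.
- specialize (HM' 0%nat). rewrite sum_O in HM'.
  pose proof (Cmod_ge_0 (a 0%nat * z ^ 0)). lra.
- pose proof (HM' n) as H1. pose proof (HM' (S n)) as H2. rewrite sum_Sn in H2.
  set (x := sum_n _ n) in *. set (y := (a (S n) * z ^ S n)%C) in *.
  change (plus x y) with (x + y)%C in H2.
  replace y with ((x + y) + - x)%C by ring.
  eapply Rle_trans; [apply Cmod_triangle|]. rewrite Cmod_opp. lra.
Qed.

(** * Parseval's inequality on circles *)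

(* [ring] does not see through the canonical-structure carriers that [sum_n] and
   [is_series] leave in the type of an equation. *)
Ltac cring := match goal with |- ?a = ?b => apply (proj2 (Ceq_minus a b)); ring end.
Ltac rring := match goal with |- ?a = ?b => change (@eq R a b); ring end.

Lemma sum_n_S_C (u : nat -> C) (n : nat) : sum_n u (S n) = (sum_n u n + u (S n))%C.
Proof. exact (sum_Sn u n). Qed.

Lemma sum_n_scal_C (k : C) (u : nat -> C) (n : nat) :
  sum_n (fun i => (k * u i)%C) n = (k * sum_n u n)%C.
Proof. exact (sum_n_mult_l (K := C_Ring) k u n). Qed.

Lemma sum_n_conj (u : nat -> C) (n : nat) :
  Cconj (sum_n u n) = sum_n (fun i => Cconj (u i)) n.
Proof.
induction n; [now rewrite !sum_O|]. now rewrite !sum_n_S_C, Cplus_conj, IHn.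
Qed.

Lemma sum_n_RtoC (u : nat -> R) (n : nat) :
  sum_n (fun i => RtoC (u i)) n = RtoC (sum_n u n).
Proof.
induction n; [now rewrite !sum_O|]. rewrite sum_n_S_C, IHn, sum_Sn.
now rewrite <- RtoC_plus.
Qed.

Lemma sum_n_delta (u : nat -> C) (i n : nat) : (i <= n)%nat ->
  (forall j, (j <= n)%nat -> j <> i -> u j = RtoC 0) -> sum_n u n = u i.
Proof.
intros Hi Hu.
assert (H : forall m, (m <= n)%nat -> sum_n u m = if le_dec i m then u i else RtoC 0).
{ induction m; intros Hm.
- rewrite sum_O. destruct (le_dec i 0) as [H|H].
    now replace i with 0%nat by lia.
  apply Hu; lia.
- rewrite sum_n_S_C, IHm by lia. destruct (Nat.eq_dec i (S m)) as [->|Hne].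
    destruct (le_dec (S m) m); [lia|]. destruct (le_dec (S m) (S m)); [cring|lia].
  rewrite (Hu (S m)) by lia.
  destruct (le_dec i m), (le_dec i (S m)); try lia; cring. }
rewrite H by lia. destruct (le_dec i n); [easy|lia].
Qed.

Lemma exists_primitive_root (m : nat) : exists w : C,
  Cmod w = 1 /\ (w ^ S m)%C = 1 /\
  forall d, (0 < d <= m)%nat -> (w ^ d)%C <> 1.
Proof.
pose proof (pos_INR m) as Hm. pose proof PI_RGT_0 as Hpi.
set (t := 2 * PI / INR (S m)).
assert (Hmoivre : forall n, ((cos t, sin t) ^ n)%C = (cos (INR n * t), sin (INR n * t))).
{ induction n.
  - simpl. rewrite Rmult_0_l, cos_0, sin_0. easy.
  - rewrite Cpow_S, IHn, S_INR, Rmult_plus_distr_r, Rmult_1_l, cos_plus, sin_plus.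
    unfold Cmult; simpl. f_equal; ring. }
assert (HS : 0 < INR (S m)) by (rewrite S_INR; lra).
exists (cos t, sin t). repeat split.
- unfold Cmod; simpl fst; simpl snd. rewrite <- !Rsqr_pow2, Rplus_comm, sin2_cos2.
  apply sqrt_1.
- rewrite Hmoivre. unfold t.
  replace (INR (S m) * _) with (2 * PI) by (field; lra).
  now rewrite cos_2PI, sin_2PI.
(* Compare real parts: [cos (2 a) = 1 - 2 sin^2 a] with [a = PI * d / (m + 1)] strictly between 0
   and [PI], where the sine is positive. *)
- intros d Hd E. rewrite Hmoivre in E. apply (f_equal Re) in E. simpl in E.
  assert (Hd1 : 0 < INR d) by (apply lt_0_INR; lia).
  assert (Hd2 : INR d < INR (S m)) by (apply lt_INR; lia).
  replace (INR d * t) with (2 * (PI * (INR d / INR (S m)))) in E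
    by (unfold t; field; lra).
  rewrite cos_2a_sin in E.
  assert (0 < INR d / INR (S m) < 1).
  { split; [now apply Rdiv_lt_0_compat|].
    apply Rmult_lt_reg_r with (INR (S m)); [lra|].
    unfold Rdiv. rewrite Rmult_assoc, Rinv_l; lra. }
  assert (0 < sin (PI * (INR d / INR (S m)))).
  { apply sin_gt_0; nra. }
  nra.
Qed.

Lemma geometric_sum_C (q : C) (m : nat) :
  ((q - 1) * sum_n (fun k => q ^ k)%C m)%C = (q ^ S m - 1)%C.
Proof.
induction m.
- rewrite sum_O. simpl. cring.
- rewrite sum_n_S_C, Cmult_plus_distr_l, IHm, !Cpow_S. cring.
Qed.

Lemma Cpow_conj (z : C) (n : nat) : Cconj (z ^ n)%C = (Cconj z ^ n)%C.
Proof.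
induction n; [simpl; unfold Cconj; simpl; now rewrite Ropp_0|].
now rewrite !Cpow_S, Cmult_conj, IHn.
Qed.

(** Orthogonality of the characters of the cyclic group of order [m + 1]: expand the squared modulus
    as a double sum over [i] and [j] and sum over [k] first. For [i <> j] this is a geometric sum of
    ratio [q <> 1] with [q ^ S m = 1], so it vanishes. *)
Lemma finite_parseval (p : nat -> C) (m : nat) (w : C) :
  Cmod w = 1 -> (w ^ S m)%C = 1 -> (forall d, (0 < d <= m)%nat -> (w ^ d)%C <> 1) ->
  sum_n (fun k => Cmod (sum_n (fun i => p i * (w ^ k) ^ i)%C m) ^ 2) m
  = INR (S m) * sum_n (fun i => Cmod (p i) ^ 2) m.
Proof.
intros Hw1 HwN Hw.
assert (Hwc : (w * Cconj w)%C = 1) by (rewrite <- Cmod2_conj, Hw1; f_equal; ring).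
assert (Hpc : forall n, (w ^ n * Cconj w ^ n)%C = 1).
{ intros n. now rewrite <- Cpow_mult_l, Hwc, Cpow_1_l. }
assert (Hgeo : forall i j, (i <= m)%nat -> (j <= m)%nat -> i <> j ->
  sum_n (fun k => (w ^ i * Cconj w ^ j) ^ k)%C m = RtoC 0).
{ intros i j Hi Hj Hij. set (q := (w ^ i * Cconj w ^ j)%C).
  assert (HqN : (q ^ S m)%C = 1).
  { unfold q. rewrite Cpow_mult_l, <- !Cpow_mult_r, !(Nat.mul_comm _ (S m)), !Cpow_mult_r.
    rewrite <- Cpow_conj, HwN, Cpow_1_l.
    replace (Cconj 1) with (RtoC 1) by (unfold Cconj; simpl; now rewrite Ropp_0).
    rewrite Cpow_1_l. cring. }
  pose proof (geometric_sum_C q m) as Hg. rewrite HqN in Hg.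
  assert (Hq1 : (q - 1)%C <> 0).
  { intros E. assert (Eq : q = 1) by (replace q with (q - 1 + 1)%C by cring; rewrite E; cring).
    assert (Eij : (w ^ i)%C = (w ^ j)%C).
    { replace (w ^ i)%C with (w ^ i * (w ^ j * Cconj w ^ j))%C by (rewrite Hpc; cring).
      replace (w ^ i * (w ^ j * Cconj w ^ j))%C with (q * w ^ j)%C by (unfold q; cring).
      rewrite Eq. cring. }
    (* On the unit circle [Cconj w] inverts [w], so equal powers [a < b] would give
       [w ^ (b - a) = 1], against primitivity. *)
    assert (Hc : forall a b, (a < b)%nat -> (b <= m)%nat -> (w ^ a)%C = (w ^ b)%C -> False).
    { intros a b Hab Hb Ewab. apply (Hw (b - a)%nat); [lia|].
      replace b with (a + (b - a))%nat in Ewab by lia. rewrite Cpow_add_r in Ewab.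
      replace (w ^ (b - a))%C with (w ^ a * w ^ (b - a) * Cconj w ^ a)%C.
        rewrite <- Ewab. apply Hpc.
      replace (w ^ a * w ^ (b - a) * Cconj w ^ a)%C
        with (w ^ (b - a) * (w ^ a * Cconj w ^ a))%C by cring.
      rewrite Hpc. cring. }
    destruct (Nat.lt_total i j) as [H|[H|H]]; [|lia|].
      now apply (Hc i j).
    now apply (Hc j i). }
  replace (RtoC 1 - 1)%C with (RtoC 0) in Hg by cring.
  destruct (Ceq_dec (sum_n (fun k => q ^ k)%C m) 0) as [E|E]; [exact E|].
  exfalso. now apply (Cmult_neq_0 _ _ Hq1 E). }
apply RtoC_inj. rewrite <- sum_n_RtoC, RtoC_mult, <- sum_n_RtoC, <- sum_n_scal_C.
rewrite (sum_n_ext _ (fun k => sum_n (fun i => sum_n (fun j =>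
  (p i * Cconj (p j) * (w ^ i * Cconj w ^ j) ^ k)%C) m) m)).
2:{ intros k. rewrite Cmod2_conj, sum_n_conj, Cmult_comm, <- sum_n_scal_C.
  apply sum_n_ext. intros i. rewrite Cmult_comm, <- sum_n_scal_C.
  apply sum_n_ext. intros j.
  rewrite Cmult_conj, !Cpow_conj, Cpow_mult_l, <- !Cpow_mult_r.
  rewrite (Nat.mul_comm k i), (Nat.mul_comm k j). cring. }
rewrite sum_n_switch. apply sum_n_ext_loc. intros i Hi.
rewrite sum_n_switch.
rewrite (sum_n_delta _ i m Hi).
- rewrite (sum_n_ext _ (fun k => RtoC (Cmod (p i) ^ 2))).
    rewrite sum_n_RtoC, sum_n_const, RtoC_mult. reflexivity.
  intros k. rewrite Hpc, Cpow_1_l, Cmod2_conj. cring.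
- intros j Hj Hji. rewrite sum_n_scal_C, Hgeo by auto. cring.
Qed.

Lemma Series_tail_lt (b : nat -> R) (eps : R) : ex_series b -> 0 < eps ->
  exists N, forall m, (N <= m)%nat -> Series b - sum_n b m < eps.
Proof.
intros Hb Heps.
destruct (proj1 (is_series_norm (V := R_NormedModule) b (Series b))
  (Series_correct _ Hb) (mkposreal _ Heps)) as [N HN].
exists N. intros m Hm. specialize (HN m Hm). simpl pos in HN.
change (Rabs (sum_n b m - Series b) < eps) in HN.
apply Rabs_def2 in HN. lra.
Qed.

Lemma Cmod_tail_le (x : nat -> C) (l : C) (b : nat -> R) (m : nat) :
  is_series x l -> (forall n, Cmod (x n) <= b n) -> ex_series b ->
  Cmod (l - sum_n x m) <= Series b - sum_n b m.
Proof.
intros Hx Hxb Hb.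
assert (Ht : is_series (fun k => x (S m + k)%nat) (l - sum_n x m)%C).
{ apply is_series_incr_n; [lia|]. simpl Init.Nat.pred.
  match goal with |- is_series _ ?y => replace y with l; [exact Hx|] end.
  change (l = (l - sum_n x m + sum_n x m)%C). ring. }
replace (Series b - sum_n b m) with (Series (fun k => b (S m + k)%nat)).
- apply (Cmod_series_le _ _ _ Ht); [easy|].
  now apply (ex_series_incr_n (V := R_NormedModule) b).
- rewrite (Series_incr_n b (S m)) by (lia || exact Hb).
  rewrite sum_n_Reals. simpl Init.Nat.pred. lra.
Qed.

Lemma sum_n_le (u v : nat -> R) (n : nat) :
  (forall k, (k <= n)%nat -> u k <= v k) -> sum_n u n <= sum_n v n.
Proof. intros H. rewrite !sum_n_Reals. now apply sum_Rle. Qed.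

Lemma sum_n_affine (A B : R) (x : nat -> R) (n : nat) :
  sum_n (fun k => A * x k + B) n = A * sum_n x n + INR (S n) * B.
Proof.
induction n; [rewrite !sum_O; simpl; ring|].
rewrite !sum_Sn, IHn, (S_INR (S n)). unfold plus; simpl. ring.
Qed.

Lemma Cmod_sum_n_le (x : nat -> C) (n : nat) :
  Cmod (sum_n x n) <= sum_n (fun k => Cmod (x k)) n.
Proof.
induction n; [rewrite !sum_O; lra|].
rewrite sum_n_S_C, sum_Sn. eapply Rle_trans; [apply Cmod_triangle|].
now apply Rplus_le_compat_r.
Qed.

Lemma Cmod_term_unit (x : C) (w : C) (n : nat) : Cmod w = 1 ->
  Cmod (x * w ^ n) = Cmod x.
Proof. intros Hw. rewrite Cmod_mult, Cmod_pow, Hw, pow1. ring. Qed.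

(* The partial sums of degree [m] are compared in quadratic mean over the
   [(m + 1)]-st roots of unity, where the discrete Parseval identity is exact. *)
Lemma parseval_le (u v : nat -> C) (M S : R) : 0 <= M ->
  ex_series (fun n => Cmod (u n)) -> ex_series (fun n => Cmod (v n)) ->
  (forall w U V, Cmod w = 1 -> is_series (fun n => (u n * w ^ n)%C) U ->
     is_series (fun n => (v n * w ^ n)%C) V -> Cmod V <= M * Cmod U) ->
  (forall m, sum_n (fun n => Cmod (u n) ^ 2) m <= S) ->
  forall K, sum_n (fun n => Cmod (v n) ^ 2) K <= M ^ 2 * S.
Proof.
intros HM Hu Hv HUV HS K.
set (Q := Series (fun n => Cmod (u n))).
assert (HQ : 0 <= Q) by (apply Series_nonneg; [intros; apply Cmod_ge_0|exact Hu]).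
(* Comes from expanding [(M * Cmod P + (M + 1) * eps) ^ 2] with [Cmod P <= Q] and [eps <= 1]:
   everything beyond [M ^ 2 * Cmod P ^ 2] is at most [eps * c]. The final [+ 1] keeps [c] positive,
   so that [e / c] makes sense. *)
set (c := 2 * M * (M + 1) * Q + (M + 1) ^ 2 + 1).
assert (Hc : 0 < c) by (unfold c; nra).
apply le_epsilon. intros e He.
set (eps := Rmin 1 (e / c)).
assert (Heps : 0 < eps) by (apply Rmin_pos; [lra|now apply Rdiv_lt_0_compat]).
assert (Heps1 : eps <= 1) by apply Rmin_l.
assert (Hepsc : eps * c <= e).
{ replace e with (e / c * c) by (field; lra). apply Rmult_le_compat_r; [lra|].
  apply Rmin_r. }
destruct (Series_tail_lt _ eps Hu Heps) as [N1 HN1].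
destruct (Series_tail_lt _ eps Hv Heps) as [N2 HN2].
set (m := Nat.max K (Nat.max N1 N2)).
specialize (HN1 m ltac:(lia)). specialize (HN2 m ltac:(lia)).
destruct (exists_primitive_root m) as [w [Hw1 [HwN Hw]]].
assert (Hpt : forall k, Cmod (sum_n (fun i => v i * (w ^ k) ^ i)%C m) ^ 2
  <= M ^ 2 * Cmod (sum_n (fun i => u i * (w ^ k) ^ i)%C m) ^ 2 + eps * c).
{ intros k. set (z := (w ^ k)%C).
  assert (Hz : Cmod z = 1) by (unfold z; now rewrite Cmod_pow, Hw1, pow1).
  assert (HU := CSeries_correct (fun n => (u n * z ^ n)%C)).
  assert (HV := CSeries_correct (fun n => (v n * z ^ n)%C)).
  set (U := CSeries (fun n => (u n * z ^ n)%C)) in *.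
  set (V := CSeries (fun n => (v n * z ^ n)%C)) in *.
  assert (HU' : is_series (fun n => (u n * z ^ n)%C) U).
  { apply HU, ex_series_Cmod. revert Hu. apply ex_series_ext.
    intros n. now rewrite Cmod_term_unit. }
  assert (HV' : is_series (fun n => (v n * z ^ n)%C) V).
  { apply HV, ex_series_Cmod. revert Hv. apply ex_series_ext.
    intros n. now rewrite Cmod_term_unit. }
  pose proof (HUV z U V Hz HU' HV') as H1.
  assert (H2 : Cmod (U - sum_n (fun i => u i * z ^ i)%C m) <= eps).
  { eapply Rle_trans; [apply (Cmod_tail_le _ _ (fun n => Cmod (u n)) m HU')|lra].
    intros n. rewrite Cmod_term_unit by exact Hz. lra.
    exact Hu. }
  assert (H3 : Cmod (V - sum_n (fun i => v i * z ^ i)%C m) <= eps).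
  { eapply Rle_trans; [apply (Cmod_tail_le _ _ (fun n => Cmod (v n)) m HV')|lra].
    intros n. rewrite Cmod_term_unit by exact Hz. lra.
    exact Hv. }
  assert (H4 : Cmod (sum_n (fun i => u i * z ^ i)%C m) <= Q).
  { eapply Rle_trans; [apply Cmod_sum_n_le|].
    eapply Rle_trans; [|apply (Series_ge_partial _ m (fun n => Cmod_ge_0 (u n)) Hu)].
    apply sum_n_le. intros n _. rewrite Cmod_term_unit by exact Hz. lra. }
  set (P := sum_n (fun i => u i * z ^ i)%C m) in *.
  set (R := sum_n (fun i => v i * z ^ i)%C m) in *.
  assert (H5 : Cmod U <= Cmod P + eps).
  { replace U with (P + (U - P))%C by cring.
    eapply Rle_trans; [apply Cmod_triangle|lra]. }
  assert (H6 : Cmod R <= Cmod V + eps).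
  { replace R with (V + - (V - R))%C by cring.
    eapply Rle_trans; [apply Cmod_triangle|]. rewrite Cmod_opp. lra. }
  (* Truncation is paid twice: [|R| <= |V| + eps <= M * |U| + eps <= M * (|P| + eps) + eps]. *)
  assert (H7 : Cmod R <= M * Cmod P + (M + 1) * eps) by nra.
  pose proof (Cmod_ge_0 P). pose proof (Cmod_ge_0 R).
  assert (H8 : Cmod R ^ 2 <= (M * Cmod P + (M + 1) * eps) ^ 2)
    by (apply pow_incr; lra).
  assert (H9 : 2 * M * (M + 1) * eps * Cmod P <= 2 * M * (M + 1) * eps * Q).
  { apply Rmult_le_compat_l; [|exact H4]. repeat apply Rmult_le_pos; lra. }
  assert (H10 : (M + 1) ^ 2 * eps * eps <= (M + 1) ^ 2 * eps * 1).
  { apply Rmult_le_compat_l; [|exact Heps1]. apply Rmult_le_pos; [apply pow2_ge_0|lra]. }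
  unfold c. nra. }
pose proof (finite_parseval u m w Hw1 HwN Hw) as Pu.
pose proof (finite_parseval v m w Hw1 HwN Hw) as Pv.
pose proof (sum_n_le _ _ m (fun k _ => Hpt k)) as Hsum.
rewrite Pv in Hsum.
assert (HSm : 0 < INR (Datatypes.S m)) by (apply lt_0_INR; lia).
rewrite sum_n_affine, Pu in Hsum.
apply Rle_trans with (sum_n (fun n => Cmod (v n) ^ 2) m).
  apply sum_n_mono; [intros; apply pow2_ge_0|lia].
specialize (HS m).
apply Rmult_le_reg_l with (INR (Datatypes.S m)); [exact HSm|].
eapply Rle_trans; [exact Hsum|].
pose proof (pow2_ge_0 M).
assert (M ^ 2 * sum_n (fun i => Cmod (u i) ^ 2) m <= M ^ 2 * S)
  by now apply Rmult_le_compat_l.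
nra.
Qed.

Lemma parseval_circle_le (a b : nat -> C) (r M S : R) : 0 <= r -> 0 <= M ->
  abs_pseries a r -> abs_pseries b r ->
  (forall z A B, Cmod z = r -> is_series (fun n => (a n * z ^ n)%C) A ->
     is_series (fun n => (b n * z ^ n)%C) B -> Cmod B <= M * Cmod A) ->
  (forall m, sum_n (fun n => (Cmod (a n) * r ^ n) ^ 2) m <= S) ->
  forall K, sum_n (fun n => (Cmod (b n) * r ^ n) ^ 2) K <= M ^ 2 * S.
Proof.
intros Hr HM Ha Hb Hab HS.
assert (Hmod : forall x n, Cmod (x * RtoC r ^ n) = Cmod x * r ^ n).
{ intros x n. now rewrite Cmod_mult, Cmod_pow, Cmod_R, Rabs_pos_eq. }
intros K.
rewrite (sum_n_ext _ (fun n => Cmod (b n * RtoC r ^ n) ^ 2))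
  by (intros n; now rewrite Hmod).
apply (parseval_le (fun n => (a n * RtoC r ^ n)%C)); [exact HM| | | |].
- revert Ha. apply ex_series_ext. intros n. now rewrite Hmod.
- revert Hb. apply ex_series_ext. intros n. now rewrite Hmod.
- intros w A B Hw HA HB. apply (Hab (r * w)%C).
  + rewrite Cmod_mult, Hw, Cmod_R, Rabs_pos_eq by exact Hr. ring.
  + revert HA. apply is_series_ext. intros n. rewrite Cpow_mult_l. cring.
  + revert HB. apply is_series_ext. intros n. rewrite Cpow_mult_l. cring.
- intros m. rewrite (sum_n_ext _ (fun n => (Cmod (a n) * r ^ n) ^ 2)); [apply HS|].
  intros n. now rewrite Hmod.
Qed.

(** * Cauchy's estimate, and coefficients determined by values near the centre *)

Lemma is_series_zero_C : is_series (fun _ : nat => RtoC 0) (RtoC 0).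
Proof.
generalize (pseries_zero (RtoC 0)). intros H. apply is_pseries_Cpow in H.
revert H. apply is_series_ext. intros n. cring.
Qed.

Lemma is_series_single (u : nat -> C) (l : C) : u 0%nat = l ->
  (forall n, u (S n) = RtoC 0) -> is_series u l.
Proof.
intros H0 H. apply is_series_decr_1.
match goal with |- is_series _ ?y => replace y with (RtoC 0) end.
- generalize is_series_zero_C. apply is_series_ext. intros n. now rewrite H.
- rewrite H0. change (RtoC 0 = (l + - l)%C). ring.
Qed.

Lemma cauchy_estimate (b : nat -> C) (r M : R) : 0 <= r -> abs_pseries b r ->
  (forall z B, Cmod z = r -> is_series (fun n => (b n * z ^ n)%C) B -> Cmod B <= M) ->
  forall k, Cmod (b k) * r ^ k <= M.
Proof.
intros Hr Hb HM k.
assert (Hz : Cmod (RtoC r) = r) by now rewrite Cmod_R, Rabs_pos_eq.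
assert (HM0 : 0 <= M).
{ destruct (abs_pseries_ex b r (RtoC r)) as [B HB]; [lra|exact Hb|].
  apply Rle_trans with (Cmod B); [apply Cmod_ge_0|]. now apply (HM r). }
set (a := fun n : nat => if n then RtoC 1 else RtoC 0).
assert (Ha : forall n, Cmod (a n) * r ^ n = if n then 1 else 0).
{ intros [|n]; unfold a; [rewrite Cmod_1; simpl|rewrite Cmod_0]; ring. }
assert (Hs : sum_n (fun n => (Cmod (b n) * r ^ n) ^ 2) k <= M ^ 2 * 1).
{ apply parseval_circle_le with a; [exact Hr|exact HM0| |exact Hb| |].
  - apply ex_series_incr_1. apply ex_series_ext with (fun n => 0 * (/2) ^ n).
      intros n. rewrite Ha. rring.
    apply (ex_series_scal (V := R_NormedModule) 0), ex_series_geom.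
    rewrite Rabs_pos_eq; lra.
  - intros z A B Hzr HA HB.
    replace A with (RtoC 1).
      rewrite Cmod_1, Rmult_1_r. now apply (HM z).
    apply (is_series_norm_unique (V := C_NormedModule)) with (2 := HA).
    apply is_series_single.
      unfold a. simpl. ring.
    intros n. unfold a. cring.
  - intros m. apply Req_le. induction m.
      rewrite sum_O, Ha. ring.
    rewrite sum_Sn, IHm, Ha. unfold plus; simpl. ring. }
assert (H : (Cmod (b k) * r ^ k) ^ 2 <= M ^ 2).
{ rewrite Rmult_1_r in Hs. eapply Rle_trans; [|exact Hs].
  apply (term_le_sum_n (fun n => (Cmod (b n) * r ^ n) ^ 2)); [|lia].
  intros n. apply pow2_ge_0. }
apply Rsqr_incr_0_var; [|exact HM0]. now rewrite !Rsqr_pow2.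
Qed.

Lemma is_series_shift_C (u : nat -> C) (l : C) :
  is_series u l -> is_series (fun n => u (S n)) (l - u 0%nat)%C.
Proof.
intros H. apply is_series_incr_1.
match goal with |- is_series _ ?y => replace y with l end; [exact H|].
change (l = (l - u 0%nat + u 0%nat)%C). ring.
Qed.

Lemma is_series_scal_C (k : C) (u : nat -> C) (l : C) :
  is_series u l -> is_series (fun n => (k * u n)%C) (k * l)%C.
Proof. exact (is_series_scal (V := C_NormedModule) k u l). Qed.

Lemma abs_pseries_shift (c : nat -> C) (r : R) : 0 < r ->
  abs_pseries c r -> abs_pseries (fun n => c (S n)) r.
Proof.
intros Hr H. apply ex_series_incr_1 in H.
apply (ex_series_scal (V := R_NormedModule) (/ r)) in H. revert H.
apply ex_series_ext. intros n. unfold scal; simpl; unfold mult; simpl. field. lra.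
Qed.

(** At a zero [h] the constant coefficient equals [- h * G], where [G] is the sum of the shifted
    series and stays bounded by [B]; the zeros [h] can be taken arbitrarily small. *)
Lemma pseries_zeros_coef0 (c : nat -> C) (r : R) : 0 < r -> abs_pseries c r ->
  (forall eps, 0 < eps -> exists h, 0 < Cmod h < eps /\
     is_series (fun n => (c n * h ^ n)%C) (RtoC 0)) ->
  c 0%nat = RtoC 0.
Proof.
intros Hr Hc Hz. apply Cmod_eq_0. apply Rle_antisym; [|apply Cmod_ge_0].
pose proof (abs_pseries_shift c r Hr Hc) as Hs.
set (B := Series (fun n => Cmod (c (S n)) * r ^ n)).
assert (HB : 0 <= B).
{ apply Series_nonneg; [|exact Hs]. intros n. apply Rmult_le_pos; [apply Cmod_ge_0|].
  apply pow_le. lra. }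
apply le_epsilon. intros e He. rewrite Rplus_0_l.
destruct (Hz (Rmin r (e / (B + 1)))) as [h [[Hh0 Hh] H0]].
{ apply Rmin_pos; [exact Hr|]. apply Rdiv_lt_0_compat; lra. }
assert (Hhr : Cmod h < r) by (eapply Rlt_le_trans; [exact Hh|apply Rmin_l]).
assert (Hhe : Cmod h < e / (B + 1)) by (eapply Rlt_le_trans; [exact Hh|apply Rmin_r]).
apply is_series_shift_C in H0.
replace (RtoC 0 - c 0%nat * h ^ 0)%C with (- c 0%nat)%C in H0 by (simpl; ring).
destruct (abs_pseries_ex _ r h ltac:(lra) Hs) as [G HG].
assert (HGB : Cmod G <= B).
{ apply (Cmod_series_le _ _ _ HG); [|exact Hs]. intros n.
  rewrite Cmod_mult, Cmod_pow. apply Rmult_le_compat_l; [apply Cmod_ge_0|].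
  apply pow_incr. split; [apply Cmod_ge_0|lra]. }
assert (E : (- c 0%nat)%C = (h * G)%C).
{ apply (is_series_norm_unique (V := C_NormedModule)) with (1 := H0).
  generalize (is_series_scal_C h _ _ HG). apply is_series_ext.
  intros n. rewrite Cpow_S. cring. }
rewrite <- Cmod_opp, E, Cmod_mult.
apply Rle_trans with (e / (B + 1) * (B + 1)); [|right; field; lra].
apply Rmult_le_compat; try apply Cmod_ge_0; lra.
Qed.

(** Once the constant coefficient is known to vanish, dividing by [h <> 0] shows that the shifted
    series has the same zeros, and the argument repeats. *)
Lemma pseries_zeros_coef (c : nat -> C) (r : R) : 0 < r -> abs_pseries c r ->
  (forall eps, 0 < eps -> exists h, 0 < Cmod h < eps /\
     is_series (fun n => (c n * h ^ n)%C) (RtoC 0)) ->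
  forall n, c n = RtoC 0.
Proof.
intros Hr Hc Hz n. revert c Hc Hz. induction n; intros c Hc Hz.
  now apply pseries_zeros_coef0 with r.
apply (IHn (fun n => c (S n))); [now apply abs_pseries_shift|].
intros eps Heps. destruct (Hz eps Heps) as [h [Hh H0]]. exists h. split; [exact Hh|].
assert (c 0%nat = RtoC 0) as E by now apply pseries_zeros_coef0 with r.
apply is_series_shift_C in H0. rewrite E in H0.
apply (is_series_scal_C (/ h)) in H0.
assert (h <> RtoC 0) by (apply Cmod_gt_0; lra).
replace (/ h * (0 - 0 * h ^ 0))%C with (RtoC 0) in H0 by ring.
revert H0. apply is_series_ext. intros k. rewrite Cpow_S.
match goal with |- ?a = ?b => change (@eq C a b) end. field. exact H.
Qed.

Lemma pseries_coef_ext (b c : nat -> C) (r : R) : 0 < r ->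
  abs_pseries b r -> abs_pseries c r ->
  (forall eps, 0 < eps -> exists h s, 0 < Cmod h < eps /\
     is_series (fun n => (b n * h ^ n)%C) s /\ is_series (fun n => (c n * h ^ n)%C) s) ->
  forall n, b n = c n.
Proof.
intros Hr Hb Hc H n.
replace (b n) with (b n - c n + c n)%C by ring.
rewrite (pseries_zeros_coef (fun n => (b n - c n)%C) r Hr); [ring| |].
- apply ex_series_le_R with (fun n => Cmod (b n) * r ^ n + Cmod (c n) * r ^ n).
  + intros k. pose proof (pow_le r k (Rlt_le _ _ Hr)). pose proof (Cmod_ge_0 (b k - c k)).
    split; [now apply Rmult_le_pos|]. rewrite <- Rmult_plus_distr_r.
    apply Rmult_le_compat_r; [easy|]. unfold Cminus.
    rewrite <- (Cmod_opp (c k)). apply Cmod_triangle.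
  + now apply (ex_series_plus (V := R_NormedModule)).
- intros eps Heps. destruct (H eps Heps) as [h [s [Hh [H1 H2]]]].
  exists h. split; [exact Hh|].
  replace (RtoC 0) with (s - s)%C by ring.
  generalize (is_series_minus _ _ _ _ H1 H2). apply is_series_ext.
  intros k. match goal with |- plus ?x (opp ?y) = _ =>
    change ((x - y)%C = ((b k - c k) * h ^ k)%C) end. ring.
Qed.

(** * Recentring power series *)

(** Pascal's rule holds by computation and the value is 0 for [k > n], so binomial sums may run
    beyond [n], as the double series in [recentre] requires. *)
Fixpoint binom (n k : nat) : nat :=
  match k, n with
  | O, _ => 1
  | S _, O => 0
  | S k', S n' => binom n' k' + binom n' k
  end.

Lemma binom_gt (n k : nat) : (n < k)%nat -> binom n k = 0%nat.
Proof.
revert k. induction n; intros [|k] H; try lia; [easy|].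
simpl. rewrite !IHn by lia. easy.
Qed.

Lemma sum_n_first_C (u : nat -> C) (n : nat) :
  sum_n u (S n) = (u 0%nat + sum_n (fun k => u (S k)) n)%C.
Proof.
induction n; [rewrite sum_n_S_C, !sum_O; cring|].
rewrite sum_n_S_C, IHn, sum_n_S_C. cring.
Qed.

Lemma binomial_C (x h : C) (n : nat) :
  sum_n (fun k => RtoC (INR (binom n k)) * x ^ (n - k) * h ^ k)%C n = ((x + h) ^ n)%C.
Proof.
induction n; [rewrite sum_O; simpl; cring|].
rewrite Cpow_S, <- IHn, sum_n_first_C.
rewrite (sum_n_ext _ (fun k => h * (RtoC (INR (binom n k)) * x ^ (n - k) * h ^ k)
  + RtoC (INR (binom n (S k))) * x ^ (n - k) * h ^ S k)%C).
2:{ intros k. change (binom (S n) (S k)) with (binom n k + binom n (S k))%nat.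
  rewrite plus_INR, RtoC_plus, Cpow_S. simpl Nat.sub. cring. }
match goal with |- context [sum_n (fun k => (@?f k + @?g k)%C) n] =>
  replace (sum_n (fun k => (f k + g k)%C) n) with (sum_n f n + sum_n g n)%C
    by (symmetry; exact (sum_n_plus f g n)) end.
rewrite (sum_n_scal_C h), Cmult_plus_distr_r.
set (P := sum_n _ n) at 1 3.
assert (E : (x * P)%C = (x ^ S n
  + sum_n (fun k => RtoC (INR (binom n (S k))) * x ^ (n - k) * h ^ S k)%C n)%C).
{ transitivity (sum_n (fun k => RtoC (INR (binom n k)) * x ^ (S n - k) * h ^ k)%C (S n)).
  - rewrite sum_n_S_C, binom_gt by lia. unfold P. rewrite <- sum_n_scal_C.
    rewrite (sum_n_ext_loc _ (fun k => RtoC (INR (binom n k)) * x ^ (S n - k) * h ^ k)%C).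
      simpl INR. cring.
    intros k Hk. rewrite Nat.sub_succ_l, Cpow_S by exact Hk. cring.
  - rewrite sum_n_first_C. f_equal.
    destruct n; simpl; cring. }
fold P. rewrite E. simpl binom. simpl INR.
replace (S n - 0)%nat with (S n) by lia. simpl (h ^ 0)%C. cring.
Qed.

Lemma binomial_R (x y : R) (n : nat) :
  (x + y) ^ n = sum_n (fun k => INR (binom n k) * x ^ (n - k) * y ^ k) n.
Proof.
apply RtoC_inj. rewrite <- sum_n_RtoC.
rewrite (sum_n_ext _ (fun k => RtoC (INR (binom n k)) * RtoC x ^ (n - k) * RtoC y ^ k)%C).
- rewrite binomial_C, <- RtoC_plus. now rewrite <- !pow_n_RtoC.
- intros j. rewrite !RtoC_mult. now rewrite <- !pow_n_RtoC.
Qed.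

Lemma binom_term_le (x y : R) (n k : nat) : 0 <= x -> 0 <= y ->
  INR (binom n k) * x ^ (n - k) * y ^ k <= (x + y) ^ n.
Proof.
intros Hx Hy.
destruct (le_lt_dec k n) as [Hk|Hk].
- rewrite binomial_R. set (f := fun k => _).
  assert (Hf : forall k, 0 <= f k).
  { intros j. unfold f. repeat apply Rmult_le_pos; try apply pos_INR; now apply pow_le. }
  exact (term_le_sum_n f k n Hf Hk).
- rewrite binom_gt by exact Hk. simpl INR. rewrite !Rmult_0_l. apply pow_le. lra.
Qed.

(** The bound is uniform in the truncation [K]; this is the domination needed to exchange the two
    summations in [recentre]. *)
Lemma binomial_partial_le (x h : C) (n K : nat) :
  Cmod (sum_n (fun k => RtoC (INR (binom n k)) * x ^ (n - k) * h ^ k)%C K)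
  <= (Cmod x + Cmod h) ^ n.
Proof.
set (f := fun k => INR (binom n k) * Cmod x ^ (n - k) * Cmod h ^ k).
pose proof (Cmod_ge_0 x) as Hx. pose proof (Cmod_ge_0 h) as Hh.
assert (Hf : forall k, 0 <= f k).
{ intros j. unfold f. repeat apply Rmult_le_pos; try apply pos_INR; now apply pow_le. }
assert (E : (Cmod x + Cmod h) ^ n = sum_n f n) by apply binomial_R.
eapply Rle_trans; [apply Cmod_sum_n_le|]. rewrite E.
rewrite (sum_n_ext _ f).
2:{ intros k. unfold f. rewrite !Cmod_mult, !Cmod_pow, Cmod_R, Rabs_pos_eq by apply pos_INR.
  reflexivity. }
apply Rle_trans with (sum_n f (Nat.max n K)).
  apply sum_n_mono; [exact Hf|lia].
right. destruct (Nat.le_exists_sub n (Nat.max n K)) as [d [Hd _]]; [lia|].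
rewrite Hd. clear Hd. induction d; [easy|].
change (S d + n)%nat with (S (d + n)). rewrite sum_Sn, IHd. unfold f at 2. rewrite binom_gt by lia.
unfold plus; simpl. ring.
Qed.

(** For [f] with coefficients [a], the coefficients of the [k]-th derivative of [f] divided by
    [k!]. *)
Definition taylor_coef (a : nat -> C) (k j : nat) : C :=
  (RtoC (INR (binom (j + k) k)) * a (j + k)%nat)%C.

(** The [k]-th Taylor coefficient at [z] of the sum of the series. *)
Definition recentred (a : nat -> C) (z : C) (k : nat) : C :=
  CSeries (fun j => taylor_coef a k j * z ^ j)%C.

(** [binom (j + k) k * s ^ j * (r - s) ^ k] is one term of the expansion of
    [(s + (r - s)) ^ (j + k) = r ^ (j + k)]: the loss of radius pays for the binomial factor. *)
Lemma taylor_coef_abs (a : nat -> C) (k : nat) (r s : R) : 0 <= s < r ->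
  abs_pseries a r -> abs_pseries (taylor_coef a k) s.
Proof.
intros Hs Ha. unfold abs_pseries.
apply ex_series_le_R with
  (fun j => / (r - s) ^ k * (Cmod (a (k + j)%nat) * r ^ (k + j))).
- intros j. unfold taylor_coef. rewrite Cmod_mult, Cmod_R, Rabs_pos_eq by apply pos_INR.
  pose proof (Cmod_ge_0 (a (j + k)%nat)). pose proof (pow_le s j (proj1 Hs)).
  pose proof (pos_INR (binom (j + k) k)).
  split; [now repeat apply Rmult_le_pos|].
  pose proof (binom_term_le s (r - s) (j + k) k ltac:(lra) ltac:(lra)) as Hb.
  replace (s + (r - s)) with r in Hb by ring.
  replace (j + k - k)%nat with j in Hb by lia.
  assert (Hp : 0 < (r - s) ^ k) by (apply pow_lt; lra).
  rewrite (Nat.add_comm k j).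
  apply Rmult_le_reg_l with ((r - s) ^ k); [exact Hp|].
  set (X := Cmod (a (j + k)%nat) * r ^ (j + k)).
  replace ((r - s) ^ k * (/ (r - s) ^ k * X)) with X by (field; lra). unfold X.
  replace (_ * _) with (Cmod (a (j + k)%nat) * (INR (binom (j + k) k) * s ^ j * (r - s) ^ k))
    by ring.
  now apply Rmult_le_compat_l.
- apply (ex_series_scal (V := R_NormedModule)).
  now apply (ex_series_incr_n (V := R_NormedModule) (fun n => Cmod (a n) * r ^ n)).
Qed.

Lemma is_series_plus_C (u v : nat -> C) (l m : C) : is_series u l -> is_series v m ->
  is_series (fun n => (u n + v n)%C) (l + m)%C.
Proof. exact (is_series_plus (V := C_NormedModule) u v l m). Qed.

Lemma is_series_minus_C (u v : nat -> C) (l m : C) : is_series u l -> is_series v m ->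
  is_series (fun n => (u n - v n)%C) (l - m)%C.
Proof. exact (is_series_minus (V := C_NormedModule) u v l m). Qed.

Lemma is_series_sum_n (t : nat -> nat -> C) (l : nat -> C) (K : nat) :
  (forall k, is_series (fun n => t n k) (l k)) ->
  is_series (fun n => sum_n (t n) K) (sum_n l K).
Proof.
intros H. induction K.
- rewrite sum_O. apply is_series_ext with (2 := H 0%nat). intros n. now rewrite sum_O.
- rewrite sum_n_S_C.
  apply is_series_ext with (2 := is_series_plus_C _ _ _ _ IHK (H (S K))).
  intros n. now rewrite sum_n_S_C.
Qed.

Lemma is_series_prepend0 (u : nat -> C) (l : C) (k : nat) :
  (forall n, (n < k)%nat -> u n = RtoC 0) ->
  is_series (fun j => u (j + k)%nat) l -> is_series u l.
Proof.
revert u. induction k; intros u H0 H.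
- revert H. apply is_series_ext. intros n. now rewrite Nat.add_0_r.
- apply is_series_decr_1. rewrite (H0 0%nat) by lia.
  match goal with |- is_series _ ?y => replace y with l end.
  + apply IHk; [intros n Hn; apply H0; lia|].
    revert H. apply is_series_ext. intros n. f_equal. lia.
  + change (l = (l + - RtoC 0)%C). ring.
Qed.

(** The exchange of summations in the double series of [a n * (z + h) ^ n]. For fixed [K], the sum
    minus its columns [k <= K] is a series whose [n]-th term is [a n] times the difference between
    [(z + h) ^ n] and its binomial sum truncated at [K]. That term is 0 for [n <= K], where the
    binomial sum is complete, and is always at most [2 * |a n| * (|z| + |h|) ^ n]; so the error is a
    tail of a convergent series. *)
Lemma recentre (a : nat -> C) (r : R) (z h F : C) :
  abs_pseries a r -> Cmod z < r -> Cmod z + Cmod h <= r ->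
  is_series (fun n => (a n * (z + h) ^ n)%C) F ->
  is_series (fun k => (recentred a z k * h ^ k)%C) F.
Proof.
intros Ha Hz Hzh HF.
set (t := fun n k => (a n * (RtoC (INR (binom n k)) * z ^ (n - k) * h ^ k))%C).
assert (Ht : forall k, is_series (fun n => t n k) (recentred a z k * h ^ k)%C).
{ intros k. apply is_series_prepend0 with k.
  - intros n Hn. unfold t. rewrite binom_gt by exact Hn. simpl INR. ring.
  - assert (Hk : is_series (fun j => taylor_coef a k j * z ^ j)%C (recentred a z k)).
    { apply CSeries_correct, abs_pseries_ex with (Cmod z); [lra|].
      apply taylor_coef_abs with r; [|exact Ha]. split; [apply Cmod_ge_0|exact Hz]. }
    apply (is_series_scal_C (h ^ k)%C) in Hk. rewrite Cmult_comm.
    revert Hk. apply is_series_ext. intros j. unfold t, taylor_coef.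
    replace (j + k - k)%nat with j by lia. cring. }
set (b := fun n => 2 * (Cmod (a n) * (Cmod z + Cmod h) ^ n)).
pose proof (Cmod_ge_0 z) as Hz0. pose proof (Cmod_ge_0 h) as Hh0.
assert (Hb : ex_series b).
{ apply (ex_series_scal (V := R_NormedModule)).
  apply abs_pseries_le with (2 := Ha). lra. }
apply is_series_norm. intros eps.
destruct (Series_tail_lt b eps Hb (cond_pos eps)) as [N HN].
exists N. intros K HK. specialize (HN K HK).
pose proof (is_series_minus_C _ _ _ _ HF (is_series_sum_n t _ K Ht)) as HD.
set (x := fun n => _) in HD.
change (Cmod (sum_n (fun k => recentred a z k * h ^ k)%C K - F) < eps).
eapply Rle_lt_trans; [|exact HN].
replace (sum_n (fun k => recentred a z k * h ^ k)%C K - F)%C with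
  (- (F - sum_n (fun k => recentred a z k * h ^ k)%C K))%C by cring.
rewrite Cmod_opp.
set (D := (F - sum_n (fun k => recentred a z k * h ^ k)%C K)%C) in *.
assert (Hx0 : forall n, (n <= K)%nat -> x n = RtoC 0).
{ intros n Hn. unfold x, t. rewrite sum_n_scal_C, <- binomial_C.
  replace (sum_n (fun k => RtoC (INR (binom n k)) * z ^ (n - k) * h ^ k)%C K)
    with (sum_n (fun k => RtoC (INR (binom n k)) * z ^ (n - k) * h ^ k)%C n); [cring|].
  destruct (Nat.le_exists_sub n K Hn) as [d [Hd _]]. rewrite Hd. clear.
  induction d; [easy|]. change (S d + n)%nat with (S (d + n)). rewrite sum_n_S_C, <- IHd, binom_gt by lia.
  simpl INR. cring. }
replace D with (D - sum_n x K)%C.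
- apply Cmod_tail_le with (1 := HD); [|exact Hb].
  intros n. unfold x, t, b. rewrite sum_n_scal_C.
  unfold Cminus. eapply Rle_trans; [apply Cmod_triangle|].
  rewrite Cmod_opp, !Cmod_mult, Cmod_pow.
  pose proof (Cmod_ge_0 (a n)).
  assert (Cmod (z + h) ^ n <= (Cmod z + Cmod h) ^ n).
  { apply pow_incr. split; [apply Cmod_ge_0|apply Cmod_triangle]. }
  pose proof (binomial_partial_le z h n K). nra.
- assert (Hs : forall m, (m <= K)%nat -> sum_n x m = RtoC 0).
  { induction m; intros Hm; [rewrite sum_O; now apply Hx0|].
    rewrite sum_n_S_C, IHm, Hx0 by lia. cring. }
  rewrite Hs by lia. ring.
Qed.

(** * Analytic functions on the disc are globally power series *)

Lemma pseries_abs_real (a : nat -> C) (l : C) (r s : R) : 0 <= s < r ->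
  is_series (fun n => (a n * RtoC r ^ n)%C) l -> abs_pseries a s.
Proof.
intros Hs H. apply (pseries_abs a r l); [now apply is_pseries_Cpow|].
rewrite Cmod_R, Rabs_pos_eq; lra.
Qed.

(** Phrased for functions on all of [C], so that [z + h] carries no proof of membership in the disc;
    the coefficients are those of the variable [h]. *)
Definition locally_analytic (f : C -> C) : Prop :=
  forall z, Cmod z < 1 -> exists b r, 0 < r /\
    forall h, Cmod h < r -> is_series (fun n => (b n * h ^ n)%C) (f (z + h)%C).

Lemma Cmod_lt_coords (z w : C) (d : R) :
  Rabs (Re z - Re w) < d -> Rabs (Im z - Im w) < d -> Cmod (z - w) < 2 * d.
Proof.
intros H1 H2. replace (z - w)%C with (RtoC (Re z - Re w) + Ci * RtoC (Im z - Im w))%C.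
- eapply Rle_lt_trans; [apply Cmod_triangle|].
  rewrite Cmod_mult, Cmod_Ci, !Cmod_R. lra.
- destruct z, w. apply injective_projections; simpl; ring.
Qed.

(** A Lebesgue number argument. Compactness is applied to the square of half-side [R], whose corners
    may lie outside the unit disc; there the second clause of [P] makes the neighbourhood so small
    that it misses the points of modulus at most [R]. *)
Lemma uniform_radius (f : C -> C) (R : R) : R < 1 -> locally_analytic f ->
  exists d, 0 < d /\ forall z, Cmod z <= R -> exists b,
    forall h, Cmod h < d -> is_series (fun n => (b n * h ^ n)%C) (f (z + h)%C).
Proof.
intros HR Hf.
set (P := fun (z : C) (d : posreal) =>
  (Cmod z < 1 -> exists b, forall h, Cmod h < 4 * d ->
     is_series (fun n => (b n * h ^ n)%C) (f (z + h)%C)) /\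
  (1 <= Cmod z -> 2 * d <= Cmod z - R)).
assert (HP : forall z, exists d, P z d).
{ intros z. destruct (Rlt_le_dec (Cmod z) 1) as [Hz|Hz].
  - destruct (Hf z Hz) as [b [r [Hr Hb]]].
    assert (Hr4 : 0 < r / 4) by lra. exists (mkposreal _ Hr4). split; simpl pos.
    + intros _. exists b. intros h Hh. apply Hb. lra.
    + intros H. lra.
  - assert (Hd : 0 < (Cmod z - R) / 2) by lra. exists (mkposreal _ Hd).
    split; simpl pos; intros; lra. }
set (delta := fun u v => proj1_sig (constructive_indefinite_description _ (HP (u, v)))).
assert (Hdelta : forall u v, P (u, v) (delta u v)).
{ intros u v. unfold delta.
  exact (proj2_sig (constructive_indefinite_description _ (HP (u, v)))). }
destruct (compactness_value_2d (- R) R (- R) R delta) as [d Hd].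
exists d. split; [apply cond_pos|]. intros z Hz.
pose proof (Rmax_Cmod z) as Hmax.
assert (Hx : - R <= Re z <= R).
{ apply Rabs_le_between. eapply Rle_trans; [|exact Hz].
  eapply Rle_trans; [|exact Hmax]. apply Rmax_l. }
assert (Hy : - R <= Im z <= R).
{ apply Rabs_le_between. eapply Rle_trans; [|exact Hz].
  eapply Rle_trans; [|exact Hmax]. apply Rmax_r. }
destruct (NNPP _ (Hd (Re z) (Im z) Hx Hy)) as [u [v [_ [_ [Hu [Hv Hdd]]]]]].
destruct (Hdelta u v) as [H1 H2]. set (D := delta u v) in *.
pose proof (cond_pos D) as HD.
assert (Hw : Cmod (z - (u, v)) < 2 * D) by now apply Cmod_lt_coords.
set (w := (u, v) : C) in *.
assert (Hw1 : Cmod w < 1).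
{ apply Rnot_le_lt. intros H. specialize (H2 H).
  assert (Cmod w <= Cmod z + Cmod (z - w)).
  { replace w with (z + - (z - w))%C at 1 by ring.
    eapply Rle_trans; [apply Cmod_triangle|]. rewrite Cmod_opp. lra. }
  lra. }
destruct (H1 Hw1) as [b Hb].
(* The expansion at [w] is valid up to [4 * D], hence absolutely convergent at [3 * D]; this leaves
   room for [|z - w| < 2 * D] together with [|h| < d <= D]. *)
assert (Hab : abs_pseries b (3 * D)).
{ apply pseries_abs_real with (f (w + RtoC (7 / 2 * D))%C) (7 / 2 * D); [lra|].
  apply Hb. rewrite Cmod_R, Rabs_pos_eq; lra. }
exists (recentred b (z - w)). intros h Hh.
apply recentre with (3 * D); [exact Hab|lra|lra|].
replace (z + h)%C with (w + (z - w + h))%C by ring.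
apply Hb. eapply Rle_lt_trans; [apply Cmod_triangle|]. lra.
Qed.

Lemma geometric_sum_le (q : R) (m : nat) : 0 <= q < 1 ->
  sum_n (fun k => q ^ k) m <= / (1 - q).
Proof.
intros Hq. rewrite <- Series_geom by (rewrite Rabs_pos_eq; lra).
apply Series_ge_partial; [intros; apply pow_le; lra|].
apply ex_series_geom. rewrite Rabs_pos_eq; lra.
Qed.

(* Cauchy's estimate is applied twice: to the expansions at the points of the circle
   of radius [rho = r - d / 4], and then to their coefficients as functions of
   the centre. Summing over [k] the resulting bounds on
   [binom m k * a m * rho ^ (m - k) * t ^ k] bounds [a m * (rho + t) ^ m]. *)
Lemma extend_radius (f : C -> C) (a : nat -> C) (M R d r : R) :
  (forall z, Cmod z < 1 -> Cmod (f z) <= M) -> R + d <= 1 ->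
  (forall z, Cmod z <= R -> exists b, forall h, Cmod h < d ->
     is_series (fun n => (b n * h ^ n)%C) (f (z + h)%C)) ->
  0 < d -> d <= r -> r <= R ->
  (forall z, Cmod z < r -> is_series (fun n => (a n * z ^ n)%C) (f z)) ->
  forall z, Cmod z < r + d / 4 -> is_series (fun n => (a n * z ^ n)%C) (f z).
Proof.
intros HM HRd Hloc Hd Hdr HrR Ha.
set (rho := r - d / 4).
assert (Habs : abs_pseries a (r - d / 16)).
{ apply pseries_abs_real with (f (RtoC (r - d / 32))) (r - d / 32); [lra|].
  apply Ha. rewrite Cmod_R, Rabs_pos_eq; lra. }
assert (Hrec : forall z h, Cmod z = rho -> Cmod h <= d / 8 ->
  is_series (fun k => (recentred a z k * h ^ k)%C) (f (z + h)%C)).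
{ intros z h Hz Hh. apply recentre with (r - d / 16); [exact Habs| | |];
    try (rewrite Hz; unfold rho; lra).
  apply Ha. eapply Rle_lt_trans; [apply Cmod_triangle|]. rewrite Hz. unfold rho. lra. }
(* Near [z] both expansions represent [f], so they have the same coefficients; thus the recentred
   series, so far known to represent [f] only for [|h| <= d / 8], does so for all [|h| < d]. *)
assert (Hkey : forall z, Cmod z = rho -> exists b,
  (forall h, Cmod h < d -> is_series (fun n => (b n * h ^ n)%C) (f (z + h)%C)) /\
  forall k, b k = recentred a z k).
{ intros z Hz. destruct (Hloc z) as [b Hb]; [rewrite Hz; unfold rho; lra|].
  exists b. split; [exact Hb|].
  apply pseries_coef_ext with (d / 16); [lra| | |].
  - apply pseries_abs_real with (f (z + RtoC (d / 8))%C) (d / 8); [lra|].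
    apply Hb. rewrite Cmod_R, Rabs_pos_eq; lra.
  - apply pseries_abs_real with (f (z + RtoC (d / 8))%C) (d / 8); [lra|].
    apply Hrec; [exact Hz|]. rewrite Cmod_R, Rabs_pos_eq; lra.
  - intros eps Heps. exists (RtoC (Rmin (eps / 2) (d / 8))).
    pose proof (Rmin_l (eps / 2) (d / 8)). pose proof (Rmin_r (eps / 2) (d / 8)).
    assert (0 < Rmin (eps / 2) (d / 8)) by (apply Rmin_pos; lra).
    set (x := Rmin _ _) in *. assert (Hx : Cmod (RtoC x) = x).
      rewrite Cmod_R, Rabs_pos_eq; lra.
    exists (f (z + RtoC x)%C). rewrite Hx. split; [lra|]. split.
    + apply Hb. rewrite Hx. lra.
    + apply Hrec; [exact Hz|lra]. }
assert (Hrho : 0 <= rho) by (unfold rho; lra).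
assert (HM0 : 0 <= M).
{ apply Rle_trans with (Cmod (f 0)); [apply Cmod_ge_0|]. apply HM. rewrite Cmod_0. lra. }
(* The circle of radius [3 / 4 * d] about [z] reaches modulus at most [r + d / 2], still below 1, so
   [M] bounds [f] on it. *)
assert (Hest1 : forall z k, Cmod z = rho -> Cmod (recentred a z k) * (3 / 4 * d) ^ k <= M).
{ intros z k Hz. destruct (Hkey z Hz) as [b [Hb Hbk]]. rewrite <- Hbk.
  apply cauchy_estimate; [lra| |].
  - apply pseries_abs_real with (f (z + RtoC (7 / 8 * d))%C) (7 / 8 * d); [lra|].
    apply Hb. rewrite Cmod_R, Rabs_pos_eq; lra.
  - intros h B Hh HB.
    replace B with (f (z + h)%C).
    + apply HM. eapply Rle_lt_trans; [apply Cmod_triangle|].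
      rewrite Hz, Hh. unfold rho. lra.
    + apply (is_series_norm_unique (V := C_NormedModule)) with (2 := HB). apply Hb. lra. }
assert (Hest2 : forall k j,
  INR (binom (j + k) k) * Cmod (a (j + k)%nat) * rho ^ j * (3 / 4 * d) ^ k <= M).
{ intros k j. assert (Hp : 0 < (3 / 4 * d) ^ k) by (apply pow_lt; lra).
  apply Rmult_le_reg_r with (/ (3 / 4 * d) ^ k); [now apply Rinv_0_lt_compat|].
  rewrite Rmult_assoc, Rinv_r, Rmult_1_r by lra.
  replace (INR (binom (j + k) k) * Cmod (a (j + k)%nat)) with (Cmod (taylor_coef a k j)).
  - apply cauchy_estimate; [exact Hrho| |].
    + apply taylor_coef_abs with (2 := Habs). unfold rho. unfold rho in Hrho. lra.
    + intros z B Hz HB. apply Rmult_le_reg_r with ((3 / 4 * d) ^ k); [exact Hp|].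
      rewrite Rmult_assoc, Rinv_l, Rmult_1_r by lra.
      apply is_series_CSeries in HB. rewrite <- HB. now apply Hest1.
  - unfold taylor_coef. rewrite Cmod_mult, Cmod_R, Rabs_pos_eq; [easy|apply pos_INR]. }
assert (Hbig : abs_pseries a (r + d / 4)).
(* Here [rho + 5 / 8 * d = r + 3 / 8 * d] lies beyond the target [r + d / 4]. The ratio of [5 / 8]
   to [3 / 4] is [5 / 6], and the geometric sum of that ratio is at most 6. *)
{ apply abs_pseries_of_bounded with (rho + 5 / 8 * d) (M * 6); [unfold rho; lra|].
  intros m. rewrite binomial_R.
  rewrite <- (sum_n_mult_l (K := R_Ring)).
  apply Rle_trans with (sum_n (fun k => M * (5 / 6) ^ k) m).
  - apply sum_n_le. intros k Hk.
    pose proof (Hest2 k (m - k)%nat) as H. replace (m - k + k)%nat with m in H by lia.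
    replace (5 / 8 * d) with (5 / 6 * (3 / 4 * d)) by field.
    rewrite Rpow_mult_distr.
    assert (Hq : 0 <= (5 / 6) ^ k) by (apply pow_le; lra).
    apply (Rmult_le_compat_r _ _ _ Hq) in H. unfold mult; simpl.
    eapply Rle_trans; [|exact H]. right. ring.
  - rewrite (sum_n_mult_l (K := R_Ring)). apply Rmult_le_compat_l; [exact HM0|].
    eapply Rle_trans; [apply geometric_sum_le; lra|]. lra. }
intros z Hz. destruct (Rlt_le_dec (Cmod z) r) as [Hzr|Hzr]; [now apply Ha|].
assert (Hz0 : 0 < Cmod z) by lra.
(* [w] is the point of modulus [rho] on the ray through [z], so that [|w| + |h| = |z|]. The
   recentred series at [w] sums at [h] both to the enlarged series and to [f z]. *)
set (w := (RtoC (rho / Cmod z) * z)%C). set (h := (RtoC (1 - rho / Cmod z) * z)%C).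
assert (Ewh : (w + h)%C = z).
{ unfold w, h. rewrite RtoC_minus. ring. }
assert (Hrz : 0 <= rho / Cmod z <= 1).
{ split; [apply Rdiv_le_0_compat; lra|]. apply Rmult_le_reg_r with (Cmod z); [lra|].
  unfold Rdiv. rewrite Rmult_assoc, Rinv_l by lra. unfold rho. lra. }
assert (Hw : Cmod w = rho).
{ unfold w. rewrite Cmod_mult, Cmod_R, Rabs_pos_eq by lra. field. lra. }
assert (Hh : Cmod h = Cmod z - rho).
{ unfold h. rewrite Cmod_mult, Cmod_R, Rabs_pos_eq by lra. field. lra. }
destruct (abs_pseries_ex a (r + d / 4) z ltac:(lra) Hbig) as [G HG].
replace (f z) with G; [exact HG|].
destruct (Hkey w Hw) as [b [Hb Hbk]].
apply (is_series_norm_unique (V := C_NormedModule) (fun n => (recentred a w n * h ^ n)%C)).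
- apply recentre with (r + d / 4); [exact Hbig| | |].
  + rewrite Hw. unfold rho. lra.
  + rewrite Hw, Hh. lra.
  + now rewrite Ewh.
- rewrite <- Ewh.
  apply is_series_ext with (fun n => (b n * h ^ n)%C).
    intros n. now rewrite Hbk.
  apply Hb. rewrite Hh. unfold rho. lra.
Qed.

(** The coefficients at 0 are fixed before [z] is given; only the number and size of the
    enlargements depend on [z], since the uniform local radius is obtained on the closed disc of
    radius [R < 1]. *)
Lemma global_pseries_C (f : C -> C) (M : R) : locally_analytic f ->
  (forall z, Cmod z < 1 -> Cmod (f z) <= M) ->
  exists a, forall z, Cmod z < 1 -> is_series (fun n => (a n * z ^ n)%C) (f z).
Proof.
intros Hf HM.
destruct (Hf 0) as [a [r [Hr Ha]]]; [rewrite Cmod_0; lra|].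
exists a. intros z Hz.
set (r0 := Rmin r (1 / 2)).
assert (Hr0 : 0 < r0) by (apply Rmin_pos; lra).
assert (Hr0r : r0 <= r) by apply Rmin_l. assert (Hr01 : r0 <= 1 / 2) by apply Rmin_r.
set (R := Rmax (Cmod z) r0).
assert (HR1 : R < 1) by (apply Rmax_lub_lt; lra).
assert (HzR : Cmod z <= R) by apply Rmax_l.
assert (Hr0R : r0 <= R) by apply Rmax_r.
destruct (uniform_radius f R HR1 Hf) as [d0 [Hd0 Hloc]].
set (d := Rmin d0 (Rmin r0 (1 - R))).
assert (Hd : 0 < d) by (repeat apply Rmin_pos; lra).
assert (Hdd0 : d <= d0) by apply Rmin_l.
assert (Hdr0 : d <= r0) by (eapply Rle_trans; [apply Rmin_r|apply Rmin_l]).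
assert (HdR : d <= 1 - R) by (eapply Rle_trans; [apply Rmin_r|apply Rmin_r]).
(* Each step gains [d / 4], unless the radius has already passed [R]; then [extend_radius], which
   asks for [r <= R], stops applying, but [z] is already covered. *)
assert (Hn : forall n : nat, (exists r', R < r' /\
    forall w, Cmod w < r' -> is_series (fun n => (a n * w ^ n)%C) (f w)) \/
  forall w, Cmod w < r0 + INR n * (d / 4) -> is_series (fun n => (a n * w ^ n)%C) (f w)).
{ induction n.
  - right. intros w Hw. simpl INR in Hw. replace (f w) with (f (0 + w)%C) by (f_equal; ring). apply Ha. lra.
  - destruct IHn as [IH|IH]; [now left|].
    destruct (Rlt_le_dec R (r0 + INR n * (d / 4))) as [HRn|HRn].
      left. now exists (r0 + INR n * (d / 4)).
    right. rewrite S_INR.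
    replace (r0 + (INR n + 1) * (d / 4)) with (r0 + INR n * (d / 4) + d / 4) by ring.
    apply extend_radius with M R; try assumption; try lra.
    + intros w Hw. destruct (Hloc w Hw) as [b Hb]. exists b. intros h Hh. apply Hb. lra.
    + pose proof (pos_INR n). nra. }
destruct (INR_unbounded (4 / d)) as [n Hnd].
assert (1 < INR n * (d / 4)).
{ replace 1 with (4 / d * (d / 4)) by (field; lra). apply Rmult_lt_compat_r; lra. }
destruct (Hn n) as [[r' [Hr' H']]|H'].
- apply H'. lra.
- apply H'. lra.
Qed.

Definition disc_extend (phi : unit_disc -> C) (z : C) : C :=
  match Rlt_dec (Cmod z) 1 with
  | left H => phi (Unit_disc z H)
  | right _ => 0
  end.

Lemma disc_extend_eq (phi : unit_disc -> C) (z : unit_disc) : disc_extend phi z = phi z.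
Proof.
unfold disc_extend. destruct (Rlt_dec (Cmod z) 1) as [H|H]; [|now destruct (H (disc_lt1 z))].
f_equal. destruct z as [z Hz]. simpl in H |- *. f_equal. apply proof_irrelevance.
Qed.

Lemma disc_extend_analytic (phi : unit_disc -> C) :
  analytic_on_disc phi -> locally_analytic (disc_extend phi).
Proof.
intros H z Hz. destruct (H (Unit_disc z Hz)) as [b [r [Hr Hb]]].
(* The extension has the default value 0 off the disc, so the expansion is claimed only where
   [z + h] stays inside. *)
exists b, (Rmin r (1 - Cmod z)). split; [apply Rmin_pos; lra|].
intros h Hh.
assert (H1 : Cmod h < r) by (eapply Rlt_le_trans; [exact Hh|apply Rmin_l]).
assert (H2 : Cmod h < 1 - Cmod z) by (eapply Rlt_le_trans; [exact Hh|apply Rmin_r]).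
assert (Hzh : Cmod (z + h) < 1) by (eapply Rle_lt_trans; [apply Cmod_triangle|lra]).
specialize (Hb (Unit_disc _ Hzh)). simpl disc_val in Hb.
assert (E : (z + h - z)%C = h) by ring. unfold open_disc in Hb. rewrite E in Hb.
rewrite <- (disc_extend_eq phi (Unit_disc _ Hzh)) in Hb. apply is_pseries_Cpow.
now apply Hb.
Qed.

Lemma global_pseries (phi : unit_disc -> C) :
  analytic_on_disc phi -> bounded_on_disc phi ->
  exists a, forall z : unit_disc, is_pseries a (z : C) (phi z).
Proof.
intros Ha [M HM].
destruct (global_pseries_C (disc_extend phi) M) as [a H].
- now apply disc_extend_analytic.
- intros z Hz. specialize (HM (Unit_disc z Hz)). now rewrite <- disc_extend_eq in HM.
- exists a. intros z. apply is_pseries_Cpow. rewrite <- (disc_extend_eq phi z). apply H, disc_lt1.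
Qed.

(** * Multiplication operators *)

Definition cauchy_prod (u v : nat -> C) (n : nat) : C :=
  sum_n (fun k => u k * v (n - k)%nat)%C n.

Lemma abs_Re_Im (u : nat -> C) : ex_series (fun n => Cmod (u n)) ->
  ex_series (fun n => Rabs (Re (u n))) /\ ex_series (fun n => Rabs (Im (u n))).
Proof.
intros H. split; apply ex_series_le_R with (2 := H); intros n; split;
  try apply Rabs_pos; (eapply Rle_trans; [|apply Rmax_Cmod]); [apply Rmax_l|apply Rmax_r].
Qed.

Lemma is_series_cauchy_prod (u v : nat -> C) (U V : C) :
  is_series u U -> is_series v V ->
  ex_series (fun n => Cmod (u n)) -> ex_series (fun n => Cmod (v n)) ->
  is_series (cauchy_prod u v) (U * V)%C.
Proof.
intros HU HV Hu Hv.
apply is_series_C in HU as [HU1 HU2]. apply is_series_C in HV as [HV1 HV2].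
destruct (abs_Re_Im u Hu) as [Hu1 Hu2]. destruct (abs_Re_Im v Hv) as [Hv1 Hv2].
pose proof (is_series_mult _ _ _ _ HU1 HV1 Hu1 Hv1) as H11.
pose proof (is_series_mult _ _ _ _ HU2 HV2 Hu2 Hv2) as H22.
pose proof (is_series_mult _ _ _ _ HU1 HV2 Hu1 Hv2) as H12.
pose proof (is_series_mult _ _ _ _ HU2 HV1 Hu2 Hv1) as H21.
apply is_series_C; split.
- generalize (is_series_minus _ _ _ _ H11 H22). apply is_series_ext. intros n.
  unfold cauchy_prod. rewrite sum_n_Re_Im. simpl Re. rewrite sum_n_Reals.
  match goal with |- plus ?x (opp ?y) = ?z => change (x - y = z) end.
  rewrite <- minus_sum. apply sum_eq. intros k _. unfold Re, Im, Cmult; cbn [fst snd]. ring.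
- generalize (is_series_plus _ _ _ _ H12 H21). apply is_series_ext. intros n.
  unfold cauchy_prod. rewrite sum_n_Re_Im. simpl Im. rewrite sum_n_Reals.
  match goal with |- plus ?x ?y = ?z => change (x + y = z) end.
  rewrite <- plus_sum. apply sum_eq. intros k _. unfold Re, Im, Cmult; cbn [fst snd]. ring.
Qed.

Lemma is_series_pow_cauchy_prod (a b : nat -> C) (r : R) (z A B : C) :
  abs_pseries a r -> abs_pseries b r -> Cmod z <= r ->
  is_series (fun n => a n * z ^ n)%C A -> is_series (fun n => b n * z ^ n)%C B ->
  is_series (fun n => cauchy_prod a b n * z ^ n)%C (A * B)%C.
Proof.
intros Ha Hb Hz HA HB.
assert (Habs : forall c, abs_pseries c r -> ex_series (fun n => Cmod (c n * z ^ n))).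
{ intros c Hc. apply ex_series_ext with (fun n => Cmod (c n) * Cmod z ^ n).
    intros n. now rewrite Cmod_mult, Cmod_pow.
  apply abs_pseries_le with (2 := Hc). split; [apply Cmod_ge_0|exact Hz]. }
generalize (is_series_cauchy_prod _ _ _ _ HA HB (Habs a Ha) (Habs b Hb)).
apply is_series_ext. intros n. unfold cauchy_prod. rewrite Cmult_comm, <- sum_n_scal_C.
apply sum_n_ext_loc. intros k Hk.
replace (z ^ n)%C with (z ^ k * z ^ (n - k))%C; [cring|].
rewrite <- Cpow_add_r. f_equal. lia.
Qed.

Lemma bernoulli_le (t : R) (n : nat) : 0 <= t <= 1 -> 1 - INR n * t <= (1 - t) ^ n.
Proof.
intros Ht. induction n; [simpl; lra|].
rewrite S_INR. simpl pow. pose proof (pos_INR n).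
assert (0 <= INR n * t * t) by (repeat apply Rmult_le_pos; lra). nra.
Qed.

(** The limit [r -> 1] in a finite sum, made quantitative: with [r = 1 - t] every weight is at least
    [(1 - t) ^ (2 * K)], which Bernoulli's inequality bounds below. *)
Lemma sum_sqr_le_of_radii (c : nat -> C) (Y : R) (K : nat) :
  (forall r, 0 <= r < 1 -> sum_n (fun n => (Cmod (c n) * r ^ n) ^ 2) K <= Y) ->
  sum_n (fun n => Cmod (c n) ^ 2) K <= Y.
Proof.
intros H. apply Rnot_lt_le. intros Hlt.
set (X := sum_n (fun n => Cmod (c n) ^ 2) K) in *.
assert (HY : 0 <= Y).
{ eapply Rle_trans; [|apply (H 0); lra]. apply sum_n_nonneg.
  intros; apply pow2_ge_0. }
set (N := INR (2 * K)). assert (HN : 0 <= N) by apply pos_INR.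
(* Chosen so that [(1 - N * t) * X = X - N / (N + 1) * (X - Y)], which exceeds [Y]. *)
set (t := (X - Y) / (X * (N + 1))).
assert (HXN : 0 < X * (N + 1)) by nra.
assert (Ht0 : 0 < t) by (apply Rdiv_lt_0_compat; lra).
assert (Ht1 : t * (X * (N + 1)) = X - Y) by (unfold t; field; lra).
assert (Ht2 : t <= 1) by nra.
specialize (H (1 - t) ltac:(lra)).
pose proof (bernoulli_le t (2 * K) ltac:(lra)) as Hb. fold N in Hb.
assert (Hle : (1 - t) ^ (2 * K) * X <= Y).
{ eapply Rle_trans; [|exact H]. unfold X.
  replace ((1 - t) ^ (2 * K) * _)
    with (sum_n (fun n => (1 - t) ^ (2 * K) * Cmod (c n) ^ 2) K)
    by exact (sum_n_mult_l (K := R_Ring) _ _ K).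
  apply sum_n_le. intros n Hn.
  rewrite Rpow_mult_distr, <- pow_mult, Rmult_comm.
  apply Rmult_le_compat_l; [apply pow2_ge_0|].
  replace (2 * K)%nat with (n * 2 + (2 * K - n * 2))%nat by lia.
  rewrite pow_add. rewrite <- (Rmult_1_r ((1 - t) ^ (n * 2))) at 2.
  apply Rmult_le_compat_l; [apply pow_le; lra|].
  eapply Rle_trans; [apply (pow_incr _ 1); lra|]. rewrite pow1. lra. }
nra.
Qed.

Lemma disc_pseries_abs (a : nat -> C) (f : unit_disc -> C) (r : R) :
  (forall z : unit_disc, is_pseries a (z : C) (f z)) -> 0 <= r < 1 -> abs_pseries a r.
Proof.
intros Ha Hr.
assert (Hs : Cmod (RtoC ((1 + r) / 2)) < 1) by (rewrite Cmod_R, Rabs_pos_eq; lra).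
apply pseries_abs_real with (f (Unit_disc _ Hs)) ((1 + r) / 2); [lra|].
apply is_pseries_Cpow. exact (Ha (Unit_disc _ Hs)).
Qed.

Lemma multiplier_pseries (psi : unit_disc -> C) (a : nat -> C) (f : H2) :
  (forall z : unit_disc, is_pseries a (z : C) (psi z)) ->
  forall z : unit_disc, is_pseries (cauchy_prod a (coef f)) (z : C) (psi z * f z)%C.
Proof.
intros Ha z. pose proof (disc_lt1 z). pose proof (Cmod_ge_0 z).
apply is_pseries_Cpow. apply is_series_pow_cauchy_prod with (Cmod z).
- apply disc_pseries_abs with psi; [exact Ha|lra].
- apply disc_pseries_abs with f; [apply coef_pseries|lra].
- lra.
- apply is_pseries_Cpow, Ha.
- apply is_pseries_Cpow, coef_pseries.
Qed.

Lemma sum_coef_sqr_le (f : H2) (K : nat) :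
  sum_n (fun n => Cmod (coef f n) ^ 2) K <= H2_norm f ^ 2.
Proof.
unfold H2_norm. rewrite <- l2norm_sqr by apply coef_l2.
apply Series_ge_partial; [intros; apply pow2_ge_0|apply coef_l2].
Qed.

(** On each circle of radius [r < 1] the product is pointwise at most [M] times [f], which compares
    the coefficients weighted by [r ^ n]; then [r] tends to 1. *)
Lemma multiplier_bound (psi : unit_disc -> C) (a : nat -> C) (M : R) (f : H2) :
  (forall z : unit_disc, is_pseries a (z : C) (psi z)) ->
  0 <= M -> (forall z, Cmod (psi z) <= M) ->
  forall K, sum_n (fun n => Cmod (cauchy_prod a (coef f) n) ^ 2) K <= M ^ 2 * H2_norm f ^ 2.
Proof.
intros Ha HM0 HM K. apply sum_sqr_le_of_radii. intros r Hr.
pose proof (multiplier_pseries psi a f Ha) as Hprod.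
apply (parseval_circle_le (coef f)); [lra|exact HM0| | | |].
- apply disc_pseries_abs with f; [apply coef_pseries|lra].
- now apply disc_pseries_abs with (1 := Hprod).
- intros z A B Hz HA HB.
  assert (Hz1 : Cmod z < 1) by lra. set (w := Unit_disc z Hz1).
  replace B with (psi w * f w)%C.
  + replace A with (f w).
    * rewrite Cmod_mult. apply Rmult_le_compat_r; [apply Cmod_ge_0|apply HM].
    * apply (is_series_norm_unique (V := C_NormedModule)) with (2 := HA).
      apply is_pseries_Cpow. exact (coef_pseries f w).
  + apply (is_series_norm_unique (V := C_NormedModule)) with (2 := HB).
    apply is_pseries_Cpow. exact (Hprod w).
- intros m. eapply Rle_trans; [|apply (sum_coef_sqr_le f m)].
  apply sum_n_le. intros n _. apply pow_incr.
  pose proof (Cmod_ge_0 (coef f n)). pose proof (pow_le r n (proj1 Hr)).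
  split; [now apply Rmult_le_pos|].
  rewrite <- (Rmult_1_r (Cmod (coef f n))) at 2. apply Rmult_le_compat_l; [easy|].
  rewrite <- (pow1 n). apply pow_incr. lra.
Qed.

Lemma H2_norm_le_of_sums (f : H2) (B : R) : 0 <= B ->
  (forall K, sum_n (fun n => Cmod (coef f n) ^ 2) K <= B ^ 2) -> H2_norm f <= B.
Proof.
intros HB H. apply Series_partial_le in H; [|intros; apply pow2_ge_0].
unfold H2_norm, l2norm. rewrite <- (sqrt_pow2 B) by exact HB. now apply sqrt_le_1_alt.
Qed.

Lemma analytic_toeplitz_exists (psi : unit_disc -> C) :
  analytic_on_disc psi -> bounded_on_disc psi -> exists T, analytic_toeplitz psi T.
Proof.
intros Han Hb. destruct (global_pseries psi Han Hb) as [a Ha].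
destruct Hb as [M HM].
assert (HM0 : 0 <= M).
{ assert (H0 : Cmod 0 < 1) by (rewrite Cmod_0; lra).
  eapply Rle_trans; [apply Cmod_ge_0|apply (HM (Unit_disc _ H0))]. }
assert (HH2 : forall f : H2, in_H2 (fun z => psi z * f z)%C).
{ intros f. exists (cauchy_prod a (coef f)). split; [now apply multiplier_pseries|].
  apply (Series_partial_le _ (M ^ 2 * H2_norm f ^ 2)); [intros; apply pow2_ge_0|].
  now apply multiplier_bound with psi. }
exists (fun f => MkH2 _ (HH2 f)). split; [|easy].
split.
- intros f g. apply H2_eq. intros z. simpl. ring.
- intros k f. apply H2_eq. intros z. simpl. ring.
(* [is_linear] asks for a positive constant, and [M] may be 0. *)
- exists (M + 1). split; [lra|]. intros f.
  change (H2_norm (MkH2 _ (HH2 f)) <= (M + 1) * H2_norm f).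
  pose proof (l2norm_ge_0 (coef f)) as Hf. fold (H2_norm f) in Hf.
  apply Rle_trans with (M * H2_norm f); [|nra].
  apply H2_norm_le_of_sums; [now apply Rmult_le_pos|]. intros K.
  rewrite Rpow_mult_distr.
  rewrite (sum_n_ext _ (fun n => Cmod (cauchy_prod a (coef f) n) ^ 2)).
    now apply multiplier_bound with psi.
  intros n. rewrite (coef_unique _ (cauchy_prod a (coef f))); [easy|].
  now apply multiplier_pseries.
Qed.

(** * Adjoints on the Hardy space *)

Lemma H2_norm_ge_0 (f : H2) : 0 <= H2_norm f.
Proof. apply l2norm_ge_0. Qed.

Lemma H2_inner_of_series (f g : H2) (l : C) :
  is_series (fun n => (coef f n * Cconj (coef g n))%C) l -> H2_inner f g = l.
Proof. exact (is_series_CSeries _ l). Qed.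

Lemma H2_inner_self_eq0 (f : H2) : H2_inner f f = RtoC 0 -> f = zero.
Proof.
rewrite H2_inner_self. intros E. apply RtoC_inj in E. apply H2_norm_eq0.
destruct (Req_dec (H2_norm f) 0) as [|H]; [easy|]. now apply (pow_nonzero _ 2) in H.
Qed.

Lemma H2_inner_plus_l (f g h : H2) :
  H2_inner (plus f g) h = (H2_inner f h + H2_inner g h)%C.
Proof.
apply H2_inner_of_series.
generalize (is_series_plus_C _ _ _ _ (H2_inner_correct f h) (H2_inner_correct g h)).
apply is_series_ext. intros n. change (plus f g) with (H2_plus f g).
rewrite coef_plus. cring.
Qed.

Lemma H2_inner_scal_l (k : C) (f g : H2) :
  H2_inner (scal k f) g = (k * H2_inner f g)%C.
Proof.
apply H2_inner_of_series.
generalize (is_series_scal_C k _ _ (H2_inner_correct f g)).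
apply is_series_ext. intros n. change (scal k f) with (H2_scal k f).
rewrite coef_scal. cring.
Qed.

Lemma is_series_conj (u : nat -> C) (l : C) :
  is_series u l -> is_series (fun n => Cconj (u n)) (Cconj l).
Proof.
intros H. apply is_series_C in H as [H1 H2]. apply is_series_C. split.
- exact H1.
- exact (is_series_opp _ _ H2).
Qed.

Lemma Cconj_conj (z : C) : Cconj (Cconj z) = z.
Proof. destruct z. unfold Cconj; simpl. now rewrite Ropp_involutive. Qed.

Lemma H2_inner_conj (f g : H2) : H2_inner g f = Cconj (H2_inner f g).
Proof.
apply H2_inner_of_series.
generalize (is_series_conj _ _ (H2_inner_correct f g)). apply is_series_ext.
intros n. rewrite Cmult_conj, Cconj_conj. cring.
Qed.

Lemma H2_inner_plus_r (f g h : H2) :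
  H2_inner f (plus g h) = (H2_inner f g + H2_inner f h)%C.
Proof.
rewrite H2_inner_conj, H2_inner_plus_l, Cplus_conj.
now rewrite <- !H2_inner_conj.
Qed.

Lemma H2_inner_minus_l (f g h : H2) :
  H2_inner (minus f g) h = (H2_inner f h - H2_inner g h)%C.
Proof.
rewrite H2_inner_conj, H2_inner_minus_r, Cminus_conj. now rewrite <- !H2_inner_conj.
Qed.

Lemma H2_inner_scal_r (k : C) (f g : H2) :
  H2_inner f (scal k g) = (Cconj k * H2_inner f g)%C.
Proof.
rewrite H2_inner_conj, H2_inner_scal_l, Cmult_conj. now rewrite <- !H2_inner_conj.
Qed.

Lemma H2_norm_plus_sqr (f g : H2) :
  H2_norm (plus f g) ^ 2 = H2_norm f ^ 2 + H2_norm g ^ 2 + 2 * Re (H2_inner f g).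
Proof.
pose proof (H2_inner_self (plus f g)) as H.
rewrite H2_inner_plus_l, !H2_inner_plus_r, !H2_inner_self in H.
rewrite (H2_inner_conj f g) in H. apply (f_equal Re) in H. simpl in H. simpl. lra.
Qed.

(** Moving [f] along [g] by a real multiple of [- c] reduces the squared norm to a real quadratic in
    [s]. It yields both the Cauchy-Schwarz inequality and the orthogonality of a minimal error. *)
Lemma H2_norm_perturb (f g : H2) (s : R) :
  let c := H2_inner f g in
  H2_norm (plus f (scal (- (RtoC s * c))%C g)) ^ 2
  = H2_norm f ^ 2 + Cmod c ^ 2 * (s ^ 2 * H2_norm g ^ 2 - 2 * s).
Proof.
intros c. rewrite H2_norm_plus_sqr, H2_inner_scal_r, H2_norm_scal. fold c.
rewrite Cmod_opp, Cmod_mult, Cmod_R.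
replace ((Rabs s * Cmod c * H2_norm g) ^ 2)
  with (Rabs s ^ 2 * Cmod c ^ 2 * H2_norm g ^ 2) by ring.
rewrite <- (Rsqr_pow2 (Rabs s)), <- Rsqr_abs, Rsqr_pow2.
replace (Re (Cconj (- (s * c)) * c)) with (- (s * Cmod c ^ 2)).
  ring.
unfold Cmod. rewrite pow2_sqrt by nra. destruct c. simpl. ring.
Qed.

Lemma H2_cauchy_schwarz (f g : H2) : Cmod (H2_inner f g) <= H2_norm f * H2_norm g.
Proof.
set (c := H2_inner f g).
assert (H : forall s, 0 <= H2_norm f ^ 2 + Cmod c ^ 2 * (s ^ 2 * H2_norm g ^ 2 - 2 * s)).
{ intros s. unfold c. rewrite <- H2_norm_perturb. apply pow2_ge_0. }
pose proof (H2_norm_ge_0 f) as Hf. pose proof (H2_norm_ge_0 g) as Hg.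
pose proof (Cmod_ge_0 c) as Hc.
destruct (Req_dec (H2_norm g) 0) as [E|E].
- rewrite E in H |- *. rewrite Rmult_0_r.
  destruct (Req_dec (Cmod c) 0) as [Ec|Ec]; [lra|].
  assert (Hc2 : 0 < Cmod c ^ 2) by (apply pow_lt; lra).
  (* The quadratic has degenerated to an affine function of [s]; this value of [s] makes it equal to
     -1. *)
  specialize (H ((H2_norm f ^ 2 + 1) / (2 * Cmod c ^ 2))).
  exfalso. revert H. apply Rlt_not_le.
  match goal with |- ?x < 0 => replace x with (-1) by (field; lra) end. lra.
(* The minimizer of the quadratic in [s]. *)
- specialize (H (/ H2_norm g ^ 2)).
  assert (Hg2 : 0 < H2_norm g ^ 2) by (apply pow_lt; lra).
  apply Rsqr_incr_0; [|exact Hc|now apply Rmult_le_pos].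
  rewrite !Rsqr_pow2.
  apply (Rmult_le_compat_r (H2_norm g ^ 2)) in H; [|lra].
  match type of H with _ <= ?x =>
    replace x with (H2_norm f ^ 2 * H2_norm g ^ 2 - Cmod c ^ 2) in H by (field; lra) end.
  rewrite Rpow_mult_distr. lra.
Qed.

Lemma H2_orthogonal_of_minimal (f g : H2) :
  (forall k : C, H2_norm f ^ 2 <= H2_norm (plus f (scal k g)) ^ 2) -> H2_inner f g = RtoC 0.
Proof.
intros H. set (G := H2_norm g ^ 2). assert (HG : 0 <= G) by apply pow2_ge_0.
(* With [s = 1 / (G + 1)] the factor [s ^ 2 * G - 2 * s] is [- (G + 2) / (G + 1) ^ 2], negative even
   for [G = 0], so [g = 0] needs no separate case. *)
specialize (H (- (RtoC (/ (G + 1)) * H2_inner f g))%C).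
rewrite H2_norm_perturb in H. fold G in H.
apply Cmod_eq_0. set (c := Cmod (H2_inner f g)) in *.
assert (Hc : c ^ 2 * ((/ (G + 1)) ^ 2 * G - 2 * / (G + 1)) * (G + 1) ^ 2
  = - (c ^ 2 * (G + 2))) by (field; lra).
assert (0 <= c ^ 2) by apply pow2_ge_0.
assert (0 < (G + 1) ^ 2) by (apply pow_lt; lra). nra.
Qed.

(** * Monomials, truncations and construction of the adjoint *)

Lemma square_summable_delta (n : nat) :
  square_summable (fun k => if Nat.eq_dec k n then RtoC 1 else RtoC 0).
Proof.
apply (Series_partial_le _ 1); [intros; apply pow2_ge_0|].
intros K. apply Rle_trans with (if le_dec n K then 1 else 0).
- induction K.
  + rewrite sum_O. destruct (Nat.eq_dec 0 n), (le_dec n 0); try lia;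
      rewrite ?Cmod_1, ?Cmod_0; simpl; lra.
  + rewrite sum_Sn. eapply Rle_trans; [apply Rplus_le_compat_r, IHK|].
    destruct (Nat.eq_dec (S K) n), (le_dec n K), (le_dec n (S K)); try lia;
      rewrite ?Cmod_1, ?Cmod_0; simpl; lra.
- destruct (le_dec n K); lra.
Qed.

Definition H2_basis (n : nat) : H2 := H2_of_coef _ (square_summable_delta n).

Definition H2_trunc (c : nat -> C) (K : nat) : H2 :=
  sum_n (fun n => scal (c n) (H2_basis n)) K.

Lemma coef_trunc (c : nat -> C) (K n : nat) :
  coef (H2_trunc c K) n = if le_dec n K then c n else RtoC 0.
Proof.
unfold H2_trunc. induction K.
- rewrite sum_O. change (scal (c 0%nat) (H2_basis 0)) with (H2_scal (c 0%nat) (H2_basis 0)).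
  rewrite coef_scal. unfold H2_basis. rewrite coef_of_coef.
  destruct (Nat.eq_dec n 0) as [E|E], (le_dec n 0); try lia; rewrite ?E; ring.
- rewrite sum_Sn. change plus with H2_plus. rewrite coef_plus, IHK.
  change (scal (c (S K)) (H2_basis (S K))) with (H2_scal (c (S K)) (H2_basis (S K))).
  rewrite coef_scal. unfold H2_basis. rewrite coef_of_coef.
  destruct (Nat.eq_dec n (S K)) as [E|E], (le_dec n K), (le_dec n (S K));
    try lia; rewrite ?E; ring.
Qed.

Lemma sum_n_S_R (u : nat -> R) (n : nat) : sum_n u (S n) = sum_n u n + u (S n).
Proof. exact (sum_Sn u n). Qed.

Lemma sum_sqr_trunc_le (c : nat -> C) (K L : nat) :
  sum_n (fun n => Cmod (coef (H2_trunc c K) n) ^ 2) L <= sum_n (fun n => Cmod (c n) ^ 2) K.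
Proof.
assert (H : sum_n (fun n => Cmod (coef (H2_trunc c K) n) ^ 2) L
  <= sum_n (fun n => Cmod (c n) ^ 2) (Nat.min L K)).
{ induction L.
  - rewrite Nat.min_0_l, !sum_O, coef_trunc. destruct (le_dec 0 K); [lra|lia].
  - rewrite sum_n_S_R, coef_trunc. destruct (le_dec (S L) K).
    + replace (Nat.min L K) with L in IHL by lia. replace (Nat.min (S L) K) with (S L) by lia.
      rewrite sum_n_S_R. now apply Rplus_le_compat_r.
    + replace (Nat.min L K) with K in IHL by lia. replace (Nat.min (S L) K) with K by lia.
      rewrite Cmod_0. lra. }
eapply Rle_trans; [exact H|]. apply sum_n_mono; [intros; apply pow2_ge_0|lia].
Qed.

Lemma H2_trunc_tail (f : H2) (eps : R) : 0 < eps ->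
  exists N, forall K, (N <= K)%nat -> H2_norm (minus (H2_trunc (coef f) K) f) <= eps.
Proof.
intros Heps. set (b := fun n => Cmod (coef f n) ^ 2).
destruct (Series_tail_lt b (eps ^ 2) (coef_l2 f)) as [N HN]; [now apply pow_lt|].
exists N. intros K HK. specialize (HN K HK).
apply H2_norm_le_of_sums; [lra|]. intros L.
assert (H : sum_n (fun n => Cmod (coef (minus (H2_trunc (coef f) K) f) n) ^ 2) L
  <= sum_n b (Nat.max L K) - sum_n b K).
{ induction L.
  - rewrite Nat.max_0_l, sum_O, coef_minus, coef_trunc.
    destruct (le_dec 0 K); [|lia]. unfold Cminus. rewrite Cplus_opp_r, Cmod_0. lra.
  - rewrite sum_n_S_R, coef_minus, coef_trunc. destruct (le_dec (S L) K).
    + replace (Nat.max L K) with K in IHL by lia. replace (Nat.max (S L) K) with K by lia.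
      unfold Cminus. rewrite Cplus_opp_r, Cmod_0. lra.
    + replace (Nat.max L K) with L in IHL by lia. replace (Nat.max (S L) K) with (S L) by lia.
      rewrite sum_n_S_R. unfold Cminus. rewrite Cplus_0_l, Cmod_opp.
      unfold b in IHL |- *. lra. }
pose proof (Series_ge_partial b (Nat.max L K) (fun n => pow2_ge_0 _) (coef_l2 f)). lra.
Qed.

Lemma is_linear_sum_n (T : H2 -> H2) (u : nat -> H2) (n : nat) : is_linear T ->
  T (sum_n u n) = sum_n (fun k => T (u k)) n.
Proof.
intros HT. induction n; [now rewrite !sum_O|].
now rewrite !sum_Sn, (linear_plus T HT), IHn.
Qed.

Lemma H2_inner_sum_n_l (u : nat -> H2) (g : H2) (n : nat) :
  H2_inner (sum_n u n) g = sum_n (fun k => H2_inner (u k) g) n.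
Proof.
induction n; [now rewrite !sum_O|]. now rewrite sum_n_S_C, sum_Sn, H2_inner_plus_l, IHn.
Qed.

Lemma H2_inner_trunc (T : H2 -> H2) (g : H2) (c : nat -> C) (K : nat) : is_linear T ->
  H2_inner (T (H2_trunc c K)) g = sum_n (fun n => c n * H2_inner (T (H2_basis n)) g)%C K.
Proof.
intros HT. unfold H2_trunc. rewrite is_linear_sum_n, H2_inner_sum_n_l by exact HT.
apply sum_n_ext. intros n. now rewrite (linear_scal T HT), H2_inner_scal_l.
Qed.

(** Forced by the adjoint identity at the [n]-th monomial: [H2_inner (H2_basis n) (S g)] is the
    conjugate of the [n]-th coefficient of [S g]. *)
Definition adjoint_coef (T : H2 -> H2) (g : H2) (n : nat) : C :=
  Cconj (H2_inner (T (H2_basis n)) g).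

(** Test the form against the truncation of the coefficient sequence itself: the inner product
    becomes the partial sum [X], so Cauchy-Schwarz gives [X <= M * sqrt X * H2_norm g], and one
    factor [sqrt X] cancels. *)
Lemma adjoint_coef_bound (T : H2 -> H2) (M : R) (g : H2) : is_linear T -> 0 <= M ->
  (forall f, H2_norm (T f) <= M * H2_norm f) ->
  forall K, sum_n (fun n => Cmod (adjoint_coef T g n) ^ 2) K <= (M * H2_norm g) ^ 2.
Proof.
intros HT HM HTM K. set (s := adjoint_coef T g).
set (X := sum_n (fun n => Cmod (s n) ^ 2) K).
assert (HX : 0 <= X) by (apply sum_n_nonneg; intros; apply pow2_ge_0).
assert (E : H2_inner (T (H2_trunc s K)) g = RtoC X).
{ rewrite H2_inner_trunc by exact HT. unfold X. rewrite <- sum_n_RtoC.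
  apply sum_n_ext. intros n. rewrite Cmod2_conj. unfold s, adjoint_coef.
  now rewrite Cconj_conj. }
pose proof (H2_cauchy_schwarz (T (H2_trunc s K)) g) as H.
rewrite E, Cmod_R, Rabs_pos_eq in H by exact HX.
pose proof (H2_norm_ge_0 g) as Hg.
assert (Ht : H2_norm (H2_trunc s K) <= sqrt X).
{ apply H2_norm_le_of_sums; [apply sqrt_pos|]. intros L.
  rewrite pow2_sqrt by exact HX. apply sum_sqr_trunc_le. }
assert (H1 : X <= M * sqrt X * H2_norm g).
{ eapply Rle_trans; [exact H|]. apply Rmult_le_compat_r; [exact Hg|].
  eapply Rle_trans; [apply HTM|]. now apply Rmult_le_compat_l. }
pose proof (sqrt_pos X) as Hs. pose proof (sqrt_sqrt X HX) as Hss.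
set (q := sqrt X) in *.
destruct (Req_dec q 0) as [Eq|Eq]; [rewrite Eq in Hss; rewrite <- Hss, Rmult_0_l;
  apply pow2_ge_0|].
assert (q <= M * H2_norm g).
{ apply Rmult_le_reg_r with q; [lra|]. rewrite Hss. lra. }
rewrite <- Hss. replace (q * q) with (q ^ 2) by ring. apply pow_incr. lra.
Qed.

Lemma adjoint_exists (T : H2 -> H2) : is_linear T -> exists S, adjoint_of T S.
Proof.
intros HT.
assert (Hbound : exists M, 0 < M /\ forall f, H2_norm (T f) <= M * H2_norm f)
  by exact (linear_norm T HT).
destruct Hbound as [M [HM HTM]].
assert (Hsq : forall g, square_summable (adjoint_coef T g)).
{ intros g. apply (Series_partial_le _ ((M * H2_norm g) ^ 2)); [intros; apply pow2_ge_0|].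
  apply adjoint_coef_bound; [exact HT|lra|exact HTM]. }
exists (fun g => H2_of_coef _ (Hsq g)). split.
- split.
  + intros f g. apply H2_eq_coef. intros n. change plus with H2_plus at 2.
    rewrite coef_plus, !coef_of_coef. unfold adjoint_coef.
    now rewrite H2_inner_plus_r, Cplus_conj.
  + intros k f. apply H2_eq_coef. intros n.
    change (coef (H2_of_coef _ (Hsq (scal k f))) n
      = coef (H2_scal k (H2_of_coef _ (Hsq f))) n).
    rewrite coef_scal, !coef_of_coef. unfold adjoint_coef.
    now rewrite H2_inner_scal_r, Cmult_conj, Cconj_conj.
  + exists M. split; [exact HM|]. intros g.
    change (H2_norm (H2_of_coef _ (Hsq g)) <= M * H2_norm g).
    pose proof (H2_norm_ge_0 g).
    apply H2_norm_le_of_sums; [nra|]. intros K.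
    rewrite (sum_n_ext _ (fun n => Cmod (adjoint_coef T g n) ^ 2)).
      apply adjoint_coef_bound; [exact HT|lra|exact HTM].
    intros n. now rewrite coef_of_coef.
(* On truncations of [f] the identity is linearity; boundedness of [T] and Cauchy-Schwarz carry it
   to the limit. *)
- intros f g. symmetry. apply H2_inner_of_series. apply is_series_norm. intros eps.
  pose proof (H2_norm_ge_0 g) as Hg. pose proof (cond_pos eps) as He.
  assert (Hd : 0 < M * H2_norm g + 1) by nra.
  destruct (H2_trunc_tail f (eps / (M * H2_norm g + 1))) as [N HN].
    now apply Rdiv_lt_0_compat.
  exists N. intros K HK. specialize (HN K HK).
  rewrite (sum_n_ext _ (fun n => coef f n * H2_inner (T (H2_basis n)) g)%C).
  2:{ intros n. rewrite coef_of_coef. unfold adjoint_coef. now rewrite Cconj_conj. }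
  rewrite <- H2_inner_trunc by exact HT.
  change (Cmod (H2_inner (T (H2_trunc (coef f) K)) g - H2_inner (T f) g) < eps).
  replace (H2_inner (T (H2_trunc (coef f) K)) g - H2_inner (T f) g)%C
    with (H2_inner (T (minus (H2_trunc (coef f) K) f)) g).
  + eapply Rle_lt_trans; [apply H2_cauchy_schwarz|].
    apply Rle_lt_trans with (M * (eps / (M * H2_norm g + 1)) * H2_norm g).
    * apply Rmult_le_compat_r; [exact Hg|]. eapply Rle_trans; [apply HTM|].
      apply Rmult_le_compat_l; lra.
    * replace (M * _ * _) with (eps * ((M * H2_norm g) / (M * H2_norm g + 1)))
        by (field; lra).
      rewrite <- (Rmult_1_r eps) at 2. apply Rmult_lt_compat_l; [exact He|].
      apply Rmult_lt_reg_r with (M * H2_norm g + 1); [exact Hd|].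
      unfold Rdiv. rewrite Rmult_assoc, Rinv_l; lra.
  + unfold minus. rewrite (linear_plus T HT), H2_inner_plus_l.
    replace (opp f) with (scal (opp one : C) f) by apply (scal_opp_one (V := H2_ModuleSpace)).
    rewrite (linear_scal T HT), H2_inner_scal_l. change (opp one : C) with (- RtoC 1)%C. ring.
Qed.

(** * Reproducing kernels and eigenvalues of the adjoint *)

Lemma square_summable_kernel (w : unit_disc) : square_summable (fun n => Cconj w ^ n)%C.
Proof.
pose proof (disc_lt1 w). pose proof (Cmod_ge_0 w).
apply square_summable_le with (fun n => (Cmod w ^ 2) ^ n).
- intros n. rewrite Cmod_pow, Cmod_conj, <- !pow_mult, Nat.mul_comm. lra.
- apply ex_series_geom. rewrite Rabs_pos_eq by apply pow2_ge_0. nra.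
Qed.

(** The Szego kernel [z -> 1 / (1 - conj w * z)]. *)
Definition H2_kernel (w : unit_disc) : H2 := H2_of_coef _ (square_summable_kernel w).

Lemma H2_inner_kernel (f : H2) (w : unit_disc) : H2_inner f (H2_kernel w) = f w.
Proof.
apply H2_inner_of_series.
generalize (proj1 (is_pseries_Cpow _ _ _) (coef_pseries f w)). apply is_series_ext.
intros n. unfold H2_kernel. now rewrite coef_of_coef, Cpow_conj, Cconj_conj.
Qed.

Lemma H2_kernel_neq0 (w : unit_disc) : H2_kernel w <> zero.
Proof.
intros E. assert (H : coef (H2_kernel w) 0 = coef H2_zero 0) by now rewrite E.
unfold H2_kernel in H. rewrite coef_of_coef, coef_zero in H. exact (C1_nz H).
Qed.

Lemma H2_eq_of_inner (g h : H2) : (forall f, H2_inner f g = H2_inner f h) -> g = h.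
Proof.
intros H. apply (plus_reg_r (opp h)). rewrite plus_opp_r. apply H2_inner_self_eq0.
change (H2_inner (minus g h) (minus g h) = RtoC 0). rewrite H2_inner_minus_r, H. ring.
Qed.

(** Paired with any [f], both [S k_w] and [conj (phi w) k_w] give [phi w * f w]. *)
Lemma kernel_eigenvector (phi : unit_disc -> C) (T S : H2 -> H2) (w : unit_disc) :
  analytic_toeplitz phi T -> adjoint_of T S ->
  ker_shift S (Cconj (phi w)) (H2_kernel w).
Proof.
intros [_ HT] [_ HS]. unfold ker_shift.
replace (S (H2_kernel w)) with (scal (Cconj (phi w)) (H2_kernel w)).
  exact (plus_opp_r (G := H2_AbelianGroup) _).
apply H2_eq_of_inner. intros f.
rewrite <- HS, H2_inner_scal_r, !H2_inner_kernel, HT, Cconj_conj. ring.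
Qed.

(** * Reciprocals of analytic functions *)

(** Each coefficient of the reciprocal depends on all earlier ones, so the recursion carries the
    whole initial segment as a function. Level [n] is meaningful only at indices [k <= n]. *)
Fixpoint recip_prefix (b : nat -> C) (n : nat) : nat -> C :=
  match n with
  | O => fun _ => (/ b 0%nat)%C
  | S n' => fun k =>
      if le_dec k n' then recip_prefix b n' k
      else (- / b 0%nat * sum_n (fun j => b (S j) * recip_prefix b n' (n' - j)%nat) n')%C
  end.

Definition recip_coef (b : nat -> C) (n : nat) : C := recip_prefix b n n.

Lemma recip_prefix_stable (b : nat -> C) (n k : nat) : (k <= n)%nat ->
  recip_prefix b n k = recip_coef b k.
Proof.
unfold recip_coef. induction n; intros H.
  now replace k with 0%nat by lia.
destruct (Nat.eq_dec k (S n)) as [->|]; [easy|].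
simpl. destruct (le_dec k n); [auto|lia].
Qed.

Lemma recip_coef_S (b : nat -> C) (n : nat) : recip_coef b (S n) =
  (- / b 0%nat * sum_n (fun j => b (S j) * recip_coef b (n - j)%nat) n)%C.
Proof.
unfold recip_coef at 1. simpl. destruct (le_dec (S n) n); [lia|].
f_equal. apply sum_n_ext. intros j. now rewrite recip_prefix_stable by lia.
Qed.

Lemma cauchy_prod_recip (b : nat -> C) : b 0%nat <> RtoC 0 ->
  cauchy_prod b (recip_coef b) 0 = RtoC 1 /\
  forall n, cauchy_prod b (recip_coef b) (S n) = RtoC 0.
Proof.
intros H0. unfold cauchy_prod. split.
- rewrite sum_O. exact (Cinv_r _ H0).
- intros n. rewrite sum_n_first_C. simpl Nat.sub. rewrite recip_coef_S.
  set (X := sum_n _ n) at 1.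
  match goal with |- (?p + ?q)%C = _ => change q with X; change (p + X = RtoC 0)%C end.
  apply (proj2 (Ceq_minus _ _)). field. exact H0.
Qed.

(** With [e = 1 / |b 0|], [p = 1 / s] and growth rate [k], the recursion is dominated by [e] times
    [B * e * p] times the sum of [p ^ j * k ^ (n - j)]. The rate is chosen with [k - p = B * e * p],
    so this telescopes to [e * (k ^ S n - p ^ S n)], which is within the claimed bound. *)
Lemma recip_coef_bound (b : nat -> C) (B s : R) : b 0%nat <> RtoC 0 -> 0 < s ->
  (forall n, Cmod (b n) * s ^ n <= B) ->
  forall n, Cmod (recip_coef b n) <= / Cmod (b 0%nat) * ((1 + B / Cmod (b 0%nat)) / s) ^ n.
Proof.
intros H0 Hs HB.
assert (Hb : 0 < Cmod (b 0%nat)) by now apply Cmod_gt_0.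
set (e := / Cmod (b 0%nat)). assert (He : 0 < e) by now apply Rinv_0_lt_compat.
assert (HB0 : 0 <= B).
{ eapply Rle_trans; [|apply (HB 0%nat)]. simpl. lra. }
set (p := / s). assert (Hp : 0 < p) by now apply Rinv_0_lt_compat.
set (k := (1 + B / Cmod (b 0%nat)) / s).
assert (Hk : k = p + B * e * p) by (unfold k, p, e; field; lra).
assert (HBe : 0 <= B * e) by nra. assert (Hk0 : 0 < k) by nra.
assert (Hgeo : forall n, B * e * p * sum_n (fun j => p ^ j * k ^ (n - j)) n
   = k ^ S n - p ^ S n).
{ induction n.
  - rewrite sum_O. simpl. lra.
  - rewrite sum_n_S_R.
    rewrite (sum_n_ext_loc _ (fun j => k * (p ^ j * k ^ (n - j)))).
    + replace (sum_n (fun j => k * (p ^ j * k ^ (n - j))) n)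
        with (k * sum_n (fun j => p ^ j * k ^ (n - j)) n)
        by (symmetry; exact (sum_n_mult_l (K := R_Ring) _ _ n)).
      rewrite Nat.sub_diag.
      transitivity (k * (B * e * p * sum_n (fun j => p ^ j * k ^ (n - j)) n)
        + B * e * p * p ^ S n); [simpl (k ^ 0); ring|].
      rewrite IHn. replace (B * e * p) with (k - p) by lra. simpl. ring.
    + intros j Hj. rewrite Nat.sub_succ_l by exact Hj. simpl. ring. }
induction n as [n IH] using (well_founded_induction lt_wf).
destruct n as [|n].
- unfold recip_coef, recip_prefix. rewrite Cmod_inv by exact H0. fold e. simpl. lra.
- rewrite recip_coef_S, Cmod_mult, Cmod_opp, Cmod_inv by exact H0. fold e.
  apply Rmult_le_compat_l; [lra|].
  eapply Rle_trans; [apply Cmod_sum_n_le|].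
  apply Rle_trans with (B * e * p * sum_n (fun j => p ^ j * k ^ (n - j)) n).
  + replace (B * e * p * sum_n (fun j => p ^ j * k ^ (n - j)) n)
      with (sum_n (fun j => B * e * p * (p ^ j * k ^ (n - j))) n)
      by exact (sum_n_mult_l (K := R_Ring) _ _ n).
    apply sum_n_le. intros j Hj. rewrite Cmod_mult.
    replace (B * e * p * (p ^ j * k ^ (n - j))) with ((B * p ^ S j) * (e * k ^ (n - j)))
      by (simpl; ring).
    apply Rmult_le_compat; try apply Cmod_ge_0.
    * specialize (HB (S j)). assert (Hsj : 0 < s ^ S j) by now apply pow_lt.
      apply Rmult_le_reg_r with (s ^ S j); [exact Hsj|].
      unfold p. rewrite pow_inv, Rmult_assoc, Rinv_l; lra.
    * apply IH. lia.
  + rewrite Hgeo. assert (0 < p ^ S n) by now apply pow_lt. lra.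
Qed.

Lemma is_series_at_0 (b : nat -> C) : is_series (fun n => b n * 0 ^ n)%C (b 0%nat).
Proof.
apply is_series_single; [exact (Cmult_1_r _)|]. intros n. rewrite Cpow_S. ring.
Qed.

(** The coefficients [recip_coef b] grow at most geometrically, so their series converges near 0;
    its Cauchy product with [b] is the constant 1, which makes its sum the reciprocal there. *)
Lemma locally_analytic_inv (f : C -> C) : locally_analytic f ->
  (forall z, Cmod z < 1 -> f z <> RtoC 0) -> locally_analytic (fun z => / f z)%C.
Proof.
intros Hf H0 z Hz. destruct (Hf z Hz) as [b [r [Hr Hb]]].
assert (Hb0 : b 0%nat <> RtoC 0).
{ replace (b 0%nat) with (f z); [now apply H0|].
  apply (is_series_norm_unique (V := C_NormedModule) (fun n => b n * 0 ^ n)%C).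
  - rewrite <- (Cplus_0_r z) at 1. apply Hb. rewrite Cmod_0. lra.
  - apply is_series_at_0. }
assert (Hb0' : 0 < Cmod (b 0%nat)) by now apply Cmod_gt_0.
set (s := r / 2). assert (Hs : 0 < s) by (unfold s; lra).
assert (Habs : abs_pseries b s).
{ apply pseries_abs_real with (f (z + RtoC (3 / 4 * r))%C) (3 / 4 * r); [unfold s; lra|].
  apply Hb. rewrite Cmod_R, Rabs_pos_eq; lra. }
set (B := Series (fun n => Cmod (b n) * s ^ n)).
assert (HB : forall n, Cmod (b n) * s ^ n <= B).
{ intros n. apply (term_le_Series (fun n => Cmod (b n) * s ^ n)); [|exact Habs].
  intros m. apply Rmult_le_pos; [apply Cmod_ge_0|apply pow_le; lra]. }
assert (HB0 : 0 <= B).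
{ eapply Rle_trans; [|apply (HB 0%nat)]. simpl. lra. }
pose proof (recip_coef_bound b B s Hb0 Hs HB) as Hd.
set (k := (1 + B / Cmod (b 0%nat)) / s) in *.
assert (Hk : 1 <= k * s).
{ unfold k. replace (_ * s) with (1 + B / Cmod (b 0%nat)) by (field; lra).
  assert (0 <= B / Cmod (b 0%nat)) by (apply Rdiv_le_0_compat; lra). lra. }
assert (Hk0 : 0 < k) by nra.
assert (Hik : / k <= s).
{ apply Rmult_le_reg_l with k; [exact Hk0|]. rewrite Rinv_r; lra. }
assert (Hik0 : 0 < / k) by now apply Rinv_0_lt_compat.
assert (Hdabs : abs_pseries (recip_coef b) (/ k / 2)).
{ apply abs_pseries_of_bounded with (/ k) (/ Cmod (b 0%nat)); [lra|].
  intros n. specialize (Hd n). assert (Hkn : 0 < k ^ n) by now apply pow_lt.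
  rewrite pow_inv. apply Rmult_le_reg_r with (k ^ n); [exact Hkn|].
  rewrite Rmult_assoc, Rinv_l; lra. }
exists (recip_coef b), (/ k / 2). split; [lra|]. intros h Hh.
destruct (abs_pseries_ex _ _ h (Rlt_le _ _ Hh) Hdabs) as [G HG].
replace (/ f (z + h))%C with G; [exact HG|].
assert (E : (f (z + h) * G)%C = RtoC 1).
{ apply (is_series_norm_unique (V := C_NormedModule)
    (fun n => cauchy_prod b (recip_coef b) n * h ^ n)%C).
  - apply is_series_pow_cauchy_prod with (/ k / 2).
    + apply abs_pseries_le with (2 := Habs). lra.
    + exact Hdabs.
    + lra.
    + apply Hb. unfold s in *. lra.
    + exact HG.
  - destruct (cauchy_prod_recip b Hb0) as [E0 ES]. apply is_series_single.
    + rewrite E0. exact (Cmult_1_r _).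
    + intros n. rewrite ES. cring. }
assert (Hf0 : f (z + h)%C <> RtoC 0).
{ intros E'. rewrite E', Cmult_0_l in E. symmetry in E. exact (C1_nz E). }
replace G with (/ f (z + h) * (f (z + h) * G))%C by (field; exact Hf0).
rewrite E. cring.
Qed.

Lemma locally_analytic_minus_const (f : C -> C) (c : C) :
  locally_analytic f -> locally_analytic (fun z => f z - c)%C.
Proof.
intros Hf z Hz. destruct (Hf z Hz) as [b [r [Hr Hb]]].
exists (fun n : nat => if n then b n - c else b n)%C, r. split; [exact Hr|]. intros h Hh.
assert (Hc : is_series (fun n : nat => (if n then c else RtoC 0) * h ^ n)%C c).
{ apply is_series_single; [exact (Cmult_1_r _)|]. intros n. cring. }
generalize (is_series_minus_C _ _ _ _ (Hb h Hh) Hc). apply is_series_ext.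
intros [|n]; cring.
Qed.

Lemma locally_analytic_on_disc (f : C -> C) :
  locally_analytic f -> analytic_on_disc (fun z => f z).
Proof.
intros Hf z0. destruct (Hf z0 (disc_lt1 z0)) as [b [r [Hr Hb]]].
exists b, r. split; [exact Hr|]. intros z Hz. apply is_pseries_Cpow.
replace (f z) with (f (z0 + (z - z0))%C) by (f_equal; ring).
now apply Hb.
Qed.

Lemma analytic_on_disc_inv_minus (phi : unit_disc -> C) (c : C) :
  analytic_on_disc phi -> (forall z, phi z <> c) ->
  analytic_on_disc (fun z => / (phi z - c))%C.
Proof.
intros Hphi Hc.
assert (H : locally_analytic (fun z => / (disc_extend phi z - c))%C).
{ apply (locally_analytic_inv (fun z => disc_extend phi z - c)%C).
  - now apply locally_analytic_minus_const, disc_extend_analytic.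
  - intros z Hz E. apply (proj2 (Ceq_minus _ _)) in E.
    apply (Hc (Unit_disc z Hz)). rewrite <- E.
    symmetry. exact (disc_extend_eq phi (Unit_disc z Hz)). }
apply locally_analytic_on_disc in H. intros z0. destruct (H z0) as [b [r [Hr Hb]]].
exists b, r. split; [exact Hr|]. intros z Hz.
rewrite <- (disc_extend_eq phi z). now apply Hb.
Qed.

Lemma eigenvalue_near_range (phi : unit_disc -> C) (T S : H2 -> H2) (c : C) (r : R) :
  analytic_on_disc phi -> analytic_toeplitz phi T -> adjoint_of T S -> 0 < r ->
  (forall w, r <= Cmod (Cconj (phi w) - c)) -> ~ point_spectrum S c.
Proof.
intros Hphi [_ HT] [_ HS] Hr Hfar [x [Hx0 Hx]].
assert (Hfar' : forall w, r <= Cmod (phi w - Cconj c)).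
{ intros w. rewrite <- Cmod_conj, Cminus_conj, Cconj_conj. apply Hfar. }
assert (Hne : forall w, phi w <> Cconj c).
{ intros w E. specialize (Hfar' w). rewrite E in Hfar'.
  unfold Cminus in Hfar'. rewrite Cplus_opp_r, Cmod_0 in Hfar'. lra. }
assert (Hne' : forall w, (phi w - Cconj c)%C <> RtoC 0).
{ intros w E. apply (Hne w). now apply Ceq_minus. }
destruct (analytic_toeplitz_exists (fun z => / (phi z - Cconj c))%C) as [T' [_ HT']].
- now apply analytic_on_disc_inv_minus.
- exists (/ r). intros z. rewrite Cmod_inv by apply Hne'.
  apply Rinv_le_contravar; [exact Hr|apply Hfar'].
- apply Hx0. set (f := T' x).
  assert (Ex : minus (T f) (scal (Cconj c) f) = x).
  { apply H2_eq. intros z. change (T f z + - (Cconj c * f z) = x z)%C.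
    rewrite HT. unfold f. rewrite HT'. field. apply Hne'. }
  assert (ESx : S x = scal c x).
  { apply (plus_reg_r (opp (scal c x))). rewrite plus_opp_r. exact Hx. }
  (* With [x = (T - conj c) f], the inner product of [x] with itself is that of [f] with
     [(S - c) x], which is 0. *)
  apply H2_inner_self_eq0. rewrite <- Ex at 1.
  rewrite H2_inner_minus_l, HS, ESx, H2_inner_scal_r, H2_inner_scal_l. ring.
Qed.

(** * The range of a non-constant analytic function contains a disc *)

Lemma contraction_surjective (F : C -> C) (b : C) (rho : R) : 0 < rho -> b <> RtoC 0 ->
  (forall h k, Cmod h <= rho -> Cmod k <= rho ->
     Cmod (F h - F k - b * (h - k)) <= Cmod b / 2 * Cmod (h - k)) ->
  forall v, Cmod (v - F (RtoC 0)) <= Cmod b * (rho / 2) ->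
  exists h, Cmod h <= rho /\ F h = v.
Proof.
intros Hrho Hb HF v Hv.
assert (Hb0 : 0 < Cmod b) by now apply Cmod_gt_0.
set (N := fun h => (h - (F h - v) / b)%C).
assert (HN : forall h k, Cmod h <= rho -> Cmod k <= rho ->
  Cmod (N h - N k) <= / 2 * Cmod (h - k)).
{ intros h k Hh Hk.
  replace (N h - N k)%C with (- ((F h - F k - b * (h - k)) / b))%C
    by (unfold N; field; exact Hb).
  rewrite Cmod_opp, Cmod_div by exact Hb.
  apply Rmult_le_reg_r with (Cmod b); [exact Hb0|].
  unfold Rdiv. rewrite Rmult_assoc, Rinv_l, Rmult_1_r by lra.
  eapply Rle_trans; [now apply HF|]. right. field. }
assert (HN0 : Cmod (N 0) <= rho / 2).
{ unfold N. replace (0 - (F 0 - v) / b)%C with ((v - F 0) / b)%C by (field; exact Hb).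
  rewrite Cmod_div by exact Hb. apply Rmult_le_reg_r with (Cmod b); [exact Hb0|].
  unfold Rdiv at 1. rewrite Rmult_assoc, Rinv_l, Rmult_1_r; lra. }
assert (HNr : forall h, Cmod h <= rho -> Cmod (N h) <= rho).
{ intros h Hh. replace (N h) with (N h - N 0 + N 0)%C by ring.
  eapply Rle_trans; [apply Cmod_triangle|].
  assert (Cmod (N h - N 0) <= / 2 * Cmod (h - 0)).
  { apply HN; [exact Hh|]. rewrite Cmod_0. lra. }
  replace (h - 0)%C with h in H by ring. lra. }
set (x := fun n => Nat.iter n N (RtoC 0)).
assert (Hx : forall n, Cmod (x n) <= rho).
{ induction n; [simpl; rewrite Cmod_0; lra|]. now apply HNr. }
assert (Hd : forall n, Cmod (x (S n) - x n) <= rho / 2 * (/ 2) ^ n).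
{ induction n.
  - simpl. replace (N 0 - 0)%C with (N 0) by ring. lra.
  - change (Cmod (N (x (S n)) - N (x n)) <= rho / 2 * (/ 2 * (/ 2) ^ n)).
    eapply Rle_trans; [now apply HN|]. lra. }
assert (Hex : ex_series (fun n => x (S n) - x n)%C).
{ apply (ex_series_le (V := C_CompleteNormedModule) _ (fun n => rho / 2 * (/ 2) ^ n)).
    exact Hd.
  apply (ex_series_scal (V := R_NormedModule)), ex_series_geom.
  rewrite Rabs_pos_eq; lra. }
destruct Hex as [H Hs].
assert (Hsum : forall n, sum_n (fun n => x (S n) - x n)%C n = x (S n)).
{ induction n; [rewrite sum_O; change (x 0%nat) with (RtoC 0); cring|].
  rewrite sum_n_S_C, IHn. cring. }
assert (Hlim : forall eps, 0 < eps -> exists n, Cmod (x (S n) - H) < eps /\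
  Cmod (x (S (S n)) - H) < eps).
{ intros eps He. destruct (proj1 (is_series_norm _ _) Hs (mkposreal _ He)) as [n Hn].
  exists n. rewrite <- (Hsum n), <- (Hsum (S n)). split; apply Hn; lia. }
assert (HH : Cmod H <= rho).
{ apply le_epsilon. intros eps He. destruct (Hlim eps He) as [n [Hn _]].
  replace H with (x (S n) + - (x (S n) - H))%C by cring.
  eapply Rle_trans; [apply Cmod_triangle|]. rewrite Cmod_opp. specialize (Hx (S n)). lra. }
exists H. split; [exact HH|].
assert (E : (N H - H)%C = RtoC 0).
{ apply Cmod_eq_0, Rle_antisym; [|apply Cmod_ge_0]. apply le_epsilon. intros eps He.
  destruct (Hlim (eps / 2)) as [n [Hn1 Hn2]]; [lra|].
  replace (N H - H)%C with (- (N (x (S n)) - N H) + (x (S (S n)) - H))%C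
    by (change (x (S (S n))) with (N (x (S n))); cring).
  eapply Rle_trans; [apply Cmod_triangle|]. rewrite Cmod_opp.
  pose proof (HN (x (S n)) H (Hx (S n)) HH). lra. }
assert (E' : ((F H - v) / b)%C = RtoC 0).
{ replace ((F H - v) / b)%C with (- (N H - H))%C by (unfold N; ring). rewrite E. ring. }
apply Ceq_minus. replace (F H - v)%C with ((F H - v) / b * b)%C by (field; exact Hb).
rewrite E'. ring.
Qed.

Lemma Cpow_diff_le (h k : C) (rho : R) (n : nat) : Cmod h <= rho -> Cmod k <= rho ->
  Cmod (h ^ S n - k ^ S n) <= INR (S n) * rho ^ n * Cmod (h - k).
Proof.
intros Hh Hk. pose proof (Cmod_ge_0 h) as Hh0. pose proof (Cmod_ge_0 (h - k)) as Hd.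
induction n.
- rewrite !Cpow_1_r. simpl. lra.
- rewrite (Cpow_S h), (Cpow_S k).
  replace (h * h ^ S n - k * k ^ S n)%C
    with (h * (h ^ S n - k ^ S n) + (h - k) * k ^ S n)%C by ring.
  eapply Rle_trans; [apply Cmod_triangle|]. rewrite !Cmod_mult, Cmod_pow.
  rewrite (S_INR (S n)), !Rmult_plus_distr_r, Rmult_1_l.
  apply Rplus_le_compat.
  + apply Rle_trans with (rho * (INR (S n) * rho ^ n * Cmod (h - k))).
      apply Rmult_le_compat; try apply Cmod_ge_0; assumption.
    right. simpl. ring.
  + rewrite Rmult_comm. apply Rmult_le_compat_r; [exact Hd|].
    apply pow_incr. split; [apply Cmod_ge_0|exact Hk].
Qed.

Lemma INR_le_pow2 (n : nat) : INR (S n) <= 2 ^ n.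
Proof.
induction n; [simpl; lra|]. rewrite S_INR. change (2 ^ S n) with (2 * 2 ^ n).
assert (1 <= 2 ^ n) by (apply pow_R1_Rle; lra). lra.
Qed.

(** After removal of the terms of degree 0 and 1, the term of degree [n + 2] is controlled by
    [(n + 2) * rho ^ (n + 1) * |h - k|]. Since [n + 2 <= 2 * 2 ^ n] and [rho <= s / 2], the factor
    [2 ^ n] is absorbed in passing from [rho ^ n] to [s ^ n], leaving [2 * rho / s ^ 2] times
    [s ^ (n + 2)]. *)
Lemma pseries_near_linear (b : nat -> C) (F : C -> C) (r s rho : R) : 0 < s < r ->
  (forall h, Cmod h < r -> is_series (fun n => b n * h ^ n)%C (F h)) ->
  0 < rho <= s / 2 ->
  forall h k, Cmod h <= rho -> Cmod k <= rho ->
  Cmod (F h - F k - b 1%nat * (h - k))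
    <= 2 * rho / s ^ 2 * Series (fun n => Cmod (b n) * s ^ n) * Cmod (h - k).
Proof.
intros Hs HF Hrho h k Hh Hk.
assert (Habs : abs_pseries b s).
{ apply pseries_abs_real with (F (RtoC ((s + r) / 2))) ((s + r) / 2); [lra|].
  apply HF. rewrite Cmod_R, Rabs_pos_eq; lra. }
pose proof (is_series_minus_C _ _ _ _ (HF h ltac:(lra)) (HF k ltac:(lra))) as H.
apply is_series_shift_C, is_series_shift_C in H.
set (L := 2 * rho / s ^ 2 * Cmod (h - k)).
assert (HL : 0 <= L).
{ apply Rmult_le_pos; [|apply Cmod_ge_0]. apply Rdiv_le_0_compat; [lra|apply pow_lt; lra]. }
replace (F h - F k - b 1%nat * (h - k))%C with
  (F h - F k - (b 0%nat * h ^ 0 - b 0%nat * k ^ 0) - (b 1%nat * h ^ 1 - b 1%nat * k ^ 1))%C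
  by (simpl; ring).
replace (_ * Cmod (h - k)) with (L * Series (fun n => Cmod (b n) * s ^ n))
  by (unfold L; ring).
assert (Hpos : forall n, 0 <= Cmod (b n) * s ^ n).
{ intros n. apply Rmult_le_pos; [apply Cmod_ge_0|apply pow_le; lra]. }
set (t := fun n => L * (Cmod (b (2 + n)%nat) * s ^ (2 + n))).
assert (Ht : ex_series t).
{ apply (ex_series_scal (V := R_NormedModule) L).
  now apply (ex_series_incr_n (V := R_NormedModule) (fun n => Cmod (b n) * s ^ n)). }
apply Rle_trans with (Series t).
- apply (Cmod_series_le _ _ _ H); [|exact Ht]. intros n. unfold t, L.
  replace (b (S (S n)) * h ^ S (S n) - b (S (S n)) * k ^ S (S n))%C
    with (b (S (S n)) * (h ^ S (S n) - k ^ S (S n)))%C by ring.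
  rewrite Cmod_mult.
  replace (_ * (_ * s ^ (2 + n))) with
    (Cmod (b (2 + n)%nat) * (2 * rho * s ^ n * Cmod (h - k))).
  2:{ simpl. field. lra. }
  apply Rmult_le_compat_l; [apply Cmod_ge_0|].
  eapply Rle_trans; [apply (Cpow_diff_le h k rho); assumption|].
  apply Rmult_le_compat_r; [apply Cmod_ge_0|].
  assert (H2 : INR (S (S n)) <= 2 * 2 ^ n) by exact (INR_le_pow2 (S n)).
  assert (H3 : rho ^ n <= (s / 2) ^ n) by (apply pow_incr; lra).
  assert (H4 : 2 ^ n * (s / 2) ^ n = s ^ n).
  { rewrite <- Rpow_mult_distr. f_equal. field. }
  assert (H5 : 0 < rho ^ n) by (apply pow_lt; lra).
  assert (H6 : 0 < 2 ^ n) by (apply pow_lt; lra).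
  rewrite <- H4. simpl (rho ^ S n).
  apply Rle_trans with (2 * 2 ^ n * (rho * rho ^ n)).
    apply Rmult_le_compat_r; [nra|exact H2].
  replace (2 * rho * (2 ^ n * (s / 2) ^ n)) with (2 * 2 ^ n * (rho * (s / 2) ^ n)) by ring.
  apply Rmult_le_compat_l; [lra|]. apply Rmult_le_compat_l; lra.
- unfold t. rewrite Series_scal_l. apply Rmult_le_compat_l; [exact HL|].
  rewrite (Series_incr_n (fun n => Cmod (b n) * s ^ n) 2) by (lia || exact Habs).
  simpl Init.Nat.pred.
  pose proof (cond_pos_sum (fun n => Cmod (b n) * s ^ n) 1 Hpos). lra.
Qed.

Lemma pseries_image_disc (b : nat -> C) (F : C -> C) (r : R) : 0 < r ->
  (forall h, Cmod h < r -> is_series (fun n => b n * h ^ n)%C (F h)) ->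
  b 1%nat <> RtoC 0 ->
  exists eps, 0 < eps /\ forall v, Cmod (v - F (RtoC 0)) < eps ->
    exists h, Cmod h < r /\ F h = v.
Proof.
intros Hr HF Hb. assert (Hb0 : 0 < Cmod (b 1%nat)) by now apply Cmod_gt_0.
set (s := r / 2). set (B := Series (fun n => Cmod (b n) * s ^ n)).
assert (Hs : 0 < s < r) by (unfold s; lra).
assert (HB : 0 <= B).
{ apply Series_nonneg.
  - intros n. apply Rmult_le_pos; [apply Cmod_ge_0|apply pow_le; lra].
  - apply pseries_abs_real with (F (RtoC (3 / 4 * r))) (3 / 4 * r); [unfold s; lra|].
    apply HF. rewrite Cmod_R, Rabs_pos_eq; lra. }
assert (Hs2 : 0 < s ^ 2) by (apply pow_lt; lra).
(* The second bound makes the Lipschitz constant [2 * rho * B / s ^ 2] at most [|b 1| / 2]; [B + 1]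
   avoids dividing by 0. *)
set (rho := Rmin (s / 2) (Cmod (b 1%nat) * s ^ 2 / (4 * (B + 1)))).
assert (Hrho : 0 < rho).
{ apply Rmin_pos; [lra|]. apply Rdiv_lt_0_compat; [now apply Rmult_lt_0_compat|lra]. }
assert (Hrs : rho <= s / 2) by apply Rmin_l.
assert (Hrb : rho * (4 * (B + 1)) <= Cmod (b 1%nat) * s ^ 2).
{ replace (Cmod (b 1%nat) * s ^ 2) with
    (Cmod (b 1%nat) * s ^ 2 / (4 * (B + 1)) * (4 * (B + 1))) by (field; lra).
  apply Rmult_le_compat_r; [lra|apply Rmin_r]. }
exists (Cmod (b 1%nat) * (rho / 2)). split; [apply Rmult_lt_0_compat; lra|].
intros v Hv.
destruct (contraction_surjective F (b 1%nat) rho Hrho Hb) with v as [h [Hh E]].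
- intros h k Hh Hk.
  eapply Rle_trans; [now apply (pseries_near_linear b F r s rho)|].
  apply Rmult_le_compat_r; [apply Cmod_ge_0|]. fold B.
  apply Rmult_le_reg_r with (s ^ 2); [exact Hs2|].
  replace (2 * rho / s ^ 2 * B * s ^ 2) with (2 * rho * B) by (field; lra). nra.
- lra.
- exists h. split; [lra|exact E].
Qed.

Lemma binom_pos (n k : nat) : (k <= n)%nat -> (0 < binom n k)%nat.
Proof.
revert k. induction n; intros [|k] H; simpl; try lia.
specialize (IHn k). lia.
Qed.

(** If the derivative vanished on the whole disc, all coefficients of index at least 1 would vanish
    and [phi] would be constant. At a point where it does not vanish, the recentred series has a
    nonzero linear coefficient. *)
Lemma range_contains_disc (phi : unit_disc -> C) (a : nat -> C) :
  (forall z : unit_disc, is_pseries a (z : C) (phi z)) -> ~ constant_on_disc phi ->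
  exists c r, 0 < r /\ forall v, Cmod (v - c) < r -> exists w, phi w = v.
Proof.
intros Ha Hnc.
assert (Habs : forall s, 0 <= s < 1 -> abs_pseries a s).
{ intros s. now apply disc_pseries_abs with phi. }
assert (Hz : exists z, Cmod z < 1 /\ recentred a z 1 <> RtoC 0).
{ apply NNPP. intros Hno.
  assert (H1 : forall n, taylor_coef a 1 n = RtoC 0).
  { assert (Habs1 : abs_pseries (taylor_coef a 1) (1 / 2)).
    { apply taylor_coef_abs with (3 / 4); [lra|]. apply Habs. lra. }
    apply pseries_zeros_coef with (1 / 2); [lra|exact Habs1|].
    intros eps Heps. exists (RtoC (Rmin (eps / 2) (1 / 2))).
    pose proof (Rmin_l (eps / 2) (1 / 2)). pose proof (Rmin_r (eps / 2) (1 / 2)).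
    assert (0 < Rmin (eps / 2) (1 / 2)) by (apply Rmin_pos; lra).
    set (x := Rmin _ _) in *.
    assert (Hx : Cmod (RtoC x) = x) by (rewrite Cmod_R, Rabs_pos_eq; lra).
    split; [rewrite Hx; lra|].
    replace (RtoC 0) with (recentred a x 1).
    - apply CSeries_correct, abs_pseries_ex with (1 / 2); [rewrite Hx; lra|exact Habs1].
    - apply NNPP. intros Hne. apply Hno. exists (RtoC x). split; [rewrite Hx; lra|exact Hne]. }
  apply Hnc. exists (a 0%nat). intros z.
  apply (is_series_norm_unique (V := C_NormedModule) (fun n => a n * z ^ n)%C).
  - apply is_pseries_Cpow, Ha.
  - apply is_series_single; [exact (Cmult_1_r _)|]. intros n.
    assert (E : a (S n) = RtoC 0).
    { specialize (H1 n). unfold taylor_coef in H1. replace (n + 1)%nat with (S n) in H1 by lia.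
      apply NNPP. intros Hne. apply (Cmult_neq_0 _ _) in H1; [exact H1| |exact Hne].
      intros E0. apply RtoC_inj in E0. revert E0. apply not_0_INR. pose proof (binom_pos (S n) 1). lia. }
    rewrite E. cring. }
destruct Hz as [z [Hz Hz1]]. pose proof (Cmod_ge_0 z).
destruct (pseries_image_disc (recentred a z) (fun h => disc_extend phi (z + h)%C)
  (1 - Cmod z)) as [eps [He Hv]]; [lra| |exact Hz1|].
- intros h Hh. pose proof (Cmod_ge_0 h).
  set (s := (1 + Cmod z + Cmod h) / 2).
  apply recentre with s; [apply Habs| | |]; unfold s; try lra.
  assert (Hzh : Cmod (z + h) < 1) by (eapply Rle_lt_trans; [apply Cmod_triangle|lra]).
  replace (disc_extend phi (z + h)%C) with (phi (Unit_disc _ Hzh))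
    by (symmetry; exact (disc_extend_eq phi (Unit_disc _ Hzh))).
  apply is_pseries_Cpow. exact (Ha (Unit_disc _ Hzh)).
- exists (disc_extend phi (z + RtoC 0)%C), eps. split; [exact He|].
  intros v Hvv. destruct (Hv v Hvv) as [h [Hh E]].
  assert (Hzh : Cmod (z + h) < 1) by (eapply Rle_lt_trans; [apply Cmod_triangle|lra]).
  exists (Unit_disc _ Hzh). rewrite <- E. symmetry.
  exact (disc_extend_eq phi (Unit_disc _ Hzh)).
Qed.

(** * Identity theorem *)

(** The series recentred at [w] represents [F] on the full disc of radius [1 - |w|], and its
    coefficients are already determined, as zero, by the small neighbourhood. *)
Lemma zero_near_extend (a : nat -> C) (F : C -> C) (w : C) (eta : R) :
  (forall z, Cmod z < 1 -> is_series (fun n => a n * z ^ n)%C (F z)) ->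
  Cmod w < 1 -> 0 < eta -> (forall z, Cmod (z - w) < eta -> F z = RtoC 0) ->
  forall z, Cmod w + Cmod (z - w) < 1 -> F z = RtoC 0.
Proof.
intros Ha Hw Heta H0.
assert (Habs : forall s, 0 <= s < 1 -> abs_pseries a s).
{ intros s Hs. apply pseries_abs_real with (F (RtoC ((1 + s) / 2))) ((1 + s) / 2); [lra|].
  apply Ha. rewrite Cmod_R, Rabs_pos_eq; lra. }
pose proof (Cmod_ge_0 w) as Hw0.
assert (Hrec : forall h, Cmod w + Cmod h < 1 ->
  is_series (fun k => recentred a w k * h ^ k)%C (F (w + h)%C)).
{ intros h Hh. pose proof (Cmod_ge_0 h).
  apply recentre with ((1 + Cmod w + Cmod h) / 2); [apply Habs| | |]; try lra.
  apply Ha. eapply Rle_lt_trans; [apply Cmod_triangle|exact Hh]. }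
assert (Hc : forall k, recentred a w k = RtoC 0).
{ set (s := (1 - Cmod w) / 2). assert (Hs : 0 < s) by (unfold s; lra).
  apply pseries_zeros_coef with (s / 2); [lra| |].
  - apply pseries_abs_real with (F (w + RtoC s)%C) s; [lra|]. apply Hrec.
    rewrite Cmod_R, Rabs_pos_eq; unfold s; lra.
  - intros eps Heps. set (x := Rmin (Rmin (eps / 2) (eta / 2)) s).
    assert (0 < x) by (repeat apply Rmin_pos; lra).
    assert (x <= eps / 2) by (eapply Rle_trans; [apply Rmin_l|apply Rmin_l]).
    assert (x <= eta / 2) by (eapply Rle_trans; [apply Rmin_l|apply Rmin_r]).
    assert (x <= s) by apply Rmin_r.
    assert (Hx : Cmod (RtoC x) = x) by (rewrite Cmod_R, Rabs_pos_eq; lra).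
    exists (RtoC x). split; [rewrite Hx; lra|].
    rewrite <- (H0 (w + RtoC x)%C).
    + apply Hrec. rewrite Hx. unfold s in *. lra.
    + replace (w + RtoC x - w)%C with (RtoC x) by ring. rewrite Hx. lra. }
intros z Hz.
apply (is_series_norm_unique (V := C_NormedModule)
  (fun k => recentred a w k * (z - w) ^ k)%C).
- replace (F z) with (F (w + (z - w))%C) by (f_equal; ring). now apply Hrec.
- generalize is_series_zero_C. apply is_series_ext. intros k. rewrite Hc. cring.
Qed.

(* Vanishing near [w] spreads along the points [|w| ^ n * w] towards [0]: each of them
   lies in the disc of radius [1 - |w|] around the preceding one. *)
Lemma pseries_identity (a : nat -> C) (F : C -> C) (w : C) (eta : R) :
  (forall z, Cmod z < 1 -> is_series (fun n => a n * z ^ n)%C (F z)) ->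
  Cmod w < 1 -> 0 < eta -> (forall z, Cmod (z - w) < eta -> F z = RtoC 0) ->
  forall n, a n = RtoC 0.
Proof.
intros Ha Hw Heta H0. pose proof (Cmod_ge_0 w) as Hw0.
set (q := Cmod w) in *. set (x := fun n => (RtoC (q ^ n) * w)%C).
assert (Hqn : forall n, 0 <= q ^ n <= 1).
{ intros n. split; [now apply pow_le|]. rewrite <- (pow1 n). apply pow_incr. lra. }
assert (Hxm : forall n, Cmod (x n) = q ^ n * q).
{ intros n. unfold x. rewrite Cmod_mult, Cmod_R, Rabs_pos_eq by apply Hqn. easy. }
assert (Hx1 : forall n, Cmod (x n) < 1).
{ intros n. rewrite Hxm. specialize (Hqn n). nra. }
assert (Hd : 0 < (1 - q) * (1 - q)) by nra.
assert (Hn : forall n, exists e, 0 < e /\ forall z, Cmod (z - x n) < e -> F z = RtoC 0).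
{ induction n.
  - exists eta. split; [exact Heta|]. intros z Hz. apply H0.
    replace w with (x 0%nat); [exact Hz|]. unfold x. simpl. ring.
  (* For [|z - x (S n)| < (1 - q) ^ 2], [|x n| + |z - x n|] is below
     [(2 - q) * q ^ n * q + (1 - q) ^ 2], hence below [(2 - q) * q + (1 - q) ^ 2 = 1]. *)
  - destruct IHn as [e [He He0]]. exists ((1 - q) * (1 - q)). split; [exact Hd|].
    intros z Hz. apply (zero_near_extend a F (x n) e Ha (Hx1 n) He He0).
    assert (Hstep : Cmod (x (S n) - x n) = (1 - q) * (q ^ n * q)).
    { replace (x (S n) - x n)%C with (RtoC (- ((1 - q) * q ^ n)) * w)%C.
      - rewrite Cmod_mult, Cmod_R, Rabs_Ropp, Rabs_pos_eq; [unfold q; ring|].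
        apply Rmult_le_pos; [lra|apply Hqn].
      - unfold x. simpl pow. rewrite RtoC_opp, !RtoC_mult, RtoC_minus. ring. }
    replace (z - x n)%C with (z - x (S n) + (x (S n) - x n))%C by ring.
    pose proof (Cmod_triangle (z - x (S n)) (x (S n) - x n)).
    rewrite Hxm, Hstep in *. specialize (Hqn n). fold q in Hw.
    assert (Hp : q ^ n * q <= q) by nra.
    apply (Rmult_le_compat_l (2 - q)) in Hp; lra. }
(* Once [|x N| < 1 / 4], any [|z| < 1 / 2] satisfies [|x N| + |z - x N| <= 2 * |x N| + |z| < 1], so
   one more extension covers a neighbourhood of 0. *)
destruct (pow_lt_1_zero q) with (y := 1 / 4) as [N HN];
  [rewrite Rabs_pos_eq; lra|lra|].
specialize (HN N (le_n N)). rewrite Rabs_pos_eq in HN by apply Hqn.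
destruct (Hn N) as [e [He He0]].
assert (Hz : forall z, Cmod z < 1 / 2 -> F z = RtoC 0).
{ intros z Hz. apply (zero_near_extend a F (x N) e Ha (Hx1 N) He He0).
  pose proof (Cmod_triangle z (- x N)) as Ht. rewrite Cmod_opp in Ht.
  fold (z - x N)%C in Ht. rewrite Hxm in *. specialize (Hqn N). nra. }
apply pseries_zeros_coef with (1 / 2); [lra| |].
- apply pseries_abs_real with (F (RtoC (3 / 4))) (3 / 4); [lra|].
  apply Ha. rewrite Cmod_R, Rabs_pos_eq; lra.
- intros eps Heps. set (y := Rmin (eps / 2) (1 / 4)).
  assert (0 < y) by (apply Rmin_pos; lra).
  assert (y <= eps / 2) by apply Rmin_l. assert (y <= 1 / 4) by apply Rmin_r.
  assert (Hy : Cmod (RtoC y) = y) by (rewrite Cmod_R, Rabs_pos_eq; lra).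
  exists (RtoC y). split; [rewrite Hy; lra|].
  rewrite <- (Hz (RtoC y)) by (rewrite Hy; lra). apply Ha. rewrite Hy. lra.
Qed.

Lemma H2_identity (f : H2) (w : unit_disc) (eta : R) : 0 < eta ->
  (forall z : unit_disc, Cmod (z - w) < eta -> f z = RtoC 0) -> f = zero.
Proof.
intros Heta H0. apply H2_eq_coef. intros n.
change (coef f n = coef H2_zero n). rewrite coef_zero. revert n.
apply pseries_identity with (disc_extend f) (w : C) eta.
- intros z Hz. apply is_pseries_Cpow.
  replace (disc_extend f z) with (f (Unit_disc z Hz))
    by (symmetry; exact (disc_extend_eq f (Unit_disc z Hz))).
  exact (coef_pseries f (Unit_disc z Hz)).
- apply disc_lt1.
- exact Heta.
- intros z Hz. unfold disc_extend. destruct (Rlt_dec (Cmod z) 1) as [H|H]; [|easy].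
  now apply H0.
Qed.

(** * Linear spans *)

Lemma lin_span_plus {E : CompleteNormedModule C_AbsRing} (P : E -> Prop) (x y : E) :
  lin_span P x -> lin_span P y -> lin_span P (plus x y).
Proof.
intros Hx Hy. induction Hx as [|k x z Hxk Hz IH].
- now rewrite plus_zero_l.
- rewrite <- plus_assoc. now apply lin_span_cons.
Qed.

Lemma lin_span_scal {E : CompleteNormedModule C_AbsRing} (P : E -> Prop) (k : C) (x : E) :
  lin_span P x -> lin_span P (scal k x).
Proof.
intros Hx. induction Hx as [|l x z Hxk Hz IH].
- refine (eq_ind zero (lin_span P) (lin_span_zero P) _ (eq_sym _)).
  exact (scal_zero_r (V := CompleteNormedModule.ModuleSpace C_AbsRing E) k).
- refine (eq_ind _ (lin_span P) (lin_span_cons P (mult k l) x _ Hxk IH) _ (eq_sym _)).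
  etransitivity; [exact (scal_distr_l (V := CompleteNormedModule.ModuleSpace C_AbsRing E) k _ z)|].
  f_equal. exact (scal_assoc (V := CompleteNormedModule.ModuleSpace C_AbsRing E) k l x).
Qed.

Lemma lin_span_single {E : CompleteNormedModule C_AbsRing} (P : E -> Prop) (k : C) (x : E) :
  P x -> lin_span P (scal k x).
Proof.
intros Hx. rewrite <- (plus_zero_r (scal k x)).
exact (lin_span_cons P k x zero Hx (lin_span_zero P)).
Qed.

(** * Totality from orthogonality *)

Lemma exists_infimum {A : Type} (P : A -> Prop) (m : A -> R) :
  (exists x, P x) -> (forall x, 0 <= m x) ->
  exists d, 0 <= d /\ (forall x, P x -> d <= m x) /\
    forall eps, 0 < eps -> exists x, P x /\ m x < d + eps.
Proof.
intros [x0 Hx0] Hm.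
destruct (completeness (fun r => exists x, P x /\ r = - m x)) as [s [Hub Hlub]].
- exists 0. intros r [x [_ ->]]. specialize (Hm x). lra.
- now exists (- m x0), x0.
- exists (- s). split; [|split].
  + assert (s <= 0); [|lra]. apply Hlub. intros r [x [_ ->]]. specialize (Hm x). lra.
  + intros x Hx. assert (- m x <= s); [|lra]. apply Hub. now exists x.
  + intros eps Heps. apply NNPP. intros Hno.
    assert (s <= s - eps); [|lra]. apply Hlub. intros r [x [Hx ->]].
    apply Rnot_lt_le. intros Hlt. apply Hno. exists x. split; [exact Hx|lra].
Qed.

Lemma H2_norm_opp (f : H2) : H2_norm (opp f) = H2_norm f.
Proof. exact (norm_opp (V := H2_NormedModule) f). Qed.

Lemma H2_parallelogram (f g : H2) :
  H2_norm (plus f g) ^ 2 + H2_norm (minus f g) ^ 2 = 2 * H2_norm f ^ 2 + 2 * H2_norm g ^ 2.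
Proof.
unfold minus. rewrite !H2_norm_plus_sqr, H2_norm_opp.
assert (E : H2_inner f (opp g) = (- H2_inner f g)%C).
{ replace (opp g) with (scal (- RtoC 1)%C g).
  - rewrite H2_inner_scal_r.
    replace (Cconj (- RtoC 1)) with (- RtoC 1)%C
      by (apply injective_projections; simpl; ring). ring.
  - apply H2_eq. intros z. change ((- RtoC 1 * g z)%C = (- g z)%C). ring. }
rewrite E. simpl. ring.
Qed.

Lemma H2_norm_triangle_minus (f g h : H2) :
  H2_norm (minus f h) <= H2_norm (minus f g) + H2_norm (minus g h).
Proof. rewrite (minus_trans g f h). apply H2_norm_triangle. Qed.

(** The midpoint [u] of [y] and [z] lies in the span, so its distance to [x] is at least [d]; the
    parallelogram law then gives [|y - z| ^ 2 <= 4 * (d + e) ^ 2 - 4 * d ^ 2]. *)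
Lemma minimizing_sequence_cauchy (P : H2 -> Prop) (x y z : H2) (d e : R) :
  (forall u, lin_span P u -> d <= H2_norm (minus u x)) -> 0 <= d -> 0 <= e ->
  lin_span P y -> lin_span P z ->
  H2_norm (minus y x) <= d + e -> H2_norm (minus z x) <= d + e ->
  H2_norm (minus y z) ^ 2 <= 8 * d * e + 4 * e ^ 2.
Proof.
intros Hd Hd0 He Hy Hz Hyx Hzx.
pose proof (H2_parallelogram (minus y x) (minus z x)) as Hp.
assert (E1 : minus (minus y x : H2) (minus z x : H2) = minus y z).
{ apply H2_eq. intros w. change (y w + - x w + - (z w + - x w) = y w + - z w)%C. ring. }
set (u := scal (RtoC (/ 2)) (plus y z) : H2).
assert (E2 : plus (minus y x : H2) (minus z x : H2) = scal (RtoC 2) (minus u x)).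
{ apply H2_eq. intros w.
  change (y w + - x w + (z w + - x w) = 2 * (RtoC (/ 2) * (y w + z w) + - x w))%C.
  rewrite RtoC_inv by lra. field. }
assert (Hu : d <= H2_norm (minus u x)).
{ apply Hd. apply (lin_span_scal P). now apply (lin_span_plus P). }
rewrite E1, E2, H2_norm_scal, Cmod_R, Rabs_pos_eq in Hp by lra.
pose proof (H2_norm_ge_0 (minus y x)). pose proof (H2_norm_ge_0 (minus z x)).
assert (H1 : H2_norm (minus y x) ^ 2 <= (d + e) ^ 2) by (apply pow_incr; lra).
assert (H2 : H2_norm (minus z x) ^ 2 <= (d + e) ^ 2) by (apply pow_incr; lra).
assert (H3 : d ^ 2 <= H2_norm (minus u x) ^ 2) by (apply pow_incr; lra).
nra.
Qed.

(* A minimizing sequence in the span for the distance to [x] converges; the error at the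
   limit is orthogonal to [P]. *)
Lemma total_of_orthogonal (P : H2 -> Prop) :
  (forall y, (forall u, P u -> H2_inner y u = RtoC 0) -> y = zero) ->
  total (E := H2_CompleteNormedModule) P.
Proof.
intros Horth x.
destruct (exists_infimum (lin_span (E := H2_CompleteNormedModule) P)
  (fun u => H2_norm (minus u x))) as [d [Hd0 [Hd Hinf]]].
- exists zero. apply lin_span_zero.
- intros u. apply H2_norm_ge_0.
(* An excess of [(/ 4) ^ n] makes the squared steps at most [(8 * d + 4) * (/ 4) ^ n], so the steps
   themselves are at most [c * (/ 2) ^ n], which is summable. *)
- assert (Hy : forall n, exists u, lin_span (E := H2_CompleteNormedModule) P u /\
    H2_norm (minus u x) < d + (/ 4) ^ n).
  { intros n. apply Hinf. apply pow_lt. lra. }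
  set (y := fun n => proj1_sig (constructive_indefinite_description _ (Hy n))).
  assert (Hyn : forall n, lin_span (E := H2_CompleteNormedModule) P (y n) /\
    H2_norm (minus (y n) x) < d + (/ 4) ^ n).
  { intros n. exact (proj2_sig (constructive_indefinite_description _ (Hy n))). }
  clearbody y.
  assert (H4 : forall n, 0 < (/ 4) ^ n <= 1).
  { intros n. split; [apply pow_lt; lra|]. rewrite <- (pow1 n). apply pow_incr. lra. }
  set (c := sqrt (8 * d + 4)).
  assert (Hstep : forall n, H2_norm (minus (y (S n)) (y n)) <= c * (/ 2) ^ n).
  { intros n. rewrite H2_norm_minus_sym.
    assert (H : H2_norm (minus (y n) (y (S n))) ^ 2 <= (c * (/ 2) ^ n) ^ 2).
    - replace ((c * (/ 2) ^ n) ^ 2) with ((8 * d + 4) * (/ 4) ^ n).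
      + pose proof (H4 n).
        eapply Rle_trans; [apply (minimizing_sequence_cauchy P x _ _ d ((/ 4) ^ n) Hd)|].
        * exact Hd0.
        * lra.
        * apply Hyn.
        * apply Hyn.
        * left. apply Hyn.
        * left. eapply Rlt_le_trans; [apply Hyn|]. simpl pow. lra.
        * nra.
      + rewrite Rpow_mult_distr. unfold c. rewrite pow2_sqrt by lra.
        rewrite <- pow_mult, Nat.mul_comm, pow_mult. do 2 f_equal. field.
    - apply Rsqr_incr_0; [now rewrite !Rsqr_pow2|apply H2_norm_ge_0|].
      apply Rmult_le_pos; [apply sqrt_pos|apply pow_le; lra]. }
  (* Completeness enters through this absolutely convergent telescoping series; the limit of [y] is
     then [l + y 0]. *)
  assert (Hex : ex_series (V := H2_CompleteNormedModule) (fun n => minus (y (S n)) (y n))).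
  { apply (ex_series_le (V := H2_CompleteNormedModule) _ (fun n => c * (/ 2) ^ n)).
      exact Hstep.
    apply (ex_series_scal (V := R_NormedModule)), ex_series_geom.
    rewrite Rabs_pos_eq; lra. }
  destruct Hex as [l Hl]. set (p := plus l (y 0%nat) : H2).
  assert (Hsum : forall n, minus (y (S n)) p
    = minus (sum_n (fun n => minus (y (S n)) (y n)) n) l).
  { intros n.
    assert (E : sum_n (fun n => minus (y (S n)) (y n)) n = minus (y (S n)) (y 0%nat)).
    { induction n; [now rewrite sum_O|]. rewrite sum_Sn, IHn. apply H2_eq. intros w.
      change (y (S n) w + - y 0%nat w + (y (S (S n)) w + - y (S n) w)
        = y (S (S n)) w + - y 0%nat w)%C. ring. }
    rewrite E. apply H2_eq. intros w.
    change (y (S n) w + - (l w + y 0%nat w) = y (S n) w + - y 0%nat w + - l w)%C. ring. }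
  assert (Hlim : forall eps, 0 < eps -> exists n, H2_norm (minus (y n) p) < eps /\
    H2_norm (minus (y n) x) < d + eps).
  { intros eps Heps.
    destruct (proj1 (is_series_norm _ _) Hl (mkposreal _ Heps)) as [N HN].
    destruct (pow_lt_1_zero (/ 4)) with (y := eps) as [N' HN'];
      [rewrite Rabs_pos_eq; lra|lra|].
    set (n := Nat.max N N'). specialize (HN n ltac:(lia)).
    specialize (HN' (S n) ltac:(lia)). rewrite Rabs_pos_eq in HN' by (apply Rlt_le, H4).
    exists (S n). split.
    - rewrite Hsum. exact HN.
    - eapply Rlt_trans; [apply Hyn|]. lra. }
  assert (Hr : H2_norm (minus p x) <= d).
  { apply le_epsilon. intros eps Heps. destruct (Hlim (eps / 2)) as [n [H1 H2']]; [lra|].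
    pose proof (H2_norm_triangle_minus p (y n) x) as Ht.
    rewrite (H2_norm_minus_sym p (y n)) in Ht.
    replace (d + eps) with (eps / 2 + (d + eps / 2)) by field.
    apply Rle_trans with (1 := Ht). apply Rplus_le_compat; now apply Rlt_le. }
  (* The limit [p] need not lie in the span, so minimality of [d] is applied to [y n + k u] and
     passed to the limit. *)
  assert (Hmin : forall k u, P u -> d <= H2_norm (plus (minus p x : H2) (scal k u : H2))).
  { intros k u Hu. apply le_epsilon. intros eps Heps.
    destruct (Hlim eps Heps) as [n [H1 _]].
    assert (H : d <= H2_norm (minus (plus (y n) (scal k u : H2) : H2) x)).
    { apply Hd. apply (lin_span_plus P); [apply Hyn|]. now apply (lin_span_single P). }
    replace (minus (plus (y n) (scal k u : H2) : H2) x)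
      with (plus (minus (y n) p : H2) (plus (minus p x : H2) (scal k u : H2) : H2)) in H.
    - eapply Rle_trans; [exact H|]. eapply Rle_trans; [apply H2_norm_triangle|]. lra.
    - apply H2_eq. intros w.
      change (y n w + - p w + (p w + - x w + k * u w) = y n w + k * u w + - x w)%C. ring. }
  assert (E : minus p x = zero).
  { apply Horth. intros u Hu. apply H2_orthogonal_of_minimal. intros k.
    pose proof (H2_norm_ge_0 (minus p x)).
    apply pow_incr. split; [easy|]. eapply Rle_trans; [exact Hr|]. now apply Hmin. }
  intros eps Heps. destruct (Hlim eps Heps) as [n [H1 _]].
  exists (y n). split; [apply Hyn|].
  change (H2_norm (minus (y n) x) < eps).
  assert (E0 : H2_norm (minus p x) = 0) by (rewrite E; exact H2_norm_zero).
  pose proof (H2_norm_triangle_minus (y n) p x) as Ht. rewrite E0, Rplus_0_r in Ht.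
  exact (Rle_lt_trans _ _ _ Ht H1).
Qed.

(** * Rich point spectrum of the adjoint *)

(** Being close to its linear part makes the local sum Lipschitz at the centre, with constant below
    [L]. *)
Lemma disc_continuous (phi : unit_disc -> C) (w : unit_disc) (eps : R) :
  analytic_on_disc phi -> 0 < eps ->
  exists eta, 0 < eta /\ forall z : unit_disc, Cmod (z - w) < eta ->
    Cmod (phi z - phi w) < eps.
Proof.
intros Hphi Heps. pose proof (disc_extend_analytic phi Hphi w (disc_lt1 w)) as H.
destruct H as [b [r [Hr Hb]]].
set (F := fun h => disc_extend phi (w + h)%C).
assert (Hs : 0 < r / 2 < r) by lra.
set (B := Series (fun n => Cmod (b n) * (r / 2) ^ n)).
set (L := 2 * (r / 4) / (r / 2) ^ 2 * B + Cmod (b 1%nat) + 1).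
pose proof (pseries_near_linear b F r (r / 2) (r / 4) Hs Hb ltac:(lra)) as Hlin.
fold B in Hlin.
assert (HB : 0 <= B).
{ apply Series_nonneg.
  - intros n. apply Rmult_le_pos; [apply Cmod_ge_0|apply pow_le; lra].
  - apply pseries_abs_real with (F (RtoC (3 / 4 * r))) (3 / 4 * r); [lra|].
    apply Hb. rewrite Cmod_R, Rabs_pos_eq; lra. }
assert (HL : 0 < L).
{ unfold L. pose proof (Cmod_ge_0 (b 1%nat)).
  assert (0 <= 2 * (r / 4) / (r / 2) ^ 2 * B); [|lra].
  apply Rmult_le_pos; [|exact HB]. apply Rdiv_le_0_compat; [lra|apply pow_lt; lra]. }
exists (Rmin (r / 4) (eps / L)). split.
{ apply Rmin_pos; [lra|now apply Rdiv_lt_0_compat]. }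
intros z Hz.
assert (H1 : Cmod (z - w) < r / 4) by (eapply Rlt_le_trans; [exact Hz|apply Rmin_l]).
assert (H2 : Cmod (z - w) < eps / L) by (eapply Rlt_le_trans; [exact Hz|apply Rmin_r]).
rewrite <- (disc_extend_eq phi z), <- (disc_extend_eq phi w).
set (h := (z - w)%C) in *.
replace (disc_extend phi z) with (F h) by (unfold F, h; f_equal; ring).
replace (disc_extend phi w) with (F 0) by (unfold F; f_equal; ring).
specialize (Hlin h 0 ltac:(lra) ltac:(rewrite Cmod_0; lra)).
replace (h - 0)%C with h in Hlin by ring.
replace (F h - F 0)%C with (F h - F 0 - b 1%nat * h + b 1%nat * h)%C by ring.
eapply Rle_lt_trans; [apply Cmod_triangle|]. rewrite Cmod_mult.
apply Rle_lt_trans with (L * Cmod h).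
- unfold L. pose proof (Cmod_ge_0 h). nra.
- apply Rlt_le_trans with (L * (eps / L)); [now apply Rmult_lt_compat_l|].
  right. field. lra.
Qed.

Theorem theorem7p2 (phi : unit_disc -> C)
  (phi_analytic : analytic_on_disc phi)
  (phi_bounded : bounded_on_disc phi)
  (phi_nonconstant : ~ constant_on_disc phi) :
  exists T Tstar : H2 -> H2,
    analytic_toeplitz phi T /\
    adjoint_of T Tstar /\
    rich_point_spectrum Tstar.
Proof.
destruct (analytic_toeplitz_exists phi phi_analytic phi_bounded) as [T HT].
destruct (adjoint_exists T (proj1 HT)) as [S HS].
exists T, S. split; [exact HT|]. split; [exact HS|].
pose proof (fun w => kernel_eigenvector phi T S w HT HS) as Heig.
split; [exact (proj1 HS)|]. split.
- destruct (global_pseries phi phi_analytic phi_bounded) as [a Ha].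
  destruct (range_contains_disc phi a Ha phi_nonconstant) as [c [r [Hr Hc]]].
  exists (Cconj c), r. split; [exact Hr|]. intros z Hz.
  destruct (Hc (Cconj z)) as [w Hw].
  { rewrite <- Cmod_conj, Cminus_conj, Cconj_conj. exact Hz. }
  exists (H2_kernel w). split; [apply H2_kernel_neq0|].
  rewrite <- (Cconj_conj z), <- Hw. apply Heig.
- intros c r Hr Hsp.
  assert (Hmeet : exists w, Cmod (Cconj (phi w) - c) < r).
  { apply NNPP. intros Hno.
    apply (eigenvalue_near_range phi T S c r phi_analytic HT HS Hr).
    - intros w. apply Rnot_lt_le. intros Hlt. apply Hno. now exists w.
    - apply Hsp. unfold open_disc, Cminus. rewrite Cplus_opp_r, Cmod_0. exact Hr. }
  destruct Hmeet as [w Hw].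
  destruct (disc_continuous phi w (r - Cmod (Cconj (phi w) - c)) phi_analytic)
    as [eta [Heta Hnear]]; [lra|].
  apply total_of_orthogonal. intros y Hy.
  apply (H2_identity y w eta Heta). intros z Hz.
  rewrite <- H2_inner_kernel. apply Hy.
  exists (Cconj (phi z)). split; [|apply Heig].
  unfold open_disc.
  replace (Cconj (phi z) - c)%C with (Cconj (phi z - phi w) + (Cconj (phi w) - c))%C
    by (rewrite Cminus_conj; ring).
  eapply Rle_lt_trans; [apply Cmod_triangle|]. rewrite Cmod_conj.
  specialize (Hnear z Hz). lra.
Qed.
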